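(* Let $\mathbf{k}$ be an algebraically closed field and let $u,v\geq 1$ be integers. In $\mathrm{D}^b(N(2u+v,u+v+1))$ consider the following complexes of projective modules (concentrated in degrees $-1,0,1$, with $P_{u+v+1}$ in degree $0$): $$E_i=(0\to P_{u+v+1}\xrightarrow{\ \xi_{u+v+1,u+v+1+i}\ }P_{u+v+1+i}),\quad 1\leq i\leq u-1;$$ $$F_j=(P_{j}\xrightarrow{\ \xi_{j,u+v+1}\ }P_{u+v+1}\to 0),\quad u\leq j\leq u+v;$$ $$G_l=(P_{l}\xrightarrow{\ \xi_{l,u+v+1}\ }P_{u+v+1}\xrightarrow{\ \xi_{u+v+1,u+v+1+l}\ }P_{u+v+1+l}),\quad 1\leq l\leq u-1.$$ Let $$T(u)_{v}=P_{u+v+1}\oplus\Big(\bigoplus_{i=1}^{u-1} E_i\Big)\oplus\Big(\bigoplus_{j=u}^{u+v} F_j\Big)\oplus\Big(\bigoplus_{l=1}^{u-1} G_l\Big).$$ Then $T(u)_{v}$ is a tilting object in $\mathrm{D}^{b}(N(2u+v,u+v+1))$, whose endomorphism algebra is isomorphic to the one-branch extension algebra $A(u)_{v}$.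
   Context: $N(n,r)$ is the Nakayama algebra given as the path algebra over $\mathbf{k}$ of the quiver $1\leftarrow 2\leftarrow\cdots\leftarrow n$ modulo the ideal generated by all paths of length $r$ (if $r=n$ it is the path algebra itself). Paths are composed like functions, so that left modules are representations of the quiver; $P_a$ is the indecomposable projective left module at vertex $a$ (so $P_1$ is simple). $\mathrm{D}^b(A)$ is the bounded derived category of finitely generated left $A$-modules, with modules viewed as complexes in degree $0$. For $N(n,r)$, $\dim_{\mathbf{k}}\mathrm{Hom}(P_a,P_b)=1$ if $a\le b<a+r$ and $0$ otherwise. Fix a nonzero $\xi_a\in\mathrm{Hom}(P_a,P_{a+1})$ for $1\le a\le n-1$ and put $\xi_{a,b}=\xi_{b-1}\cdots\xi_{a+1}\xi_a:P_a\to P_b$ for $a<b$, and $\xi_{a,a}=\mathrm{id}_{P_a}$; $\xi_{a,b}$ is a basis of $\mathrm{Hom}(P_a,P_b)$ if $a\le b<a+r$ and is zero for $b\ge a+r$. An object $T$ of $\mathrm{D}^b(A)$ is tilting if $\mathrm{Hom}(T,T[k])=0$ for all $k\neq0$ and $T$ generates $\mathrm{D}^b(A)$ as a thick triangulated subcategory. Endomorphism algebras are taken with usual composition of maps, so (with paths composed like functions) arrows of the quiver of the endomorphism algebra point in the direction of the morphisms between indecomposable summands. $A(u)_v$ is the algebra over $\mathbf{k}$ of the following quiver with relations: vertices $t_1,\dots,t_u$, $b_1,\dots,b_u$, $c_1,\dots,c_v$; arrows $t_i\to t_{i+1}$ and $b_i\to b_{i+1}$ ($1\le i\le u-1$), $t_i\to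 b_i$ ($1\le i\le u$), $b_u\to c_1$, and $c_i\to c_{i+1}$ ($1\le i\le v-1$); relations: each square $t_i,t_{i+1},b_i,b_{i+1}$ commutes. *)

(* Defs.v *)
From HB Require Import structures.
From mathcomp Require Import all_boot all_algebra.
From mathcomp Require Import generic_quotient ring_quotient boolp.
From mathcomp Require Import finmap monalg zify.

Set Implicit Arguments.
Unset Strict Implicit.
Unset Printing Implicit Defensive.

Import GRing.Theory Quotient.
Local Open Scope ring_scope.
Local Open Scope quotient_scope.

(* The library's algType excludes the zero ring, which a quotient by an        *)
(* arbitrary ideal may be; hence the description of a k-algebra as a ring with *)
(* a ring morphism from k to its centre.                                       *)
Record kalgType (k : fieldType) := KAlg {
  kalg_ring :> pzRingType;
  kalg_map : {rmorphism k -> kalg_ring};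
  kalg_mapC : forall c x, kalg_map c * x = x * kalg_map c }.

(* A finite quiver without multiple arrows. *)
Record quiver := Quiver { vertex :> finType; arrow : rel vertex }.

Lemma bilinear_assoc (k : fieldType) (V : lmodType k) (T : Type) (U : T -> V)
    (m : V -> V -> V) :
  left_distributive m +%R -> right_distributive m +%R ->
  (forall c f g, m (c *: f) g = c *: m f g) ->
  (forall c f g, m f (c *: g) = c *: m f g) ->
  (forall P : V -> Prop, P 0 -> (forall f g, P f -> P g -> P (f + g)) ->
     (forall c f, P f -> P (c *: f)) -> (forall t, P (U t)) -> forall f, P f) ->
  (forall p q r, m (U p) (m (U q) (U r)) = m (m (U p) (U q)) (U r)) ->
  associative m.
Proof.
move=> mDl mDr mZl mZr ind mU.
have m0l g : m 0 g = 0 by rewrite -(scale0r 0) mZl !scale0r.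
have m0r g : m g 0 = 0 by rewrite -(scale0r 0) mZr !scale0r.
move=> f g h; elim/ind: f => [|f f' Ef Ef'|c f Ef|p].
- by rewrite !m0l.
- by rewrite !mDl Ef Ef'.
- by rewrite !mZl Ef.
elim/ind: g => [|f f' Ef Ef'|c f Ef|q].
- by rewrite m0l m0r m0l.
- by rewrite mDl !mDr mDl Ef Ef'.
- by rewrite mZl !mZr mZl Ef.
elim/ind: h => [|f f' Ef Ef'|c f Ef|r] //.
- by rewrite !m0r.
- by rewrite !mDr Ef Ef'.
- by rewrite !mZr Ef.
Qed.

Section PathAlgebra.
Variables (k : fieldType) (Q : quiver).

(* (x, [:: x1; ...; xn]) is the path x -> x1 -> ... -> xn of length n. *)
Definition qpath := {w : Q * seq Q | path (@arrow Q) w.1 w.2}.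

Definition pathAlg := {malg k[qpath]}.
HB.instance Definition _ := GRing.Lmodule.on pathAlg.

Definition path_elt (x : Q) (p : seq Q) : pathAlg :=
  if insub (x, p) is Some w then mkmalgU (w : qpath) 1 else 0.

(* Paths are composed like functions: p * q is q followed by p. *)
Definition path_comp (p q : qpath) : pathAlg :=
  if (val p).1 == last (val q).1 (val q).2
  then path_elt (val q).1 ((val q).2 ++ (val p).2) else 0.

Definition pathAlg_one : pathAlg := \sum_(x : Q) path_elt x [::].
Definition pathAlg_mul (f g : pathAlg) : pathAlg :=
  \sum_(p <- msupp f) \sum_(q <- msupp g)
     (mcoeff p f * mcoeff q g) *: path_comp p q.

Lemma pathAlg_sumw (D : {fset qpath}) (f : pathAlg) (F : qpath -> k -> pathAlg) :
  (forall p, F p 0 = 0) -> (msupp f `<=` D)%fset ->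
  \sum_(p <- msupp f) F p (mcoeff p f) = \sum_(p <- D) F p (mcoeff p f).
Proof.
move=> F0 sD; apply: big_fset_incl => // p _.
by rewrite -mcoeff_eq0 => /eqP ->.
Qed.

Lemma pathAlg_mulEw (D E : {fset qpath}) f g :
  (msupp f `<=` D)%fset -> (msupp g `<=` E)%fset ->
  pathAlg_mul f g = \sum_(p <- D) \sum_(q <- E)
     (mcoeff p f * mcoeff q g) *: path_comp p q.
Proof.
move=> sD sE; rewrite /pathAlg_mul.
rewrite (pathAlg_sumw (F := fun p c => \sum_(q <- msupp g)
  (c * mcoeff q g) *: path_comp p q) _ sD); last first.
  by move=> p; rewrite big1 // => q _; rewrite mul0r scale0r.
apply: eq_bigr => p _.
rewrite (pathAlg_sumw (F := fun q c => (mcoeff p f * c) *: path_comp p q) _ sE)//.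
by move=> q; rewrite mulr0 scale0r.
Qed.

Lemma pathAlg_mulDl : left_distributive pathAlg_mul +%R.
Proof.
move=> f g h.
pose D := (msupp f `|` msupp g)%fset.
rewrite (@pathAlg_mulEw D (msupp h)) ?fsubset_refl ?msuppD_le //.
rewrite (@pathAlg_mulEw D (msupp h) f) ?fsubset_refl ?fsubsetUl //.
rewrite (@pathAlg_mulEw D (msupp h) g) ?fsubset_refl ?fsubsetUr //.
rewrite -big_split /=; apply: eq_bigr => p _; rewrite -big_split /=.
by apply: eq_bigr => q _; rewrite mcoeffD mulrDl scalerDl.
Qed.

Lemma pathAlg_mulDr : right_distributive pathAlg_mul +%R.
Proof.
move=> h f g.
pose D := (msupp f `|` msupp g)%fset.
rewrite (@pathAlg_mulEw (msupp h) D) ?fsubset_refl ?msuppD_le //.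
rewrite (@pathAlg_mulEw (msupp h) D _ f) ?fsubset_refl ?fsubsetUl //.
rewrite (@pathAlg_mulEw (msupp h) D _ g) ?fsubset_refl ?fsubsetUr //.
rewrite -big_split /=; apply: eq_bigr => p _; rewrite -big_split /=.
by apply: eq_bigr => q _; rewrite mcoeffD mulrDr scalerDl.
Qed.

Lemma pathAlg_mulZl c f g : pathAlg_mul (c *: f) g = c *: pathAlg_mul f g.
Proof.
rewrite (@pathAlg_mulEw (msupp f) (msupp g)) ?fsubset_refl ?msuppZ_le //.
rewrite /pathAlg_mul scaler_sumr; apply: eq_bigr => p _; rewrite scaler_sumr.
by apply: eq_bigr => q _; rewrite mcoeffZ scalerA mulrA.
Qed.

Lemma pathAlg_mulZr c f g : pathAlg_mul f (c *: g) = c *: pathAlg_mul f g.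
Proof.
rewrite (@pathAlg_mulEw (msupp f) (msupp g)) ?fsubset_refl ?msuppZ_le //.
rewrite /pathAlg_mul scaler_sumr; apply: eq_bigr => p _; rewrite scaler_sumr.
by apply: eq_bigr => q _; rewrite mcoeffZ scalerA mulrCA mulrA.
Qed.

Lemma pathAlg_mul0l f : pathAlg_mul 0 f = 0.
Proof. by rewrite -(scale0r 0) pathAlg_mulZl !scale0r. Qed.

Lemma pathAlg_mul0r f : pathAlg_mul f 0 = 0.
Proof. by rewrite -(scale0r 0) pathAlg_mulZr !scale0r. Qed.

Lemma pathAlg_sumE (f : pathAlg) :
  f = \sum_(p <- msupp f) mcoeff p f *: mkmalgU p 1.
Proof.
rewrite {1}[f]monalgE; apply: eq_bigr => p _.
apply/malgP=> q; rewrite [RHS]mcoeffZ [LHS]mcoeffU.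
rewrite [X in _ * X]mcoeffU [RHS]mulrnAr.
by rewrite mulr1.
Qed.

Lemma pathAlg_ind (P : pathAlg -> Prop) :
  P 0 -> (forall f g, P f -> P g -> P (f + g)) ->
  (forall c f, P f -> P (c *: f)) -> (forall p, P (mkmalgU p 1)) ->
  forall f, P f.
Proof.
move=> P0 PD PZ PU f; rewrite [f]pathAlg_sumE.
by apply: big_ind => // p _; apply: PZ.
Qed.

Lemma pathAlg_mulU p q :
  pathAlg_mul (mkmalgU p 1) (mkmalgU q 1) = path_comp p q.
Proof.
rewrite (@pathAlg_mulEw [fset p]%fset [fset q]%fset) ?msuppU_le //.
by rewrite !big_seq_fset1 !mcoeffUU mulr1 scale1r.
Qed.

Lemma path_eltE (p : qpath) : path_elt (val p).1 (val p).2 = mkmalgU p 1.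
Proof.
rewrite /path_elt -surjective_pairing; case: insubP => [w _ /val_inj -> //|].
by rewrite (valP p).
Qed.

Lemma path_elt_mul x p y q : path (@arrow Q) x p -> path (@arrow Q) y q ->
  pathAlg_mul (path_elt x p) (path_elt y q) =
  if x == last y q then path_elt y (q ++ p) else 0.
Proof.
move=> xp yq.
pose w1 : qpath := Sub (x, p) xp; pose w2 : qpath := Sub (y, q) yq.
by rewrite (path_eltE w1) (path_eltE w2) pathAlg_mulU /path_comp.
Qed.

Lemma path_elt0 x p : ~~ path (@arrow Q) x p -> path_elt x p = 0.
Proof. by move=> n; rewrite /path_elt insubF //; apply/negbTE. Qed.

Lemma pathAlg_mulAU p q r :
  pathAlg_mul (mkmalgU p 1) (pathAlg_mul (mkmalgU q 1) (mkmalgU r 1)) =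
  pathAlg_mul (pathAlg_mul (mkmalgU p 1) (mkmalgU q 1)) (mkmalgU r 1).
Proof.
case: p q r => [[x p] xp] [[y q] yq] [[z r] zr].
rewrite -!path_eltE /=; rewrite /= in xp yq zr.
rewrite (path_elt_mul xp yq) (path_elt_mul yq zr).
case: (x =P last y q) => [xy|nxy]; case: (y =P last z r) => [yz|nyz].
- rewrite path_elt_mul //; last by rewrite cat_path zr -yz.
  rewrite path_elt_mul //; last by rewrite cat_path yq -xy.
  by rewrite last_cat -yz -xy !eqxx catA.
- rewrite pathAlg_mul0r path_elt_mul //; last by rewrite cat_path yq -xy.
  by move/eqP/negbTE: nyz ->.
- rewrite pathAlg_mul0l path_elt_mul //; last by rewrite cat_path zr -yz.
  by rewrite last_cat -yz; move/eqP/negbTE: nxy ->.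
- by rewrite pathAlg_mul0l pathAlg_mul0r.
Qed.

Lemma pathAlg_mulA : associative pathAlg_mul.
Proof.
exact: (bilinear_assoc pathAlg_mulDl pathAlg_mulDr pathAlg_mulZl pathAlg_mulZr
          pathAlg_ind pathAlg_mulAU).
Qed.

Lemma pathAlg_sum_mull (I : finType) (F : I -> pathAlg) g :
  pathAlg_mul (\sum_i F i) g = \sum_i pathAlg_mul (F i) g.
Proof.
apply: (big_morph (fun f => pathAlg_mul f g)); last exact: pathAlg_mul0l.
by move=> f f'; rewrite pathAlg_mulDl.
Qed.

Lemma pathAlg_sum_mulr (I : finType) (F : I -> pathAlg) g :
  pathAlg_mul g (\sum_i F i) = \sum_i pathAlg_mul g (F i).
Proof.
apply: (big_morph (fun f => pathAlg_mul g f)); last exact: pathAlg_mul0r.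
by move=> f f'; rewrite pathAlg_mulDr.
Qed.

Lemma pathAlg_mul1l : left_id pathAlg_one pathAlg_mul.
Proof.
apply: pathAlg_ind.
- by rewrite pathAlg_mul0r.
- by move=> f f' Ef Ef'; rewrite pathAlg_mulDr Ef Ef'.
- by move=> c f Ef; rewrite pathAlg_mulZr Ef.
case=> [[x p] xp]; rewrite -path_eltE /=; rewrite /= in xp.
rewrite pathAlg_sum_mull (bigD1 (last x p)) //= path_elt_mul // eqxx cats0.
by rewrite big1 ?addr0 // => y /negbTE nyx; rewrite path_elt_mul // nyx.
Qed.

Lemma pathAlg_mul1r : right_id pathAlg_one pathAlg_mul.
Proof.
apply: pathAlg_ind.
- by rewrite pathAlg_mul0l.
- by move=> f f' Ef Ef'; rewrite pathAlg_mulDl Ef Ef'.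
- by move=> c f Ef; rewrite pathAlg_mulZl Ef.
case=> [[x p] xp]; rewrite -path_eltE /=; rewrite /= in xp.
rewrite pathAlg_sum_mulr (bigD1 x) //= path_elt_mul // eqxx cat0s.
by rewrite big1 ?addr0 // => y nyx; rewrite path_elt_mul //= eq_sym (negbTE nyx).
Qed.

HB.instance Definition _ := GRing.Zmodule_isPzRing.Build pathAlg
  pathAlg_mulA pathAlg_mul1l pathAlg_mul1r pathAlg_mulDl pathAlg_mulDr.

End PathAlgebra.

(* The two-sided ideal generated by a set of elements. *)
Inductive gen_ideal (A : pzRingType) (R : A -> Prop) : A -> Prop :=
| gen_ideal_gen x of R x : gen_ideal R x
| gen_ideal0 : gen_ideal R 0
| gen_idealD x y of gen_ideal R x & gen_ideal R y : gen_ideal R (x + y)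
| gen_idealMl a x of gen_ideal R x : gen_ideal R (a * x)
| gen_idealMr a x of gen_ideal R x : gen_ideal R (x * a).

Section BoundQuiverAlgebra.
Variables (k : fieldType) (Q : quiver) (R : pathAlg k Q -> Prop).

Definition rel_ideal : {pred pathAlg k Q} := [pred x | `[< gen_ideal R x >]].

Lemma rel_idealP x : reflect (gen_ideal R x) (x \in rel_ideal).
Proof. exact: asboolP. Qed.

Lemma rel_ideal_zmod : zmod_closed rel_ideal.
Proof.
split=> [|x y /rel_idealP Ix /rel_idealP Iy]; apply/rel_idealP.
  exact: gen_ideal0.
by apply: gen_idealD => //; rewrite -mulN1r; apply: gen_idealMl.
Qed.
HB.instance Definition _ :=
  GRing.isZmodClosed.Build (pathAlg k Q) rel_ideal rel_ideal_zmod.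

Definition bqAlg := quot rel_ideal.
HB.instance Definition _ := GRing.Zmodule.on bqAlg.
HB.instance Definition _ := EqQuotient.on bqAlg.

Definition bqAlg_mk (x : pathAlg k Q) : bqAlg := \pi_(quot rel_ideal) x.

Lemma bqAlg_mkP x y : bqAlg_mk x = bqAlg_mk y <-> gen_ideal R (x - y).
Proof.
split=> [/eqP|/rel_idealP]; rewrite -?idealrBE; first by move/rel_idealP.
by move=> I; apply/eqP; rewrite -idealrBE.
Qed.

Lemma bqAlg_mkK x : bqAlg_mk (repr x) = x.
Proof. exact: reprK. Qed.

Lemma bqAlg_mkD : {morph bqAlg_mk : x y / x + y}.
Proof. by move=> x y; rewrite /bqAlg_mk !piE. Qed.

Definition bqAlg_mul (x y : bqAlg) : bqAlg := bqAlg_mk (repr x * repr y).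

Lemma bqAlg_mkM x y : bqAlg_mul (bqAlg_mk x) (bqAlg_mk y) = bqAlg_mk (x * y).
Proof.
rewrite /bqAlg_mul; set x' := repr _; set y' := repr _.
have Ix : gen_ideal R (x' - x) by apply/bqAlg_mkP; rewrite bqAlg_mkK.
have Iy : gen_ideal R (y' - y) by apply/bqAlg_mkP; rewrite bqAlg_mkK.
apply/bqAlg_mkP.
have -> : x' * y' - x * y = (x' - x) * y' + x * (y' - y).
  by rewrite mulrBl mulrBr addrA subrK.
by apply: gen_idealD; [apply: gen_idealMr|apply: gen_idealMl].
Qed.

Lemma bqAlg_mulA : associative bqAlg_mul.
Proof.
by move=> x y z; rewrite -[x]bqAlg_mkK -[y]bqAlg_mkK -[z]bqAlg_mkK !bqAlg_mkM mulrA.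
Qed.
Lemma bqAlg_mul1l : left_id (bqAlg_mk 1) bqAlg_mul.
Proof. by move=> x; rewrite -[x]bqAlg_mkK bqAlg_mkM mul1r. Qed.
Lemma bqAlg_mul1r : right_id (bqAlg_mk 1) bqAlg_mul.
Proof. by move=> x; rewrite -[x]bqAlg_mkK bqAlg_mkM mulr1. Qed.
Lemma bqAlg_mulDl : left_distributive bqAlg_mul +%R.
Proof.
move=> x y z; rewrite -[x]bqAlg_mkK -[y]bqAlg_mkK -[z]bqAlg_mkK.
by rewrite -bqAlg_mkD !bqAlg_mkM mulrDl bqAlg_mkD.
Qed.
Lemma bqAlg_mulDr : right_distributive bqAlg_mul +%R.
Proof.
move=> x y z; rewrite -[x]bqAlg_mkK -[y]bqAlg_mkK -[z]bqAlg_mkK.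
by rewrite -bqAlg_mkD !bqAlg_mkM mulrDr bqAlg_mkD.
Qed.

HB.instance Definition _ := GRing.Zmodule_isPzRing.Build bqAlg
  bqAlg_mulA bqAlg_mul1l bqAlg_mul1r bqAlg_mulDl bqAlg_mulDr.

Definition bqAlg_map (c : k) : bqAlg := bqAlg_mk (c *: (1 : pathAlg k Q)).

Lemma pathAlg_scaleE c (x : pathAlg k Q) : (c *: (1 : pathAlg k Q)) * x = c *: x.
Proof. rewrite -[in RHS](mul1r x); exact: pathAlg_mulZl. Qed.
Lemma pathAlg_scaleEr c (x : pathAlg k Q) : x * (c *: (1 : pathAlg k Q)) = c *: x.
Proof. rewrite -[in RHS](mulr1 x); exact: pathAlg_mulZr. Qed.

Lemma bqAlg_map_zmod : zmod_morphism bqAlg_map.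
Proof.
move=> c d; rewrite /bqAlg_map scalerBl; apply: (addIr (bqAlg_mk (d *: (1 : pathAlg k Q)))).
by rewrite -bqAlg_mkD !subrK.
Qed.
Lemma bqAlg_map_monoid : monoid_morphism bqAlg_map.
Proof.
split=> [|c d]; first by rewrite /bqAlg_map scale1r.
by rewrite [RHS]bqAlg_mkM pathAlg_scaleE scalerA.
Qed.
HB.instance Definition _ :=
  GRing.isZmodMorphism.Build k bqAlg bqAlg_map bqAlg_map_zmod.
HB.instance Definition _ :=
  GRing.isMonoidMorphism.Build k bqAlg bqAlg_map bqAlg_map_monoid.

Lemma bqAlg_mapC c x : bqAlg_map c * x = x * bqAlg_map c.
Proof.
by rewrite -[x]bqAlg_mkK [LHS]bqAlg_mkM [RHS]bqAlg_mkM pathAlg_scaleE pathAlg_scaleEr.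
Qed.

(* The path algebra k Q modulo the two-sided ideal generated by R. *)
Definition bound_quiver_alg : kalgType k := KAlg bqAlg_mapC.

End BoundQuiverAlgebra.

Section Modules.
Variables (k : fieldType) (A : kalgType k).

Definition fin_gen (M : lmodType A) : Prop :=
  exists (n : nat) (g : 'I_n -> M),
    forall x, exists c : 'I_n -> A, x = \sum_i c i *: g i.

Lemma fin_gen_prod (M N : lmodType A) :
  fin_gen M -> fin_gen N -> fin_gen (M * N)%type.
Proof.
move=> [m [g Hg]] [n [h Hh]]; exists (m + n)%N.
exists (fun i => match split i with inl j => (g j, 0) | inr j => (0, h j) end).
case=> x y; have [c ->] := Hg x; have [d ->] := Hh y.
exists (fun i => match split i with inl j => c j | inr j => d j end).
have El i : split (lshift n i) = inl i := @unsplitK m n (inl i).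
have Er i : split (rshift m i) = inr i := @unsplitK m n (inr i).
rewrite big_split_ord /=.
under [X in _ = X + _]eq_bigr => i _ do rewrite El.
under [X in _ = _ + X]eq_bigr => i _ do rewrite Er.
apply/pair_equal_spec; split.
  rewrite !raddf_sum /= [X in _ + X]big1 ?addr0 // => i _; exact: scaler0.
by rewrite !raddf_sum /= [X in X + _]big1 ?add0r // => i _; exact: scaler0.
Qed.

Definition zmod : lmodType A := 'rV[A]_0.

Lemma zmod_eq0 (x : zmod) : x = 0.
Proof. by apply/rowP; case. Qed.

Lemma fin_gen_zmod : fin_gen zmod.
Proof.
exists 0%N, (fun _ => 0) => x; exists (fun _ => 0).
by rewrite big_ord0; apply: zmod_eq0.
Qed.

Definition lin_pair_fun (M N P : lmodType A) (f : {linear M -> N})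
  (g : {linear M -> P}) (x : M) : N * P := (f x, g x).
Lemma lin_pair_linear M N P f g : linear (@lin_pair_fun M N P f g).
Proof. by move=> a x y; rewrite /lin_pair_fun !linearP. Qed.
HB.instance Definition _ (M N P : lmodType A) (f : {linear M -> N})
    (g : {linear M -> P}) :=
  GRing.isLinear.Build A M (N * P)%type *:%R (@lin_pair_fun M N P f g)
    (@lin_pair_linear M N P f g).
Definition lin_pair (M N P : lmodType A) (f : {linear M -> N})
  (g : {linear M -> P}) : {linear M -> (N * P)%type} := @lin_pair_fun M N P f g.

Definition lin_comp (M N P : lmodType A) (g : {linear N -> P})
  (f : {linear M -> N}) : {linear M -> P} := g \o f.

Definition lin_zero (M N : lmodType A) : {linear M -> N} := \0.

(* The k-linear structure on Hom_A(M, N). *)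
Definition lin_scale_fun (M N : lmodType A) (c : k) (f : {linear M -> N}) x :=
  kalg_map A c *: f x.
Lemma lin_scale_linear M N c f : linear (@lin_scale_fun M N c f).
Proof.
move=> a x y; rewrite /lin_scale_fun linearP scalerDr !scalerA.
by rewrite kalg_mapC.
Qed.
HB.instance Definition _ (M N : lmodType A) (c : k) (f : {linear M -> N}) :=
  GRing.isLinear.Build A M N *:%R (@lin_scale_fun M N c f)
    (@lin_scale_linear M N c f).
Definition lin_scale (M N : lmodType A) (c : k) (f : {linear M -> N}) : {linear M -> N} := @lin_scale_fun M N c f.

(* The identity X i -> X j if i = j, and 0 otherwise. *)
Definition tr (I : eqType) (X : I -> lmodType A) (i j : I) : {linear X i -> X j} :=
  match @eqP I i j with
  | ReflectT e =>
      match e in _ = j' return {linear X i -> X j'} with erefl => idfun end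
  | ReflectF _ => \0
  end.

Lemma tr_id (I : eqType) (X : I -> lmodType A) i x : tr X i i x = x.
Proof. by rewrite /tr; case: eqP => // e; rewrite (eq_axiomK e). Qed.

Lemma tr_neq (I : eqType) (X : I -> lmodType A) i j x : i != j -> tr X i j x = 0.
Proof. by rewrite /tr; case: eqP. Qed.

End Modules.

#[local] Obligation Tactic := idtac.

Section Complexes.
Variables (k : fieldType) (A : kalgType k).

(* Bounded complexes of finitely generated left A-modules. The differential is *)
(* given between any two degrees, but vanishes except from i to i + 1.         *)
Record cplx := Cplx {
  obj :> int -> lmodType A;
  diff : forall i j, {linear obj i -> obj j};
  diff_shape : forall i j x, j != i + 1 -> diff i j x = 0;
  diff_diff : forall i j l x, diff j l (diff i j x) = 0;
  obj_fg : forall i, fin_gen (obj i);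
  obj_bounded : exists N : nat, forall i, (N < absz i)%N -> forall x : obj i, x = 0
}.

Lemma tr_diff (X : cplx) (a b p q : int) (u : X a) : b = p + 1 ->
  tr X b q (diff X a b u) = diff X p q (tr X a p u).
Proof.
move=> ->; have [ap|nap] := eqVneq a p; last first.
  rewrite (tr_neq _ nap) linear0 diff_shape ?linear0 //.
  by apply: contra nap => /eqP /addIr ->.
subst p; rewrite tr_id; have [->|nq] := eqVneq q (a + 1); first by rewrite tr_id.
by rewrite tr_neq 1?eq_sym // diff_shape.
Qed.

Record cmap (X Y : cplx) := Cmap {
  cmap_fun :> forall i, {linear X i -> Y i};
  cmapP : forall i j x, cmap_fun j (diff X i j x) = diff Y i j (cmap_fun i x) }.

Lemma tr_cmap (X Y : cplx) (f : cmap X Y) i j x : tr Y i j (f i x) = f j (tr X i j x).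
Proof.
have [<-|n] := eqVneq i j; first by rewrite !tr_id.
by rewrite !tr_neq // linear0.
Qed.

Program Definition cmap_id X : cmap X X := @Cmap X X (fun i => idfun) _.
Next Obligation. by []. Qed.
Program Definition cmap_comp X Y Z (g : cmap Y Z) (f : cmap X Y) : cmap X Z :=
  @Cmap X Z (fun i => (g i \o f i : {linear _ -> _})) _.
Next Obligation. by move=> *; rewrite /= !cmapP. Qed.
Program Definition cmap_zero X Y : cmap X Y := @Cmap X Y (fun i => \0) _.
Next Obligation. by move=> *; rewrite linear0. Qed.
Program Definition cmap_add X Y (f g : cmap X Y) : cmap X Y :=
  @Cmap X Y (fun i => (f i \+ g i : {linear _ -> _})) _.
Next Obligation. by move=> *; rewrite /= !cmapP linearD. Qed.
Program Definition cmap_scale X Y c (f : cmap X Y) : cmap X Y :=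
  @Cmap X Y (fun i => lin_scale c (f i)) _.
Next Obligation.
by move=> *; rewrite /= /lin_scale_fun !cmapP linearZ.
Qed.

Definition homotopic X Y (f g : cmap X Y) : Prop :=
  exists h : forall i j, {linear X i -> Y j}, forall i x,
    f i x - g i x =
      diff Y (i - 1) i (h i (i - 1) x) + h (i + 1) i (diff X i (i + 1) x).

(* The two components say that the maps induced by f on cohomology are         *)
(* injective and surjective.                                                   *)
Definition qis X Y (f : cmap X Y) : Prop := forall i,
  (forall x, diff X i (i + 1) x = 0 ->
     (exists y, f i x = diff Y (i - 1) i y) -> exists x', x = diff X (i - 1) i x')
  /\
  (forall y, diff Y i (i + 1) y = 0 ->
     exists2 x, diff X i (i + 1) x = 0 &
                exists y', y - f i x = diff Y (i - 1) i y').

Lemma qis_id X : qis (cmap_id X).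
Proof.
move=> i; split=> [x _ //|y y0]; exists y => //.
by exists 0; rewrite linear0 /= subrr.
Qed.

Lemma qis_comp X Y Z (g : cmap Y Z) (f : cmap X Y) :
  qis g -> qis f -> qis (cmap_comp g f).
Proof.
move=> qg qf i; have [gi gs] := qg i; have [fi fs] := qf i; split.
  move=> x x0 Hx; apply: fi => //; apply: gi => //.
  by rewrite -cmapP x0 linear0.
move=> z /gs [y /fs [x x0 [y' Hy]] [z' Hz]]; exists x => //.
exists (z' + g (i - 1) y').
rewrite linearD -Hz -cmapP -Hy linearB /= addrA subrK //.
Qed.

Lemma cplx_bounded2 (X Y : cplx) : exists N : nat, forall i, (N < absz i)%N ->
  (forall x : X i, x = 0) /\ (forall y : Y i, y = 0).
Proof.
have [M HM] := obj_bounded X; have [N HN] := obj_bounded Y; exists (M + N)%N.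
by move=> i Hi; split; [apply: HM|apply: HN]; lia.
Qed.

Lemma cplx_bounded_shift (X : cplx) (n : int) : exists N : nat, forall i,
  (N < absz i)%N -> forall x : X (i + n), x = 0.
Proof.
have [N HN] := obj_bounded X; exists (N + absz n)%N.
by move=> i Hi; apply: HN; lia.
Qed.

Program Definition czero : cplx := @Cplx (fun _ => zmod A) (fun _ _ => \0) _ _ _ _.
Next Obligation. by []. Qed.
Next Obligation. by []. Qed.
Next Obligation. by move=> i; exact: fin_gen_zmod. Qed.
Next Obligation. by exists 0%N => i _ x; apply: zmod_eq0. Qed.

Program Definition shift (n : int) (X : cplx) : cplx :=
  @Cplx (fun i => X (i + n))
        (fun i j => lin_scale ((-1) ^+ absz n) (diff X (i + n) (j + n))) _ _ _ _.
Next Obligation.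
move=> n X i j x nij; rewrite /= /lin_scale_fun diff_shape ?scaler0 //.
by apply: contra nij; rewrite addrAC => /eqP /addIr ->.
Qed.
Next Obligation.
by move=> n X i j l x; rewrite /= /lin_scale_fun linearZ /= diff_diff !scaler0.
Qed.
Next Obligation. by move=> n X i; apply: obj_fg. Qed.
Next Obligation. by move=> n X; apply: cplx_bounded_shift. Qed.

Program Definition dsum2 (X Y : cplx) : cplx :=
  @Cplx (fun i => (X i * Y i)%type)
        (fun i j => lin_pair (diff X i j \o fst) (diff Y i j \o snd)) _ _ _ _.
Next Obligation.
by move=> X Y i j x nij; rewrite /= /lin_pair_fun /= !diff_shape.
Qed.
Next Obligation.
by move=> X Y i j l x; rewrite /= /lin_pair_fun /= !diff_diff.
Qed.
Next Obligation. by move=> X Y i; apply: fin_gen_prod; apply: obj_fg. Qed.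
Next Obligation.
move=> X Y; have [N HN] := cplx_bounded2 X Y; exists N => i /HN [HX HY] [x y].
by rewrite (HX x) (HY y).
Qed.

Definition dsum (s : seq cplx) : cplx := foldr dsum2 czero s.

(* d (x, y) = (- d x, f x + d y) *)
Program Definition cone X Y (f : cmap X Y) : cplx :=
  @Cplx (fun i => (X (i + 1)%R * Y i)%type)
        (fun i j => lin_pair (\- (diff X (i + 1) (j + 1)) \o fst)
           ((tr Y (i + 1) j \o f (i + 1) \o fst) \+ (diff Y i j \o snd))) _ _ _ _.
Next Obligation.
move=> X Y f i j [x y] nij; rewrite /= /lin_pair_fun /=.
rewrite !diff_shape // ?tr_neq 1?eq_sym ?oppr0 ?addr0 //.
by apply: contra nij => /eqP /addIr ->.
Qed.
Next Obligation.
move=> X Y f i j l [x y]; rewrite /= /lin_pair_fun /=.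
rewrite !linearN /= diff_diff linearD /= diff_diff addr0 oppr0.
by rewrite cmapP (@tr_diff Y (i + 1) (j + 1) j l) // addNr oppr0.
Qed.
Next Obligation. by move=> X Y f i; apply: fin_gen_prod; apply: obj_fg. Qed.
Next Obligation.
move=> X Y f; have [N HN] := cplx_bounded2 (shift 1 X) Y; exists N.
by move=> i /HN [HX HY] [x y]; rewrite (HX x) (HY y).
Qed.

(* The homotopy pullback of f and t: d (x, y, z) = (d x, d y, f x - t y - d z). *)
Program Definition hpb X Y Z (f : cmap X Z) (t : cmap Y Z) : cplx :=
  @Cplx (fun i => (X i * Y i * Z (i - 1)%R)%type)
        (fun i j => lin_pair
           (lin_pair (diff X i j \o fst \o fst) (diff Y i j \o snd \o fst))
           ((tr Z i (j - 1) \o ((f i \o fst) \- (t i \o snd)) \o fst)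
              \- (diff Z (i - 1) (j - 1) \o snd))) _ _ _ _.
Next Obligation.
move=> X Y Z f t i j [[x y] z] nij; rewrite /= /lin_pair_fun /= /lin_pair_fun /=.
have nij' : i != j - 1 by apply: contra nij => /eqP ->; rewrite subrK.
rewrite !diff_shape ?tr_neq ?subr0 //.
by rewrite subrK eq_sym.
Qed.
Next Obligation.
move=> X Y Z f t i j l [[x y] z]; rewrite /= /lin_pair_fun /= /lin_pair_fun /=.
rewrite !diff_diff !cmapP -linearB (@tr_diff Z i j (j - 1)) ?subrK //.
by rewrite [X in _ - X]linearB /= diff_diff subr0 subrr.
Qed.
Next Obligation.
by move=> X Y Z f t i; do 2?apply: fin_gen_prod; apply: obj_fg.
Qed.
Next Obligation.
move=> X Y Z f t; have [M HM] := cplx_bounded2 X Y.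
have [N HN] := cplx_bounded_shift Z (- 1); exists (M + N)%N.
move=> i Hi [[x y] z]; have [|HX HY] := HM i; first by lia.
by rewrite (HX x) (HY y) (HN i _ z) //; lia.
Qed.

Program Definition hpb1 X Y Z (f : cmap X Z) (t : cmap Y Z) : cmap (hpb f t) X :=
  @Cmap (hpb f t) X (fun i => fst \o fst) _.
Next Obligation. by []. Qed.
Program Definition hpb2 X Y Z (f : cmap X Z) (t : cmap Y Z) : cmap (hpb f t) Y :=
  @Cmap (hpb f t) Y (fun i => snd \o fst) _.
Next Obligation. by []. Qed.

End Complexes.
Section DerivedCategory.
Variables (k : fieldType) (A : kalgType k).
Implicit Types X Y Z W : cplx A.

Lemma diff0_cast X i j j' (x : X i) : j = j' -> diff X i j x = 0 -> diff X i j' x = 0.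
Proof. by move=> <-. Qed.

Lemma hpb_diff0 X Y Z (f : cmap X Z) (t : cmap Y Z) i j x y z : j = i + 1 ->
  diff (hpb f t) i j (x, y, z) = 0 <->
  [/\ diff X i j x = 0, diff Y i j y = 0 & f i x - t i y = diff Z (i - 1) i z].
Proof.
move=> ->; have E : (tr Z i (i + 1 - 1) (f i x - t i y)
    - diff Z (i - 1) (i + 1 - 1) z = 0) <-> (f i x - t i y = diff Z (i - 1) i z).
  move: (i + 1 - 1) (addrK 1 i) => i' ei; subst i'; rewrite tr_id.
  by split=> [/eqP|->]; rewrite ?subrr // subr_eq0 => /eqP.
split=> [[-> -> H]|[Hx Hy /E H]]; first by split=> //; apply/E.
by rewrite /= /lin_pair_fun /= /lin_pair_fun /= Hx Hy H.
Qed.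

Lemma qis_hpb1 X Y Z (f : cmap X Z) (t : cmap Y Z) : qis t -> qis (hpb1 f t).
Proof.
move=> qt i; split.
  move=> [[x y] z] /(hpb_diff0 _ _ _ _ _ erefl) [_ dy dz] [x1 /= Hx].
  have [ti _] := qt i; have [y0 Hy0] : exists y', y = diff Y (i - 1) i y'.
    apply: ti => //; exists (f (i - 1) x1 - z).
    by rewrite linearB -cmapP -Hx /= -dz opprB addrC subrK.
  have e : i - 1 + 1 = i by rewrite subrK.
  have [_ ts] := qt (i - 1).
  have [|y2 /(diff0_cast e) dy2 [z2 Hz2]] := ts (t (i - 1) y0 - f (i - 1) x1 + z).
    apply: (diff0_cast (esym e)).
    by rewrite linearD linearB /= -!cmapP -Hx -Hy0 -dz addrA subrK subrr.
  exists (x1, y0 - y2, - z2).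
  rewrite /= /lin_pair_fun /= /lin_pair_fun /=.
  rewrite tr_id -Hx [diff Y _ _ (y0 - y2)]linearB /= -Hy0 dy2 subr0.
  rewrite linearN /= opprK -Hz2 linearB /=.
  congr (_, _, _); set a := f _ _; set b := t _ y0; set c := t _ y2.
  have -> : a - (b - c) = c - (b - a) by rewrite !opprB addrCA.
  by rewrite -(addrA (b - a) z) (addrA (c - (b - a))) subrK addrC subrK.
move=> x dx; have [_ ts] := qt i.
have [|y dy [z Hz]] := ts (f i x); first by rewrite -cmapP dx linear0.
exists (x, y, z); first by apply/hpb_diff0.
by exists 0; rewrite /= subrr linear0.
Qed.

(* A morphism from X to Y in the bounded derived category of finitely generated *)
(* left A-modules is represented by a roof X <- W -> Y whose first map is a     *)
(* quasi-isomorphism; droof_eq is the equality of the morphisms represented.    *)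
Record droof X Y := DRoof {
  apex : cplx A;
  den : cmap apex X;
  num : cmap apex Y;
  den_qis : qis den }.

Definition droof_eq X Y (r r' : droof X Y) : Prop :=
  exists (W : cplx A) (a : cmap W (apex r)) (b : cmap W (apex r')),
    [/\ qis (cmap_comp (den r) a),
        homotopic (cmap_comp (den r) a) (cmap_comp (den r') b) &
        homotopic (cmap_comp (num r) a) (cmap_comp (num r') b)].

Definition droof_map X Y (f : cmap X Y) : droof X Y := DRoof f (@qis_id k A X).
Definition droof_id X : droof X X := droof_map (cmap_id X).
Definition droof_zero X Y : droof X Y := droof_map (cmap_zero X Y).

(* The square on the homotopy pullback of num r and den r' commutes up to       *)
(* homotopy, so this roof represents num r' (den r')^-1 num r (den r)^-1.       *)
Definition droof_comp X Y Z (r' : droof Y Z) (r : droof X Y) : droof X Z :=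
  DRoof (cmap_comp (num r') (hpb2 (num r) (den r')))
        (qis_comp (den_qis r) (qis_hpb1 (num r) (den_qis r'))).

(* Addition of the numerators over a common denominator. *)
Definition droof_add X Y (r r' : droof X Y) : droof X Y :=
  DRoof (cmap_add (cmap_comp (num r) (hpb1 (den r) (den r')))
                  (cmap_comp (num r') (hpb2 (den r) (den r'))))
        (qis_comp (den_qis r) (qis_hpb1 (den r) (den_qis r'))).

Definition droof_scale X Y (c : k) (r : droof X Y) : droof X Y :=
  DRoof (cmap_scale c (num r)) (den_qis r).

Definition diso X Y : Prop :=
  exists (r : droof X Y) (r' : droof Y X),
    droof_eq (droof_comp r' r) (droof_id X) /\
    droof_eq (droof_comp r r') (droof_id Y).

(* A (full) thick triangulated subcategory, given by its class of objects. The *)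
(* cone of the morphism represented by a roof is the cone of its numerator.    *)
Record thick (C : cplx A -> Prop) : Prop := Thick {
  thick_iso : forall X Y, diso X Y -> C X -> C Y;
  thick_shift : forall n X, C X -> C (shift n X);
  thick_cone : forall X Y (r : droof X Y), C X -> C Y -> C (cone (num r));
  thick_summand : forall X Y, C (dsum2 X Y) -> C X }.

Definition thick_generates (T : cplx A) : Prop :=
  forall C, thick C -> C T -> forall X, C X.

Definition tilting (T : cplx A) : Prop :=
  (forall (n : int) (r : droof T (shift n T)), n != 0 -> droof_eq r (droof_zero _ _))
  /\ thick_generates T.

(* The k-algebra of endomorphisms of T in the derived category is isomorphic   *)
(* to B: phi is a bijective algebra morphism modulo equality of roofs.         *)
Definition dEnd_isom (T : cplx A) (B : kalgType k) : Prop :=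
  exists phi : B -> droof T T,
    [/\ [/\ droof_eq (phi 1) (droof_id T),
            forall x y, droof_eq (phi (x + y)) (droof_add (phi x) (phi y)),
            forall x y, droof_eq (phi (x * y)) (droof_comp (phi x) (phi y)) &
            forall c x, droof_eq (phi (kalg_map B c * x)) (droof_scale c (phi x))],
        forall x y, droof_eq (phi x) (phi y) -> x = y &
        forall r, exists x, droof_eq (phi x) r].

End DerivedCategory.
Section LeftIdeal.
Variables (A : pzRingType) (e : A).

Definition lideal_pred : {pred A^o} := fun x => `[< exists y : A, x = y * e >].

Lemma lideal_predP (x : A^o) : reflect (exists y : A, x = y * e) (x \in lideal_pred).
Proof. exact: asboolP. Qed.

Lemma lideal_submod : submod_closed lideal_pred.
Proof.
split=> [|a x y /lideal_predP [x' ->] /lideal_predP [y' ->]]; apply/lideal_predP.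
  by exists 0; rewrite mul0r.
by exists (a * x' + y'); rewrite mulrDl -mulrA.
Qed.
HB.instance Definition _ := GRing.isSubmodClosed.Build A A^o lideal_pred lideal_submod.

(* The left ideal A e, as a left A-module. *)
Record lideal := LIdeal { lideal_val :> A^o; _ : lideal_val \in lideal_pred }.
HB.instance Definition _ := [isSub for lideal_val].
HB.instance Definition _ := [Choice of lideal by <:].
HB.instance Definition _ := [SubChoice_isSubLmodule of lideal by <:].

Lemma lideal_gen_subproof : (e : A^o) \in lideal_pred.
Proof. by apply/lideal_predP; exists 1; rewrite mul1r. Qed.
Definition lideal_gen : lideal := LIdeal lideal_gen_subproof.

Lemma lideal_genE (x : lideal) : exists y : A, x = y *: lideal_gen.
Proof. by have /lideal_predP [y Hy] := valP x; exists y; apply: val_inj. Qed.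
End LeftIdeal.

Section ThreeTermComplex.
Variables (k : fieldType) (A : kalgType k) (M N L : lmodType A).
Variables (f : {linear M -> N}) (g : {linear N -> L}).
Hypothesis gf0 : forall x, g (f x) = 0.
Hypotheses (fgM : fin_gen M) (fgN : fin_gen N) (fgL : fin_gen L).

(* Negz 0 is the integer - 1. *)
Definition cplx3_obj (i : int) : lmodType A :=
  match i with Negz 0 => M | Posz 0 => N | Posz 1 => L | _ => zmod A end.

Definition cplx3_diff (i j : int) : {linear cplx3_obj i -> cplx3_obj j} :=
  match i, j return {linear cplx3_obj i -> cplx3_obj j} with
  | Negz 0, Posz 0 => f
  | Posz 0, Posz 1 => g
  | _, _ => lin_zero _ _
  end.

(* M -f-> N -g-> L in degrees - 1, 0, 1. *)
Program Definition cplx3 : cplx A := @Cplx _ A cplx3_obj cplx3_diff _ _ _ _.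
Next Obligation. by case=> [[|[|i]]|[|i]] [[|[|j]]|[|j]]. Qed.
Next Obligation.
by case=> [[|[|i]]|[|i]] [[|[|j]]|[|j]] [[|[|l]]|[|l]] x //=; rewrite ?linear0.
Qed.
Next Obligation. by case=> [[|[|i]]|[|i]] //=; exact: fin_gen_zmod. Qed.
Next Obligation. by exists 1%N; case=> [[|[|i]]|[|i]] //= _ x; exact: zmod_eq0. Qed.
End ThreeTermComplex.

Section Nakayama.
Variables (k : fieldType) (n r : nat).

(* The vertices 1, ..., n are numbered from 0. *)
Definition nak_quiver : quiver := @Quiver 'I_n (fun x y => x == y.+1 :> nat).

Definition nak_rel (f : pathAlg k nak_quiver) : Prop :=
  exists2 p : qpath nak_quiver, size (val p).2 = r & f = mkmalgU p 1.

Definition nakayama : kalgType k := bound_quiver_alg nak_rel.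

(* The idempotent of the vertex a of 1, ..., n; 0 for other values of a. *)
Definition nak_idem (a : nat) : nakayama :=
  \sum_(x < n | x.+1 == a) bqAlg_mk nak_rel (path_elt k (x : nak_quiver) [::]).

Definition nakP (a : nat) : lmodType nakayama := lideal (nak_idem a).

Lemma fin_gen_nakP a : fin_gen (nakP a).
Proof.
exists 1%N, (fun _ => lideal_gen (nak_idem a)) => x.
by have [y ->] := lideal_genE x; exists (fun _ => y); rewrite big_ord1.
Qed.

Lemma nak_idemE a : (exists2 x : 'I_n, x.+1 = a &
    nak_idem a = bqAlg_mk nak_rel (path_elt k (x : nak_quiver) [::])) \/
  nak_idem a = 0.
Proof.
have [x xa|no] := pickP (fun x : 'I_n => x.+1 == a); last first.
  by right; rewrite /nak_idem big_pred0.
left; exists x; first exact/eqP.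
rewrite /nak_idem (big_pred1 x) // => y.
by rewrite /= -(eqP xa) eqSS; apply/eqP/eqP => [/val_inj|->].
Qed.

Lemma nak_idemM a : nak_idem a * nak_idem a = nak_idem a.
Proof.
have [[x _ ->]|->] := nak_idemE a; last by rewrite mulr0.
by rewrite [LHS]bqAlg_mkM; congr bqAlg_mk; rewrite [LHS]path_elt_mul //= eqxx.
Qed.

Lemma nak_path_size (x : nak_quiver) s :
  path (@arrow nak_quiver) x s -> (size s + last x s = x)%N.
Proof.
elim: s x => [|y s IH] x //= /andP[/eqP xy /IH E].
by rewrite addSn E -xy.
Qed.

Lemma nak_long_path (x : nak_quiver) s : (r <= size s)%N ->
  gen_ideal nak_rel (path_elt k x s).
Proof.
move=> rs; have [xs|nxs] := boolP (path (@arrow nak_quiver) x s); last first.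
  by rewrite path_elt0 //; apply: gen_ideal0.
have := xs; rewrite -[in path _ _ _](cat_take_drop r s) cat_path => /andP[x1 x2].
have <- : path_elt k (last x (take r s)) (drop r s) * path_elt k x (take r s)
    = path_elt k x s :> pathAlg k nak_quiver.
  by rewrite [LHS]path_elt_mul // eqxx cat_take_drop.
apply: gen_idealMl; apply: gen_ideal_gen.
exists (Sub (x, take r s) x1 : qpath nak_quiver) => /=.
  by rewrite size_take_min; apply/minn_idPl.
exact: (path_eltE k (exist _ (x, take r s) x1)).
Qed.

Lemma nak_idem_mul0 a b z : (a + r <= b)%N -> nak_idem a * z * nak_idem b = 0.
Proof.
have [[x <- ->]|->] := nak_idemE a; last by rewrite !mul0r.
have [[y <- ->]|->] := nak_idemE b; last by rewrite !mulr0.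
move=> le_xy; rewrite -[z]bqAlg_mkK.
rewrite [X in X * _]bqAlg_mkM [LHS]bqAlg_mkM -[RHS](_ : bqAlg_mk nak_rel 0 = 0);
  last by rewrite /bqAlg_mk !piE.
apply/bqAlg_mkP; rewrite subr0.
elim/pathAlg_ind: (repr z) => [|f g If Ig|c f If|[[w s] ws]].
- by rewrite mulr0 mul0r; apply: gen_ideal0.
- by rewrite mulrDr mulrDl; apply: gen_idealD.
- rewrite -pathAlg_scaleE !mulrA pathAlg_scaleEr -pathAlg_scaleE -!mulrA.
  by apply: gen_idealMl; rewrite mulrA.
rewrite -path_eltE /=; rewrite /= in ws.
rewrite [X in X * _]path_elt_mul //= cats0.
case: eqP => [xw|_]; last by rewrite mul0r; apply: gen_ideal0.
rewrite [X in gen_ideal _ X]path_elt_mul //=.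
case: eqP => [wy|_]; last exact: gen_ideal0.
subst w x; apply: nak_long_path.
rewrite -(leq_add2r (last y s : 'I_n)) (nak_path_size ws) addnC -ltnS.
exact: le_xy.
Qed.

Lemma nakP_hom0 a b (f : {linear nakP a -> nakP b}) x :
  (a + r <= b)%N -> f x = 0.
Proof.
move=> le_ab; have [y ->] := lideal_genE x.
rewrite linearZ /=; set g := lideal_gen _.
suff -> : f g = 0 by rewrite scaler0.
have <- : nak_idem a *: g = g by apply: val_inj; rewrite /= [LHS]nak_idemM.
rewrite linearZ /=; apply: val_inj => /=.
have [z ->] := lideal_genE (f g).
by rewrite [LHS]mulrA [LHS]nak_idem_mul0.
Qed.

End Nakayama.

Section TiltingComplex.
Variables (k : fieldType) (u v : nat).
Notation m := (u + v + 1)%N.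
Notation N := (nakayama k (2 * u + v) m).
Notation P := (nakP k (2 * u + v) m).
Variable xi : forall a : nat, {linear P a -> P a.+1}.

(* The composite of xi a, ..., xi b.-1 if a < b, and the identity if a = b. *)
Fixpoint xi_comp (a b : nat) : {linear P a -> P b} :=
  match b with
  | 0 => tr P a 0
  | b'.+1 => if (a <= b')%N then lin_comp (xi b') (xi_comp a b') else tr P a b'.+1
  end.

Lemma xi_comp0 l x : xi_comp m (m + l) (xi_comp l m x) = 0.
Proof.
exact: (@nakP_hom0 _ _ _ _ _ (lin_comp (xi_comp m (m + l)) (xi_comp l m)) x (eq_leq (addnC l m))).
Qed.

Definition Pcplx : cplx N :=
  cplx3 (f := lin_zero (zmod N) (P m)) (g := lin_zero (P m) (zmod N))
    (fun=> erefl) (fin_gen_zmod N) (fin_gen_nakP _ _ _ m) (fin_gen_zmod N).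

Definition Ecplx (i : nat) : cplx N :=
  cplx3 (f := lin_zero (zmod N) (P m)) (g := xi_comp m (m + i))
    (fun=> linear0 _) (fin_gen_zmod N) (fin_gen_nakP _ _ _ m)
    (fin_gen_nakP _ _ _ (m + i)).

Definition Fcplx (j : nat) : cplx N :=
  cplx3 (f := xi_comp j m) (g := lin_zero (P m) (zmod N))
    (fun=> erefl) (fin_gen_nakP _ _ _ j) (fin_gen_nakP _ _ _ m) (fin_gen_zmod N).

Definition Gcplx (l : nat) : cplx N :=
  cplx3 (f := xi_comp l m) (g := xi_comp m (m + l)) (@xi_comp0 l)
    (fin_gen_nakP _ _ _ l) (fin_gen_nakP _ _ _ m) (fin_gen_nakP _ _ _ (m + l)).

Definition Tcplx : cplx N :=
  dsum (Pcplx :: [seq Ecplx i | i <- index_iota 1 u]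
              ++ [seq Fcplx j | j <- index_iota u (u + v).+1]
              ++ [seq Gcplx l | l <- index_iota 1 u]).

End TiltingComplex.

Section BranchExtension.
Variables (k : fieldType) (u v : nat).

Definition br_t (i : 'I_u) : 'I_u + 'I_u + 'I_v := inl (inl i).
Definition br_b (i : 'I_u) : 'I_u + 'I_u + 'I_v := inl (inr i).
Definition br_c (i : 'I_v) : 'I_u + 'I_u + 'I_v := inr i.

(* The indices of t, b and c are numbered from 0. *)
Definition br_arrow (x y : 'I_u + 'I_u + 'I_v) : bool :=
  match x, y with
  | inl (inl i), inl (inl j) => j == i.+1 :> nat
  | inl (inr i), inl (inr j) => j == i.+1 :> nat
  | inl (inl i), inl (inr j) => i == j
  | inl (inr i), inr j => (i.+1 == u) && (j == 0 :> nat)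
  | inr i, inr j => j == i.+1 :> nat
  | _, _ => false
  end.
Definition br_quiver : quiver := @Quiver ('I_u + 'I_u + 'I_v)%type br_arrow.

Definition br_rel (f : pathAlg k br_quiver) : Prop :=
  exists i j : 'I_u, j = i.+1 :> nat /\
    f = path_elt k (br_t i : br_quiver) [:: br_t j; br_b j]
      - path_elt k (br_t i : br_quiver) [:: br_b i; br_b j].

(* The one-branch extension algebra A(u)_v. *)
Definition branch_alg : kalgType k := bound_quiver_alg br_rel.

End BranchExtension.

(* Main.v *)
From HB Require Import structures.
Require Import Defs.
From mathcomp Require Import all_boot all_algebra.
From mathcomp Require Import generic_quotient ring_quotient boolp.
From mathcomp Require Import finmap monalg zify.

Set Implicit Arguments.
Unset Strict Implicit.
Unset Printing Implicit Defensive.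

Import GRing.Theory Quotient.
Local Open Scope ring_scope.

(** Put m = u + v + 1. The theorem rests on the maps between the projectives: for
    1 <= a, b <= 2u + v every map from P_a to P_b is a multiple of the composite
    xi_(a,b) if a <= b, which is nonzero if and only if b < a + m, and is zero if
    b < a ([hom_span], [hom_free], [hom_up]). Every summand of T has the form
    M -> P_m -> L with P_m in degree 0, where M is 0 or some P_j with j < m and L
    is 0 or some P_(m+i) with i < u.

    Maps in the derived category. T is a bounded complex of projectives, so maps
    from T are chain maps up to homotopy ([kproj_section], [droof_kproj]), and it
    suffices to consider two summands at a time. A map of nonzero degree has
    components c f from M to P_m and d g from P_m to L in degree 1, c g f from M
    to L in degree 2, and none otherwise, and is seen to be null-homotopic
    ([cplx3_shift_null]). In degree 0 there are no homotopies, a chain map is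
    determined by the scalar by which it acts on P_m, and a nonzero scalar extends
    to the outer terms exactly when the index of M does not decrease and the index
    of L does not decrease, the zero term being the least on the left and the
    greatest on the right. Thus the endomorphism algebra of T is the incidence
    algebra of this order ([dEnd_incidence]).

    The algebra A(u)_v. The order is reachability in its quiver ([br_le_label]),
    and the commutativity relations identify any two parallel paths
    ([br_parallel]), so A(u)_v is the same incidence algebra ([bq_entry_inj],
    [bq_entry_surj]).

    Generation. Cones of the evident maps between the summands give every P_a as
    a complex in one degree ([thick_stalk]). To build an arbitrary complex X, its
    cohomology is removed vertex by vertex, beginning with the last vertex
    ([stalks_generate]). A cocycle x with e_a x = x, not a coboundary, is the
    image of the generator under a map from a shift of P_a to X. Because
    e_a A e_a = k e_a, the cone of this map has the same cohomology at a except
    for the class of x, and because e_b A e_a = 0 for b > a, the cohomology at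
    later vertices remains zero. After finitely many steps the complex is acyclic,
    and an acyclic complex lies in every nonempty thick subcategory
    ([thick_acyclic]). *)

#[local] Obligation Tactic := idtac.

(** * Homotopies and quasi-isomorphisms *)

Lemma subr_addD (V : zmodType) (a b c : V) : a - (a + b + c) = - b - c.
Proof. by rewrite !opprD !addrA subrr add0r. Qed.

Section Homotopy.
Variables (k : fieldType) (A : kalgType k).
Implicit Types X Y Z W : cplx A.

Lemma homotopic_ext X Y (f g : cmap X Y) :
  (forall i x, f i x = g i x) -> homotopic f g.
Proof.
move=> E; exists (fun i j => lin_zero (X i) (Y j)) => i x.
by rewrite E subrr /= linear0 addr0.
Qed.

Lemma homotopic_sym X Y (f g : cmap X Y) : homotopic f g -> homotopic g f.
Proof.
move=> [h Hh]; exists (fun i j => \- h i j) => i x.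
by rewrite -opprB Hh /= linearN opprD.
Qed.

Lemma homotopic_trans X Y (f g h : cmap X Y) :
  homotopic f g -> homotopic g h -> homotopic f h.
Proof.
move=> [s Hs] [t Ht]; exists (fun i j => s i j \+ t i j) => i x.
by rewrite -(subrKA (g i x)) Hs Ht /= linearD addrACA.
Qed.

Lemma homotopic_compl X Y Z (h : cmap Y Z) (f g : cmap X Y) :
  homotopic f g -> homotopic (cmap_comp h f) (cmap_comp h g).
Proof.
move=> [s Hs]; exists (fun i j => lin_comp (h j) (s i j)) => i x.
by rewrite /= -linearB Hs linearD cmapP.
Qed.

Lemma homotopic_compr X Y Z (h : cmap X Y) (f g : cmap Y Z) :
  homotopic f g -> homotopic (cmap_comp f h) (cmap_comp g h).
Proof.
move=> [s Hs]; exists (fun i j => lin_comp (s i j) (h i)) => i x.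
by rewrite /= Hs cmapP.
Qed.

(** The degrees i - 1 and i + 1 of the definition of a quasi-isomorphism are
    replaced by any equal integers, which avoids transports along equalities
    such as i - 1 + 1 = i. *)
Lemma qisE X Y (f : cmap X Y) : qis f -> forall p i q, i = p + 1 -> q = i + 1 ->
  (forall x, diff X i q x = 0 ->
     (exists y, f i x = diff Y p i y) -> exists x', x = diff X p i x')
  /\
  (forall y, diff Y i q y = 0 ->
     exists2 x, diff X i q x = 0 & exists y', y - f i x = diff Y p i y').
Proof.
move=> qf p i q ip ->; have -> : p = i - 1 by rewrite ip addrK.
exact: qf.
Qed.

Lemma qisI X Y (f : cmap X Y) : (forall p,
  (forall x, diff X (p + 1) (p + 1 + 1) x = 0 ->
     (exists y, f (p + 1) x = diff Y p (p + 1) y) -> exists x', x = diff X p (p + 1) x')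
  /\
  (forall y, diff Y (p + 1) (p + 1 + 1) y = 0 ->
     exists2 x, diff X (p + 1) (p + 1 + 1) x = 0 &
                exists y', y - f (p + 1) x = diff Y p (p + 1) y')) -> qis f.
Proof.
move=> H i; move: (H (i - 1)).
by move: (i - 1) (esym (subrK 1 i)) => p ->.
Qed.

Lemma homotopic_cycle X Y (f g : cmap X Y) : homotopic f g ->
  forall i x, diff X i (i + 1) x = 0 -> exists y, f i x - g i x = diff Y (i - 1) i y.
Proof.
move=> [h Hh] i x dx; exists (h i (i - 1) x).
by rewrite Hh dx linear0 addr0.
Qed.

Lemma qis_homotopic X Y (f g : cmap X Y) : homotopic f g -> qis f -> qis g.
Proof.
move=> fg qf i; have [fi fs] := qf i; split.
  move=> x dx [y Hy]; apply: fi => //.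
  have [z Hz] := homotopic_cycle fg dx.
  by exists (z + y); rewrite linearD -Hy -Hz subrK.
move=> y /fs [x dx [y' Hy']]; exists x => //.
have [z Hz] := homotopic_cycle fg dx.
by exists (y' + z); rewrite linearD -Hy' -Hz subrKA.
Qed.

Definition acyclic Z := forall p i q (z : Z i), i = p + 1 -> q = i + 1 ->
  diff Z i q z = 0 -> exists z', z = diff Z p i z'.

Lemma cone_acyclic X Y (f : cmap X Y) : qis f -> acyclic (cone f).
Proof.
move=> qf p i q z ip iq; subst i q; case: z => x y.
rewrite /= /lin_pair_fun /= => -[dx dy].
rewrite tr_id in dy.
have {}dx : diff X (p + 1 + 1) (p + 1 + 1 + 1) x = 0.
  by apply: oppr_inj; rewrite oppr0.
have [fi _] := qisE qf (p := p + 1) erefl erefl.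
have [|x' Hx'] := fi _ dx.
  by exists (- y); rewrite linearN; apply/eqP; rewrite -addr_eq0 dy.
have [_ fs] := qisE qf (p := p) erefl erefl.
have [|x2 dx2 [y' Hy']] := fs (y + f (p + 1) x').
  by rewrite linearD -cmapP -Hx' [LHS]addrC dy.
exists (x2 - x', y'); rewrite /= /lin_pair_fun /= tr_id -Hy'; congr pair.
  by rewrite linearB /= dx2 sub0r opprK.
by rewrite linearB [RHS]addrC subrKA addrK.
Qed.

(** Homotopical projectivity. A bounded complex of projectives has it: a
    null-homotopy can be built from the top degree down. *)
Definition kproj X := forall Z (f : cmap X Z), acyclic Z ->
  homotopic f (cmap_zero X Z).

Program Definition cone_inr X Y (f : cmap X Y) : cmap Y (cone f) :=
  @Cmap _ _ Y (cone f) (fun i => lin_pair (lin_zero _ _) idfun) _.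
Next Obligation.
by move=> *; rewrite /= /lin_pair_fun /= !linear0 ?oppr0 add0r.
Qed.

(** The inclusion of T in the cone of s is null-homotopic, and the first
    component of the null-homotopy is the section. *)
Lemma kproj_section T W (s : cmap W T) : kproj T -> qis s ->
  exists a : cmap T W, homotopic (cmap_comp s a) (cmap_id T).
Proof.
move=> kT qs; have [h Hh] := kT _ (cone_inr s) (cone_acyclic qs).
have H1 i x : diff W (i - 1 + 1) (i + 1) (h i (i - 1) x).1 =
    (h (i + 1) i (diff T i (i + 1) x)).1.
  have := congr1 fst (Hh i x); rewrite /= /lin_pair_fun /= subr0 => /esym/eqP.
  by rewrite addr_eq0 eqr_opp => /eqP.
have H2 i x : x = tr T (i - 1 + 1) i (s _ (h i (i - 1) x).1)
    + diff T (i - 1) i (h i (i - 1) x).2 + (h (i + 1) i (diff T i (i + 1) x)).2.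
  by have := congr1 snd (Hh i x); rewrite /= /lin_pair_fun /= subr0.
pose a0 i : {linear T i -> W i} :=
  tr W (i - 1 + 1) i \o ((fst : {linear (_ * _)%type -> _}) \o h i (i - 1)).
have aP i j x : a0 j (diff T i j x) = diff W i j (a0 i x).
  have [->|nj] := eqVneq j (i + 1); last by rewrite !diff_shape ?linear0.
  rewrite /a0 /= -(@tr_diff _ _ W (i - 1 + 1) (i + 1)) // H1.
  move: (i + 1 - 1) (addrK 1 i) => l El; subst l; by [].
exists (Cmap aP).
exists (fun i j => \- ((snd : {linear (_ * _)%type -> _}) \o h i j)) => i x.
rewrite /= -tr_cmap {2}[x]H2 linearN; exact: subr_addD.
Qed.

Program Definition dsum_inl X Y : cmap X (dsum2 X Y) :=
  @Cmap _ _ X (dsum2 X Y) (fun i => lin_pair idfun (lin_zero _ _)) _.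
Next Obligation. by move=> *; rewrite /= /lin_pair_fun /= linear0. Qed.
Program Definition dsum_inr X Y : cmap Y (dsum2 X Y) :=
  @Cmap _ _ Y (dsum2 X Y) (fun i => lin_pair (lin_zero _ _) idfun) _.
Next Obligation. by move=> *; rewrite /= /lin_pair_fun /= linear0. Qed.
Program Definition dsum_fst X Y : cmap (dsum2 X Y) X :=
  @Cmap _ _ (dsum2 X Y) X (fun i => fst) _.
Next Obligation. by []. Qed.
Program Definition dsum_snd X Y : cmap (dsum2 X Y) Y :=
  @Cmap _ _ (dsum2 X Y) Y (fun i => snd) _.
Next Obligation. by []. Qed.

Lemma null_from_dsum X Y Z (f : cmap (dsum2 X Y) Z) :
  homotopic (cmap_comp f (dsum_inl X Y)) (cmap_zero _ _) ->
  homotopic (cmap_comp f (dsum_inr X Y)) (cmap_zero _ _) ->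
  homotopic f (cmap_zero _ _).
Proof.
move=> [s Hs] [t Ht].
exists (fun i j => (s i j \o fst) \+ (t i j \o snd)) => i [x y].
have := Hs i x; have := Ht i y; rewrite /= /lin_pair_fun /= !subr0 => Hy Hx.
rewrite linearD addrACA -Hx -Hy -linearD; congr (f i _).
by congr pair; rewrite /= ?addr0 ?add0r.
Qed.

Lemma kproj_dsum2 X Y : kproj X -> kproj Y -> kproj (dsum2 X Y).
Proof. by move=> kX kY Z f aZ; apply: null_from_dsum; [apply: kX|apply: kY]. Qed.

Lemma kproj_dsum (s : seq (cplx A)) :
  (forall X, List.In X s -> kproj X) -> kproj (dsum s).
Proof.
elim: s => [|X s IH] H; last first.
  by apply: kproj_dsum2; [apply: H; left|apply: IH => Y Ys; apply: H; right].
move=> Z f _; apply: homotopic_ext => i x.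
by rewrite (zmod_eq0 x) !linear0.
Qed.

End Homotopy.

(** * Roofs from homotopically projective complexes *)

Section Roofs.
Variables (k : fieldType) (A : kalgType k).
Implicit Types X Y Z W T : cplx A.

(** Strictly commuting squares map to homotopy pullbacks; through these maps a
    composite or a sum of roofs with trivial denominators is compared with the
    composite or the sum of the chain maps. *)
Program Definition hpb_pair W X Y Z (f : cmap X Z) (t : cmap Y Z)
    (a : cmap W X) (b : cmap W Y) (E : forall i x, f i (a i x) = t i (b i x)) :
    cmap W (hpb f t) :=
  @Cmap _ _ W (hpb f t) (fun i => lin_pair (lin_pair (a i) (b i)) (lin_zero _ _)) _.
Next Obligation.
move=> W X Y Z f t a b E i j x; rewrite /= /lin_pair_fun /= /lin_pair_fun /=.
by rewrite !cmapP E subrr !linear0 ?subr0 ?addr0.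
Qed.

Lemma droof_map_homotopic X Y (f g : cmap X Y) : homotopic f g ->
  droof_eq (droof_map f) (droof_map g).
Proof.
move=> fg; exists X, (cmap_id X), (cmap_id X); split.
- exact: qis_comp (qis_id X) (qis_id X).
- exact: homotopic_ext.
- exact: (homotopic_compr (cmap_id X)).
Qed.

Lemma droof_map_add X Y (h f g : cmap X Y) : homotopic h (cmap_add f g) ->
  droof_eq (droof_map h) (droof_add (droof_map f) (droof_map g)).
Proof.
move=> Hh.
exists X, (cmap_id X), (@hpb_pair _ _ _ _ (cmap_id X) (cmap_id X)
  (cmap_id X) (cmap_id X) (fun _ _ => erefl)); split.
- exact: qis_comp (qis_id X) (qis_id X).
- exact: homotopic_ext.
- by apply: homotopic_trans (homotopic_compr _ Hh) _; apply: homotopic_ext.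
Qed.

Lemma droof_map_comp X Y Z (h : cmap X Z) (f : cmap X Y) (g : cmap Y Z) :
  homotopic h (cmap_comp g f) ->
  droof_eq (droof_map h) (droof_comp (droof_map g) (droof_map f)).
Proof.
move=> Hh.
exists X, (cmap_id X), (@hpb_pair _ _ _ _ f (cmap_id Y)
  (cmap_id X) f (fun _ _ => erefl)); split.
- exact: qis_comp (qis_id X) (qis_id X).
- exact: homotopic_ext.
- by apply: homotopic_trans (homotopic_compr _ Hh) _; apply: homotopic_ext.
Qed.

(** A section a of the denominator turns the roof into the chain map num r o a.
    The conclusion covers all maps homotopic to it, so that it applies both to
    the zero map and to a chosen representative of an endomorphism. *)
Lemma droof_kproj X Y (r : droof X Y) : kproj X ->
  exists f : cmap X Y, forall g, homotopic g f ->
    droof_eq (droof_map g) r /\ droof_eq r (droof_map g).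
Proof.
move=> kX; have [a Ha] := kproj_section kX (den_qis r).
exists (cmap_comp (num r) a) => g Hg; split.
  exists X, (cmap_id X), a; split.
  - exact: qis_comp (qis_id X) (qis_id X).
  - apply: homotopic_trans (homotopic_sym Ha); exact: homotopic_ext.
  - by apply: homotopic_trans Hg; apply: homotopic_ext.
exists X, a, (cmap_id X); split.
- exact: qis_homotopic (homotopic_sym Ha) (qis_id X).
- by apply: homotopic_trans Ha _; apply: homotopic_ext.
- by apply: homotopic_trans (homotopic_sym Hg) _; apply: homotopic_ext.
Qed.

(** If f and g agree after a quasi-isomorphism a, then they agree after a
    followed by its section, hence up to homotopy. *)
Lemma droof_map_inj X Y (f g : cmap X Y) : kproj X ->
  droof_eq (droof_map f) (droof_map g) -> homotopic f g.
Proof.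
move=> kX [W [a [b [qa Hab Hfg]]]].
have [s Hs] := kproj_section kX qa.
have Hs' : homotopic (cmap_comp b s) (cmap_id X).
  apply: homotopic_trans Hs; apply: homotopic_sym.
  exact: (homotopic_compr s Hab).
apply: (@homotopic_trans _ _ _ _ _ (cmap_comp f (cmap_comp a s))).
  apply: homotopic_sym; apply: homotopic_trans (homotopic_compl f Hs) _.
  exact: homotopic_ext.
apply: homotopic_trans (homotopic_compr s Hfg) _.
apply: homotopic_trans (homotopic_compl g Hs') _; exact: homotopic_ext.
Qed.

(** If T is homotopically projective, chain maps modulo homotopy represent each
    endomorphism in the derived category exactly once. *)
Lemma dEnd_isom_homotopy T (B : kalgType k) (F : B -> cmap T T) : kproj T ->
  homotopic (F 1) (cmap_id T) ->
  (forall x y, homotopic (F (x + y)) (cmap_add (F x) (F y))) ->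
  (forall x y, homotopic (F (x * y)) (cmap_comp (F x) (F y))) ->
  (forall c x, homotopic (F (kalg_map B c * x)) (cmap_scale c (F x))) ->
  (forall x y, homotopic (F x) (F y) -> x = y) ->
  (forall f, exists x, homotopic (F x) f) ->
  dEnd_isom T B.
Proof.
move=> kT F1 FD FM FZ Finj Fsurj; exists (fun x => droof_map (F x)); split.
- split.
  + exact: droof_map_homotopic.
  + by move=> x y; apply: droof_map_add.
  + by move=> x y; apply: droof_map_comp.
  + by move=> c x; apply: droof_map_homotopic.
- by move=> x y /(droof_map_inj kT) /Finj.
- move=> r; have [f Hf] := droof_kproj r kT; have [x Hx] := Fsurj f.
  by exists x; have [] := Hf _ Hx.
Qed.

Lemma droof_null X Y (r : droof X Y) : kproj X ->
  (forall f : cmap X Y, homotopic f (cmap_zero X Y)) -> droof_eq r (droof_zero X Y).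
Proof.
move=> kX H; have [f Hf] := droof_kproj r kX.
by have [] := Hf _ (homotopic_sym (H f)).
Qed.

Program Definition shift_cmap n X Y (f : cmap X Y) : cmap (shift n X) (shift n Y) :=
  @Cmap _ _ (shift n X) (shift n Y) (fun i => f (i + n)) _.
Next Obligation.
by move=> n X Y f i j x; rewrite /= /lin_scale_fun linearZ /= cmapP.
Qed.

Lemma null_to_shift_dsum X Y Z n (f : cmap X (shift n (dsum2 Y Z))) :
  homotopic (cmap_comp (shift_cmap n (dsum_fst Y Z)) f) (cmap_zero _ _) ->
  homotopic (cmap_comp (shift_cmap n (dsum_snd Y Z)) f) (cmap_zero _ _) ->
  homotopic f (cmap_zero _ _).
Proof.
move=> [s Hs] [t Ht].
exists (fun i j => lin_pair (s i j) (t i j)) => i x.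
have := Hs i x; have := Ht i x; rewrite /= /lin_scale_fun /= /lin_pair_fun /= !subr0.
by case: (f i x) => a b /= -> ->.
Qed.

Lemma null_dsum_shift n (s t : seq (cplx A)) :
  (forall X Y, List.In X s -> List.In Y t ->
     forall f : cmap X (shift n Y), homotopic f (cmap_zero _ _)) ->
  forall f : cmap (dsum s) (shift n (dsum t)), homotopic f (cmap_zero _ _).
Proof.
elim: s => [|X s IHs] H f.
  by apply: homotopic_ext => i x; rewrite (zmod_eq0 x) !linear0.
apply: null_from_dsum; last first.
  by apply: IHs => X' Y' Xs; apply: H; right.
move: (cmap_comp _ _) => /=.
have {IHs}H Y : List.In Y t ->
    forall g : cmap X (shift n Y), homotopic g (cmap_zero _ _).
  by move=> Yt g; apply: H => //; left.
elim: t {f} H => [|Y t IHt] H f.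
  by apply: homotopic_ext => i x; apply: zmod_eq0.
apply: null_to_shift_dsum; first by apply: H; left.
by apply: IHt => Z Zt; apply: H; right.
Qed.

End Roofs.

(** * Thick subcategories *)

Section Thick.
Variables (k : fieldType) (A : kalgType k).
Implicit Types X Y Z W T : cplx A.

Lemma diso_qis X Y (f : cmap X Y) : qis f -> diso X Y.
Proof.
move=> qf; exists (droof_map f), (DRoof (cmap_id X) qf); split.
  exists X, (@hpb_pair _ _ _ _ _ _ f f (cmap_id X) (cmap_id X) (fun _ _ => erefl)).
  exists (cmap_id X); split; [|exact: homotopic_ext..].
  apply: qis_homotopic (qis_id X); exact: homotopic_ext.
exists X, (@hpb_pair _ _ _ _ _ _ (cmap_id X) (cmap_id X) (cmap_id X) (cmap_id X)
  (fun _ _ => erefl)), f; split; [|exact: homotopic_ext..].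
refine (qis_homotopic _ qf); exact: homotopic_ext.
Qed.

Lemma diso_sym X Y : diso X Y -> diso Y X.
Proof. by move=> [r [r' [H H']]]; exists r', r. Qed.

Variables (C : cplx A -> Prop) (thC : thick C).

Lemma thick_qis X Y (f : cmap X Y) : qis f -> C X -> C Y.
Proof. by move=> /diso_qis; apply: thick_iso thC _ _. Qed.

Lemma thick_cone_map X Y (f : cmap X Y) : C X -> C Y -> C (cone f).
Proof. exact: (@thick_cone _ _ _ thC _ _ (droof_map f)). Qed.

(** The objects of the double shift are X (i - n + n), which is only
    propositionally X i, hence the transport. *)
Program Definition unshift n X : cmap (shift (- n) (shift n X)) X :=
  @Cmap _ _ (shift (- n) (shift n X)) X (fun i => tr X (i - n + n) i) _.
Next Obligation.
move=> n X i j x; rewrite /= /lin_scale_fun /= abszN scalerA.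
rewrite -rmorphM -expr2 sqrr_sign rmorph1 scale1r.
have [->|nj] := eqVneq j (i + 1).
  by rewrite (@tr_diff _ _ X _ _ i (i + 1)) // subrK.
by rewrite !diff_shape ?linear0 // !subrK.
Qed.

Lemma qis_bij X Y (f : cmap X Y) (g : forall i, Y i -> X i) :
  (forall i, cancel (f i) (g i)) -> (forall i, cancel (g i) (f i)) -> qis f.
Proof.
move=> fg gf i; split=> [x dx [y Hy]|y dy].
  exists (g _ y); apply: (can_inj (fg i)).
  by rewrite cmapP gf.
exists (g i y); last by exists 0; rewrite gf subrr linear0.
by apply: (can_inj (fg _)); rewrite cmapP gf dy linear0.
Qed.

Lemma tr_cancel X i j : i = j -> cancel (tr X i j) (tr X j i).
Proof. by move=> -> x; rewrite !tr_id. Qed.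

Lemma thick_unshift n X : C (shift n X) -> C X.
Proof.
move=> /(thick_shift thC (- n)); apply: (@thick_qis _ _ (unshift n X)).
refine (@qis_bij _ _ (unshift n X) (fun i x => tr X i (i - n + n) x) _ _) => i;
  apply: tr_cancel.
  by rewrite subrK.
by rewrite subrK.
Qed.

(** The connecting map from the cone of f to the shift of its source. *)
Program Definition cone_fst X Y (f : cmap X Y) : cmap (cone f) (shift 1 X) :=
  @Cmap _ _ (cone f) (shift 1 X) (fun i => fst) _.
Next Obligation.
move=> X Y f i j [x y]; rewrite /= /lin_scale_fun /= /lin_pair_fun /=.
by rewrite expr1 rmorphN1 scaleN1r.
Qed.

Program Definition cone_fst_cone X Y (f : cmap X Y) :
    cmap (shift 1 Y) (cone (cone_fst f)) :=
  @Cmap _ _ (shift 1 Y) (cone (cone_fst f))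
    (fun i => lin_pair (lin_pair (lin_zero _ _) idfun) (lin_zero _ _)) _.
Next Obligation.
move=> X Y f i j y; rewrite /= /lin_scale_fun /= /lin_pair_fun /= /lin_pair_fun /=.
by rewrite !linear0 !add0r expr1 rmorphN1 scaleN1r; congr (_, _, _); rewrite oppr0.
Qed.

Lemma tr_shift n X i j x : tr (shift n X) i j x = tr X (i + n) (j + n) x.
Proof.
have [<-|nij] := eqVneq i j; first by rewrite !tr_id.
by rewrite !tr_neq //; apply: contra nij => /eqP /addIr ->.
Qed.

(** The cone of the connecting map is an extension of the shift of Y by the
    cone of an identity. *)
Lemma qis_cone_fst_cone X Y (f : cmap X Y) : qis (cone_fst_cone f).
Proof.
apply: qisI => p; split.
  move=> y _ [[[x' y2] x] /=]; rewrite /lin_pair_fun /= /lin_pair_fun /=.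
  rewrite /lin_scale_fun expr1 rmorphN1 scaleN1r tr_shift !tr_id.
  move=> [_ E2 /esym/eqP]; rewrite subr_eq0 => /eqP E3; subst x'.
  by exists (f _ x + y2); rewrite E2 scaleN1r [in RHS]linearD -cmapP.
move=> [[x' y] x] /=; rewrite /lin_pair_fun /= /lin_pair_fun /=.
rewrite /lin_scale_fun expr1 rmorphN1 scaleN1r tr_shift !tr_id => -[_ E2 /eqP].
rewrite subr_eq0 => /eqP E3; subst x'.
exists (f _ x + y).
  by rewrite scaleN1r [X in - X]linearD -cmapP.
exists (x, 0, 0); rewrite /= /lin_pair_fun /= /lin_pair_fun /= tr_shift tr_id.
rewrite tr_id !linear0 scaler0 !addr0; congr (_, _, _) => /=.
- by rewrite subr0 opprK.
- by rewrite opprD addrCA subrr addr0.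
- by rewrite subr0.
Qed.

(** Rotating the triangle: up to quasi-isomorphism the shift of Y is the cone of
    the connecting map. *)
Lemma thick_cone_target X Y (f : cmap X Y) : C X -> C (cone f) -> C Y.
Proof.
move=> CX Cf; apply: (@thick_unshift 1).
have : C (cone (cone_fst f)) by apply: thick_cone_map => //; exact: thick_shift.
apply: thick_iso thC _ _ _; apply: diso_sym; exact: diso_qis (qis_cone_fst_cone f).
Qed.

(** An acyclic Z is a direct summand of the sum of Z and the cone of an
    identity, and this sum is quasi-isomorphic to the cone. *)
Lemma thick_acyclic X Z : acyclic Z -> C X -> C Z.
Proof.
move=> aZ CX; apply: (thick_summand thC (Y := cone (cmap_id X))).
apply: (@thick_qis _ _ (dsum_inr Z (cone (cmap_id X)))); last by apply: thick_cone_map.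
apply: qisI => p; split.
  by move=> x dx [[y1 y2] [_ ->]]; exists y2.
move=> [z x] E; have dz := congr1 fst E; have dx := congr1 snd E; exists x; first exact: dx.
have [z' Hz'] := aZ _ _ _ z erefl erefl dz.
exists (z', 0); rewrite /= /lin_pair_fun /= -Hz' linear0.
by congr pair; rewrite /= ?subr0 ?subrr.
Qed.

End Thick.

(** * Maps between finite direct sums *)

Section DirectSum.
Variables (k : fieldType) (A : kalgType k) (I : eqType) (X : I -> cplx A).

(** The identity if x = y and 0 otherwise, as a total function of x and y: with
    it inclusions and projections are defined for all indices at once. *)
Definition cmap_tr (x y : I) : cmap (X x) (X y) :=
  match @eqP I x y with
  | ReflectT e =>
      match e in _ = y' return cmap (X x) (X y') with erefl => cmap_id (X x) end
  | ReflectF _ => cmap_zero _ _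
  end.

Lemma cmap_tr_id x i z : cmap_tr x x i z = z.
Proof. by rewrite /cmap_tr; case: eqP => // e; rewrite (eq_axiomK e). Qed.

Lemma cmap_tr_neq x y i z : x != y -> cmap_tr x y i z = 0.
Proof. by rewrite /cmap_tr; case: eqP. Qed.

Fixpoint dsum_in (e : seq I) (x : I) : cmap (X x) (dsum (map X e)) :=
  match e return cmap (X x) (dsum (map X e)) with
  | [::] => cmap_zero _ _
  | y :: e' => cmap_add (cmap_comp (dsum_inl _ _) (cmap_tr x y))
                        (cmap_comp (dsum_inr _ _) (dsum_in e' x))
  end.

Fixpoint dsum_pr (e : seq I) (x : I) : cmap (dsum (map X e)) (X x) :=
  match e return cmap (dsum (map X e)) (X x) with
  | [::] => cmap_zero _ _
  | y :: e' => cmap_add (cmap_comp (cmap_tr y x) (dsum_fst _ _))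
                        (cmap_comp (dsum_pr e' x) (dsum_snd _ _))
  end.

Lemma dsum_in_cons y e x i z :
  dsum_in (y :: e) x i z = (cmap_tr x y i z, dsum_in e x i z).
Proof. by congr pair; rewrite /= ?addr0 ?add0r. Qed.

Lemma dsum_pr_cons y e x i a b :
  dsum_pr (y :: e) x i (a, b) = cmap_tr y x i a + dsum_pr e x i b.
Proof. by []. Qed.

Lemma dsum_in_notin e x i z : x \notin e -> dsum_in e x i z = 0.
Proof.
elim: e => [|y e IH] //; rewrite in_cons negb_or => /andP[xy /IH E].
by rewrite dsum_in_cons E cmap_tr_neq.
Qed.

Lemma dsum_pr_notin e x i z : x \notin e -> dsum_pr e x i z = 0.
Proof.
elim: e z => [|y e IH] // [a b]; rewrite in_cons negb_or => /andP[xy xe].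
by rewrite dsum_pr_cons IH // cmap_tr_neq 1?eq_sym // addr0.
Qed.

Lemma dsum_prin e x y i z : uniq e -> x \in e ->
  dsum_pr e y i (dsum_in e x i z) = cmap_tr x y i z.
Proof.
elim: e => [|w e IH] // /andP[we ue]; rewrite in_cons dsum_in_cons dsum_pr_cons.
have [xw|xw] := eqVneq x w => /= xe.
  by subst w; rewrite cmap_tr_id dsum_in_notin // linear0 addr0.
by rewrite [X in cmap_tr w y i X]cmap_tr_neq // linear0 add0r IH.
Qed.

Lemma dsum_sumE e i z : uniq e ->
  z = \sum_(x <- e) dsum_in e x i (dsum_pr e x i z).
Proof.
elim: e z => [z _|w e IH [a b] /andP[we ue]].
  by rewrite big_nil; apply: zmod_eq0.
rewrite big_cons dsum_pr_cons cmap_tr_id dsum_pr_notin // addr0.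
rewrite dsum_in_cons cmap_tr_id dsum_in_notin //.
have -> : \sum_(x <- e) dsum_in (w :: e) x i (dsum_pr (w :: e) x i (a, b)) =
    \sum_(x <- e) dsum_inr (X w) _ i (dsum_in e x i (dsum_pr e x i b)).
  apply: eq_big_seq => x xe; rewrite dsum_pr_cons dsum_in_cons.
  have xw : x != w by apply: contraNneq we => <-.
  by rewrite [X in (X, _)]cmap_tr_neq // cmap_tr_neq 1?eq_sym // add0r.
rewrite -linear_sum -IH //.
by congr pair; rewrite /= ?addr0 ?add0r.
Qed.

Lemma cmap_sum_exists (J : Type) (r : seq J) (Y Z : cplx A) (g : J -> cmap Y Z) :
  exists f : cmap Y Z, forall i z, f i z = \sum_(j <- r) g j i z.
Proof.
elim: r => [|j r [f Hf]].
  by exists (cmap_zero Y Z) => i z; rewrite big_nil.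
by exists (cmap_add (g j) f) => i z; rewrite big_cons -Hf.
Qed.

Variable e : seq I.
Hypotheses (ue : uniq e) (fe : forall x, x \in e).
Local Notation T := (dsum (map X e)).

Lemma dsum_matrix_exists (m : forall x y, cmap (X x) (X y)) :
  exists f : cmap T T, forall x y i z,
    dsum_pr e y i (f i (dsum_in e x i z)) = m x y i z.
Proof.
pose g x y := cmap_comp (dsum_in e y) (cmap_comp (m x y) (dsum_pr e x)).
have /choice [G HG] : forall x, exists f : cmap T T, forall i z,
  f i z = \sum_(y <- e) g x y i z by move=> x; apply: cmap_sum_exists.
have [f Hf] := cmap_sum_exists e G; exists f => x y i z.
rewrite Hf (bigD1_seq x) //= big1_seq ?addr0; last first.
  move=> w /andP[wx _]; rewrite HG big1 // => y' _.
  by rewrite /= dsum_prin // cmap_tr_neq 1?eq_sym // !linear0.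
rewrite HG (bigD1_seq y) //= linearD dsum_prin // cmap_tr_id dsum_prin //.
rewrite cmap_tr_id linear_sum big1_seq ?addr0 // => y' /andP[y'y _].
by rewrite dsum_prin // cmap_tr_neq.
Qed.

Lemma dsum_ext (f g : cmap T T) i :
  (forall x y z, dsum_pr e y i (f i (dsum_in e x i z)) =
                 dsum_pr e y i (g i (dsum_in e x i z))) ->
  forall z, f i z = g i z.
Proof.
move=> H z; rewrite [z](dsum_sumE _ ue) !linear_sum; apply: eq_bigr => x _.
rewrite [LHS](dsum_sumE _ ue) [RHS](dsum_sumE _ ue).
by apply: eq_bigr => y _; rewrite H.
Qed.

Lemma dsum_comp_entry (f g : cmap T T) x y i z :
  dsum_pr e y i (f i (g i (dsum_in e x i z))) =
  \sum_(w <- e) dsum_pr e y i (f i (dsum_in e w i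
                  (dsum_pr e w i (g i (dsum_in e x i z))))).
Proof. by rewrite {1}[g i _](dsum_sumE _ ue) !linear_sum. Qed.

End DirectSum.

Section IncidenceEnd.
Variables (k : fieldType) (A : kalgType k) (I : finType) (X : I -> cplx A).
Variables (le : rel I) (h : forall x y, cmap (X x) (X y)).
Hypothesis hid : forall x i z, h x x i z = z.
Hypothesis hcomp : forall x y w i z, le x y -> le y w ->
  h y w i (h x y i z) = h x w i z.
Hypothesis hspan : forall x y (f : cmap (X x) (X y)), le x y ->
  exists c, forall i z, f i z = kalg_map A c *: h x y i z.
Hypothesis hnull : forall x y (f : cmap (X x) (X y)), ~~ le x y ->
  forall i z, f i z = 0.
Hypothesis hfree : forall x y c, le x y ->
  homotopic (cmap_scale c (h x y)) (cmap_zero _ _) -> c = 0.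

Variables (B : kalgType k) (c : B -> I -> I -> k).
Hypothesis c1 : forall x y, c 1 x y = (x == y)%:R.
Hypothesis cD : forall a b x y, c (a + b) x y = c a x y + c b x y.
Hypothesis cM : forall a b x y, c (a * b) x y = \sum_w c b x w * c a w y.
Hypothesis cZ : forall s b x y, c (kalg_map B s * b) x y = s * c b x y.
Hypothesis c0 : forall b x y, ~~ le x y -> c b x y = 0.
Hypothesis cinj : forall a b, (forall x y, c a x y = c b x y) -> a = b.
Hypothesis csurj : forall d : I -> I -> k,
  (forall x y, ~~ le x y -> d x y = 0) -> exists b, forall x y, c b x y = d x y.

(** An endomorphism is the matrix of its components, and by the hypotheses on
    [h] these are scalars indexed by the pairs of [le] and multiplied as in the
    incidence algebra of [le]. The algebra [B] has the same description through
    the matrix entries [c b x y]; since composition is written from right to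
    left, its product multiplies the matrices in reverse order. *)
Lemma dEnd_incidence (e : seq I) : uniq e -> (forall x, x \in e) ->
  kproj (dsum (map X e)) -> dEnd_isom (dsum (map X e)) B.
Proof.
move=> ue fe kT; set T := dsum (map X e).
have /choice [F HF] : forall b : B, exists f : cmap T T, forall x y i z,
    dsum_pr X e y i (f i (dsum_in X e x i z)) = kalg_map A (c b x y) *: h x y i z.
  by move=> b; apply: (dsum_matrix_exists ue fe (fun x y => cmap_scale (c b x y) (h x y))).
apply: (dEnd_isom_homotopy (F := F) kT).
- apply: homotopic_ext => i; apply: (dsum_ext ue) => x y z.
  rewrite HF /= dsum_prin // c1; have [xy|xy] := eqVneq x y.
    by subst y; rewrite rmorph1 scale1r hid cmap_tr_id.
  by rewrite rmorph0 scale0r cmap_tr_neq.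
- move=> a b; apply: homotopic_ext => i; apply: (dsum_ext ue) => x y z.
  by rewrite HF /= linearD !HF cD rmorphD scalerDl.
- move=> a b; apply: homotopic_ext => i; apply: (dsum_ext ue) => x y z.
  rewrite HF /= dsum_comp_entry // cM rmorph_sum scaler_suml.
  rewrite [LHS](perm_big e) /=; last first.
    by apply: uniq_perm; rewrite ?index_enum_uniq // => w; rewrite fe mem_index_enum.
  apply: eq_bigr => w _; rewrite !HF linearZ /= scalerA rmorphM.
  have [xw|xw] := boolP (le x w); last by rewrite c0 // rmorph0 mul0r !(mulr0, scale0r).
  have [wy|wy] := boolP (le w y); last by rewrite (c0 a) // rmorph0 !(mulr0, mul0r, scale0r).
  by rewrite hcomp // kalg_mapC.
- move=> s b; apply: homotopic_ext => i; apply: (dsum_ext ue) => x y z.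
  by rewrite HF /= /lin_scale_fun linearZ /= HF scalerA -rmorphM -cZ.
- move=> a b Hab; apply: cinj => x y.
  have [xy|xy] := boolP (le x y); last by rewrite !c0.
  apply/eqP; rewrite -subr_eq0; apply/eqP; apply: (hfree xy).
  have H := homotopic_compl (dsum_pr X e y) (homotopic_compr (dsum_in X e x) Hab).
  have [t Ht] := H; exists t => i z; rewrite -Ht /= !HF /lin_scale_fun.
  by rewrite subr0 rmorphB scalerBl.
- move=> f.
  have Hd (p : I * I) : exists d : k, (~~ le p.1 p.2 -> d = 0) /\
      forall i z, dsum_pr X e p.2 i (f i (dsum_in X e p.1 i z)) =
        kalg_map A d *: h p.1 p.2 i z.
    pose g := cmap_comp (dsum_pr X e p.2) (cmap_comp f (dsum_in X e p.1)).
    have [xy|xy] := boolP (le p.1 p.2).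
      by have [d Hd] := hspan g xy; exists d; split=> // i z; rewrite -Hd.
    exists 0; split=> // i z; rewrite rmorph0 scale0r; exact: (hnull g xy).
  have [d {}Hd] := choice Hd.
  have [|b Hb] := csurj (d := fun x y => d (x, y)).
    by move=> x y xy; have [/(_ xy)] := Hd (x, y).
  exists b; apply: homotopic_ext => i; apply: (dsum_ext ue) => x y z.
  by rewrite HF Hb; have [_ ->] := Hd (x, y).
Qed.

End IncidenceEnd.

(** * Maps between three-term complexes *)

Section ThreeTerm.
Variables (k : fieldType) (A : kalgType k).

(** The part of the projectivity of M with which null-homotopies are built. *)
Definition liftable (M : lmodType A) := forall (Z : cplx A) p i
  (phi : {linear M -> Z i}), (forall x, exists z, phi x = diff Z p i z) ->
  exists psi : {linear M -> Z p}, forall x, phi x = diff Z p i (psi x).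

Lemma liftable_zmod : liftable (zmod A).
Proof.
move=> Z p i phi _; exists (lin_zero _ _) => x.
by rewrite (zmod_eq0 x) !linear0.
Qed.

Section Source.
Variables (M N L : lmodType A) (f : {linear M -> N}) (g : {linear N -> L}).
Hypothesis gf0 : forall x, g (f x) = 0.
Hypotheses (fgM : fin_gen M) (fgN : fin_gen N) (fgL : fin_gen L).
Local Notation X := (cplx3 gf0 fgM fgN fgL).

Lemma cplx3_0 (i : int) (x : X i) : (1 < absz i)%N -> x = 0.
Proof. by case: i x => [[|[|i]]|[|i]] // x _; apply: zmod_eq0. Qed.

Lemma null_cplx3 (Z : cplx A) (s : cmap X Z) (h1 : {linear L -> Z 0})
    (h0 : {linear N -> Z (-1)}) (hm : {linear M -> Z (-1 - 1)}) :
  (forall x : L, s 1 x = diff Z 0 1 (h1 x)) ->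
  (forall x : N, s 0 x = diff Z (-1) 0 (h0 x) + h1 (g x)) ->
  (forall x : M, s (-1) x = diff Z (-1 - 1) (-1) (hm x) + h0 (f x)) ->
  homotopic s (cmap_zero X Z).
Proof.
move=> H1 H0 Hm.
exists (fun i j => match i, j return {linear X i -> Z j} with
  | Posz 1, Posz 0 => h1
  | Posz 0, Negz 0 => h0
  | Negz 0, Negz 1 => hm
  | _, _ => lin_zero _ _ end).
case=> [[|[|i]]|[|i]] x; rewrite [RHS in _ = RHS]/= subr0.
- exact: H0.
- by rewrite [LHS]H1 addr0.
- by rewrite (zmod_eq0 x) !linear0 addr0.
- exact: Hm.
- by rewrite (zmod_eq0 x) !linear0 addr0.
Qed.

Lemma kproj_cplx3 : liftable M -> liftable N -> liftable L -> kproj X.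
Proof.
move=> lM lN lL Z s aZ.
have [|h1 H1] := lL Z 0 1 (s 1).
  by move=> x; apply: (aZ 0 1 2) => //; rewrite -(@cmapP _ _ _ _ s 1 2 x) /= linear0.
have [|h0 H0] := lN Z (-1) 0 (s 0 \- (h1 \o g)).
  move=> x; apply: (aZ (-1) 0 1) => //.
  by rewrite /= linearB /= -H1 -(@cmapP _ _ _ _ s 0 1 x) subrr.
have [|hm Hm] := lM Z (-1 - 1) (-1) (s (-1) \- (h0 \o f)).
  move=> x; apply: (aZ (-1 - 1) (-1) 0) => //.
  rewrite /= linearB /= -(@cmapP _ _ _ _ s (-1) 0 x) -H0 /= gf0 linear0 subr0.
  by rewrite subrr.
apply: (@null_cplx3 Z s h1 h0 hm) => // x; first by rewrite -H0 /= subrK.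
by rewrite -Hm /= subrK.
Qed.

End Source.

(** Maps between complexes M -> P -> L and M' -> P -> L', where the spaces of
    maps between the terms are spanned by the indicated elements. *)
Section Pair.
Variables (P M L M' L' : lmodType A).
Variables (f : {linear M -> P}) (g : {linear P -> L}).
Variables (f' : {linear M' -> P}) (g' : {linear P -> L'}).
Hypotheses (gf0 : forall x, g (f x) = 0) (gf0' : forall x, g' (f' x) = 0).
Hypotheses (fgM : fin_gen M) (fgM' : fin_gen M') (fgP fgP' : fin_gen P).
Hypotheses (fgL : fin_gen L) (fgL' : fin_gen L').
Local Notation X := (cplx3 gf0 fgM fgP fgL).
Local Notation Y := (cplx3 gf0' fgM' fgP' fgL').

Hypothesis hPM : forall (phi : {linear P -> M'}) x, phi x = 0.
Hypothesis hLP : forall (phi : {linear L -> P}) x, phi x = 0.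
Hypothesis hLM : forall (phi : {linear L -> M'}) x, phi x = 0.
Hypothesis hMP : forall phi : {linear M -> P},
  exists c, forall x, phi x = kalg_map A c *: f x.
Hypothesis hPL : forall phi : {linear P -> L'},
  exists c, forall x, phi x = kalg_map A c *: g' x.
Hypothesis hML : forall phi : {linear M -> L'},
  exists c, forall x, phi x = kalg_map A c *: g' (f x).

Lemma cmap_shift_pointwise n (s : cmap X (shift n Y)) :
  (forall x : L, s 1 x = 0) -> (forall x : P, s 0 x = 0) ->
  (forall x : M, s (-1) x = 0) -> homotopic s (cmap_zero _ _).
Proof.
move=> H1 H0 Hm; apply: homotopic_ext => -[[|[|i]]|[|i]] x //=.
by rewrite (zmod_eq0 x) linear0.
by rewrite (zmod_eq0 x) linear0.
Qed.

(** In degree 1 a map is c f on M and d g' on P. The multiple t of the identity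
    of P is a homotopy with components t f and - t g'. With t = - d it suffices
    if M = 0; with t = c it suffices if g' f is nonzero, since commutation with
    the differentials then gives d = - c, and it leaves (c + d) g' otherwise,
    which a map from L to L' taking g to g' removes. In degree 2 a map is
    c g' f, removed by the homotopy c g'. In the other nonzero degrees there are
    only zero maps. *)
Lemma cplx3_shift_null n (s : cmap X (shift n Y)) : n != 0 ->
  [\/ forall x : M, x = 0,
       forall c, (forall x, kalg_map A c *: g' (f x) = 0) -> c = 0 |
       exists gam : {linear L -> L'}, forall x, gam (g x) = g' x] ->
  homotopic s (cmap_zero _ _).
Proof.
have Y0 (i : int) (y : Y i) : (1 < absz i)%N -> y = 0 by apply: cplx3_0.
case: n s => [[|[|[|n]]]|[|[|n]]] s // _ Hx.
- have [c Hc] := hMP (s (-1)); have [d Hd] := hPL (s 0).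
  have dE (y : P) : diff (shift 1 Y) (-1) 0 y = - g' y.
    by rewrite /= /lin_scale_fun expr1 rmorphN1 scaleN1r.
  have Z1 (x : shift 1 Y 1) : x = 0 := @Y0 (1 + 1) x isT.
  have null (t : k) (gam : {linear L -> L'}) :
      (forall x : M, kalg_map A c *: f x = kalg_map A t *: f x) ->
      (forall x, kalg_map A d *: g' x = - (kalg_map A t *: g' x) + gam (g x)) ->
      homotopic s (cmap_zero _ _).
    move=> Hct Hdt; apply: (null_cplx3 (s := s) (h1 := gam : {linear L -> shift 1 Y 0})
      (h0 := lin_scale t idfun : {linear P -> shift 1 Y (-1)})
      (hm := lin_zero M (shift 1 Y (-1 - 1)))).
    + by move=> x; rewrite (Z1 (s 1 x)) (Z1 (diff _ _ _ _)).
    + by move=> x; rewrite dE Hd Hdt /= /lin_scale_fun [g' (_ *: _)]linearZ.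
    + by move=> x; rewrite Hc Hct /= linear0 add0r.
  have Hcd x : kalg_map A (c + d) *: g' (f x) = 0.
    have := @cmapP _ _ _ _ s (-1) 0 x; rewrite Hd Hc dE linearZ /= => /eqP.
    by rewrite -addr_eq0 -scalerDl -rmorphD addrC => /eqP.
  case: Hx => [M0|/(_ _ Hcd)/eqP cd|[gam Hgam]].
  + apply: (null (- d) (lin_zero _ _)) => x; first by rewrite (M0 x) linear0 !scaler0.
    by rewrite rmorphN scaleNr opprK addr0.
  + apply: (null c (lin_zero _ _)) => // x.
    by move: cd; rewrite addr0 addrC addr_eq0 => /eqP ->; rewrite rmorphN scaleNr.
  + apply: (null c (lin_scale (c + d) gam)) => // x.
    by rewrite /= /lin_scale_fun Hgam rmorphD scalerDl addKr.
- have [c Hc] := hML (s (-1)).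
  have Z1 (x : shift 2 Y 1) : x = 0 := @Y0 (1 + 2) x isT.
  have Z0 (x : shift 2 Y 0) : x = 0 := @Y0 (0 + 2) x isT.
  apply: (null_cplx3 (s := s) (h1 := lin_zero L (shift 2 Y 0))
    (h0 := lin_scale c g' : {linear P -> shift 2 Y (-1)})
    (hm := lin_zero M (shift 2 Y (-1 - 1)))) => x.
  + by rewrite (Z1 (s 1 x)) (Z1 (diff _ _ _ _)).
  + by rewrite (Z0 (s 0 x)) (Z0 (_ + _)).
  + by rewrite Hc /= linear0 add0r.
- apply: cmap_shift_pointwise => x; apply: Y0; lia.
- apply: cmap_shift_pointwise => x; [exact: hLP | exact: hPM | exact: (@Y0 (-1 - 1) _ isT)].
- apply: cmap_shift_pointwise => x.
  + exact: hLM.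
  + exact: (@Y0 (0 - 2) _ isT).
  + exact: (@Y0 (-1 - 2) _ isT).
- apply: cmap_shift_pointwise => x; apply: Y0; lia.
Qed.

Program Definition cplx3_map (a : {linear M -> M'}) (b : {linear L -> L'})
    (Ha : forall x, f' (a x) = f x) (Hb : forall x, b (g x) = g' x) : cmap X Y :=
  @Cmap _ _ X Y (fun i => match i return {linear X i -> Y i} with
    | Negz 0 => a | Posz 0 => idfun | Posz 1 => b | _ => lin_zero _ _ end) _.
Next Obligation.
move=> a b Ha Hb [[|[|i]]|[|i]] [[|[|j]]|[|j]] x //=; rewrite ?linear0 //.
Qed.

Hypothesis uM : forall a : {linear M -> M'}, (forall x, f' (a x) = 0) -> forall x, a x = 0.
Hypothesis uL : forall b : {linear L -> L'}, (forall x, b (g x) = 0) -> forall x, b x = 0.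

(** On maps between the outer terms, f' and g can be cancelled. *)
Lemma cplx3_map_uniq (s t : cmap X Y) : (forall x : P, s 0 x = t 0 x) ->
  forall i x, s i x = t i x.
Proof.
move=> H; case=> [[|[|i]]|[|i]] x; rewrite ?(zmod_eq0 x) ?linear0 //.
- apply/eqP; rewrite -subr_eq0; apply/eqP.
  pose b : {linear L -> L'} := s 1; pose b' : {linear L -> L'} := t 1.
  apply: (uL (b := b \- b')) => z; rewrite /= /b /b'.
  by rewrite (@cmapP _ _ _ _ s 0 1 z : s 1 (g z) = _)
    (@cmapP _ _ _ _ t 0 1 z : t 1 (g z) = _) H subrr.
- apply/eqP; rewrite -subr_eq0; apply/eqP.
  pose a : {linear M -> M'} := s (-1); pose a' : {linear M -> M'} := t (-1).
  apply: (uM (a := a \- a')) => z; rewrite linearB /a /a'.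
  by rewrite -(@cmapP _ _ _ _ s (-1) 0 z : _ = f' (s (-1) z))
    -(@cmapP _ _ _ _ t (-1) 0 z : _ = f' (t (-1) z)) H subrr.
Qed.

Hypothesis hPP : forall phi : {linear P -> P}, exists c, forall x, phi x = kalg_map A c *: x.

Lemma cplx3_map_span (h s : cmap X Y) : (forall x : P, h 0 x = x) ->
  exists c, forall i x, s i x = kalg_map A c *: h i x.
Proof.
move=> Hh; have [c Hc] := hPP (s 0); exists c => i x.
apply: (@cplx3_map_uniq s (cmap_scale c h)) => z.
by rewrite /= /lin_scale_fun Hh Hc.
Qed.

(** If no nonzero scalar on P extends to one of the outer terms, the component
    on P vanishes. *)
Lemma cplx3_map_null (s : cmap X Y) :
  (forall c (a : {linear M -> M'}), (forall x, f' (a x) = kalg_map A c *: f x) -> c = 0)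
  \/ (forall c (b : {linear L -> L'}), (forall x, b (g x) = kalg_map A c *: g' x) -> c = 0) ->
  forall i x, s i x = 0.
Proof.
move=> H; have [c Hc] := hPP (s 0).
suff c0 : c = 0.
  apply: (@cplx3_map_uniq s (cmap_zero X Y)) => z.
  by rewrite Hc c0 rmorph0 scale0r.
case: H => H; [apply: (H c (s (-1)))|apply: (H c (s 1))] => x.
  by rewrite -Hc; apply: esym (@cmapP _ _ _ _ s (-1) 0 x).
have := @cmapP _ _ _ _ s 0 1 x; rewrite Hc => -> /=; exact: linearZ.
Qed.

Hypothesis hP : forall c, (forall x : P, kalg_map A c *: x = 0) -> c = 0.

(** A homotopy has components from P to M' and from L to P in degree 0, which
    vanish. *)
Lemma cplx3_map_free (h : cmap X Y) c : (forall x : P, h 0 x = x) ->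
  homotopic (cmap_scale c h) (cmap_zero X Y) -> c = 0.
Proof.
move=> Hh [t Ht]; apply: hP => x.
have := Ht 0 x; rewrite /= /lin_scale_fun Hh subr0 => ->.
rewrite [X in _ + X](hLP (t 1 0)) addr0 [X in f' X](hPM (t 0 (-1))); exact: linear0.
Qed.

End Pair.
End ThreeTerm.

(** * Paths in the Nakayama algebra *)

Section NakayamaPaths.
Variables (k : fieldType) (n r : nat).
Local Notation Q := (nak_quiver n).
Local Notation N := (nakayama k n r).
Local Notation PA := (pathAlg k Q).

Definition opred (x : 'I_n) : 'I_n := Ordinal (leq_ltn_trans (leq_pred x) (ltn_ord x)).

Fixpoint walk (d : nat) (x : Q) : seq Q :=
  if d is d'.+1 then opred x :: walk d' (opred x) else [::].

Lemma size_walk d x : size (walk d x) = d.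
Proof. by elim: d x => [|d IH] x //=; rewrite IH. Qed.

Lemma walk_path d (x : 'I_n) : (d <= x)%N -> path (@arrow Q) x (walk d x).
Proof.
elim: d x => [|d IH] x //= dx; rewrite IH /=; last by lia.
by rewrite andbT; apply/eqP; lia.
Qed.

Lemma last_walk d (x : 'I_n) : (last x (walk d x) : 'I_n) = (x - d)%N :> nat.
Proof. by elim: d x => [|d IH] x /=; [rewrite subn0|rewrite IH /=; lia]. Qed.

Lemma nak_path_walk (x : 'I_n) s : path (@arrow Q) x s -> s = walk (size s) x.
Proof.
elim: s x => [|y s IH] x //= /andP[/eqP xy /IH {1}->].
by have -> : y = opred x by apply: val_inj; rewrite /= xy.
Qed.

Definition idem (x : Q) : PA := path_elt k x [::].
Definition wpath (x y : 'I_n) : PA := path_elt k (x : Q) (walk (x - y) x).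

(** Paths with the same source and the same length are equal. *)
Lemma wpath_mul (x y z : 'I_n) : (z <= y <= x)%N ->
  wpath y z * wpath x y = wpath x z.
Proof.
move=> /andP[zy yx]; rewrite [LHS]path_elt_mul ?walk_path ?leq_subr //.
have Ey : y = last x (walk (x - y) x) :> 'I_n.
  by apply: val_inj; rewrite /= last_walk subKn.
rewrite -Ey eqxx /wpath; congr path_elt.
have xw : path (@arrow Q) x (walk (x - y) x ++ walk (y - z) y).
  by rewrite cat_path -Ey !walk_path ?leq_subr.
rewrite (nak_path_walk xw) size_cat !size_walk; congr walk; lia.
Qed.

(** There is one path from x to y if y <= x, and none otherwise. *)
Lemma idem_mul_idem (x y : 'I_n) (z : PA) :
  exists c, idem y * z * idem x = c *: (if (y <= x)%N then wpath x y else 0).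
Proof.
elim/pathAlg_ind: z => [|f g [c Ec] [d Ed]|c f [d Ed]|[[v s] vs]].
- by exists 0; rewrite mulr0 mul0r scale0r.
- exists (c + d); rewrite scalerDl -Ec -Ed (mulrDr (idem y) f g).
  exact: (mulrDl _ _ (idem x)).
- exists (c * d); rewrite -scalerA -Ed.
  have -> : idem y * (c *: f) = c *: (idem y * f) := pathAlg_mulZr c (idem y) f.
  exact: pathAlg_mulZl.
rewrite -path_eltE /=; rewrite /= in vs.
rewrite [X in X * _]path_elt_mul //= cats0.
case: (y =P last v s) => [yv|_]; last by exists 0; rewrite mul0r scale0r.
have -> : path_elt k v s * path_elt k (x : Q) [::] =
    (if v == x then path_elt k (x : Q) s else 0) :> PA by rewrite [LHS]path_elt_mul.
case: (v =P x) => [vx|_]; last by exists 0; rewrite scale0r.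
subst v; have E := nak_path_size vs; rewrite -yv in E.
have -> : (y <= x)%N by lia.
exists 1; rewrite scale1r (nak_path_walk vs) /wpath; congr (path_elt _ _ (walk _ _)); lia.
Qed.

(** The elements with zero coefficients at all paths of length less than r form
    an ideal which contains the relations; hence a path of length less than r is
    not zero in the quotient. *)
Definition long (f : PA) := forall q : qpath Q, (size (val q).2 < r)%N -> mcoeff q f = 0.

Lemma mcoeff_path_elt (x : Q) s (q : qpath Q) : size (val q).2 != size s ->
  mcoeff q (path_elt k x s) = 0.
Proof.
move=> qs; have [xs|xs] := boolP (path (@arrow Q) x s); last by rewrite path_elt0 // mcoeff0.
rewrite (path_eltE k (Sub (x, s) xs : qpath Q)) mcoeffU.
by case: eqVneq => // E; rewrite -E eqxx in qs.
Qed.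

Lemma mcoeff_path_comp (p q w : qpath Q) :
  size (val w).2 != (size (val q).2 + size (val p).2)%N ->
  mcoeff w (path_comp k p q) = 0.
Proof.
move=> H; rewrite /path_comp; case: eqP => _; last exact: mcoeff0.
by rewrite mcoeff_path_elt // size_cat.
Qed.

Lemma mcoeff_pathAlg_mul (f g : PA) w :
  mcoeff w (f * g) = \sum_(p <- msupp f) \sum_(q <- msupp g)
    mcoeff p f * mcoeff q g * mcoeff w (path_comp k p q).
Proof.
rewrite [f * g]/(pathAlg_mul f g) /pathAlg_mul raddf_sum /=.
apply: eq_bigr => p _; rewrite raddf_sum /=; apply: eq_bigr => q _.
exact: mcoeffZ.
Qed.

Lemma gen_ideal_long (f : PA) : gen_ideal (@nak_rel k n r) f -> long f.
Proof.
elim=> {f} [f [p sp ->]||x y _ Hx _ Hy|a f _ Hf|a f _ Hf] w wr.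
- by rewrite mcoeffU; case: eqVneq => // pw; move: wr; rewrite -pw sp ltnn.
- exact: mcoeff0.
- by rewrite mcoeffD Hx // Hy // addr0.
- rewrite mcoeff_pathAlg_mul big1 // => p _; rewrite big1 // => q _.
  have [qr|rq] := ltnP (size (val q).2) r; first by rewrite (Hf q qr) mulr0 mul0r.
  rewrite mcoeff_path_comp ?mulr0 // neq_ltn.
  by rewrite (leq_trans wr) // (leq_trans rq) // leq_addr.
- rewrite mcoeff_pathAlg_mul big1 // => p _; rewrite big1 // => q _.
  have [pr|rp] := ltnP (size (val p).2) r; first by rewrite (Hf p pr) !mul0r.
  rewrite mcoeff_path_comp ?mulr0 // neq_ltn.
  by rewrite (leq_trans wr) // (leq_trans rp) // leq_addl.
Qed.

Lemma wpath_free (x y : 'I_n) c : (x - y < r)%N ->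
  gen_ideal (@nak_rel k n r) (c *: wpath x y) -> c = 0.
Proof.
move=> xy /gen_ideal_long H.
have xw : path (@arrow Q) x (walk (x - y) x) by rewrite walk_path ?leq_subr.
have := H (Sub ((x : Q), walk (x - y) x) xw : qpath Q).
rewrite size_walk => /(_ xy); rewrite mcoeffZ /wpath.
by rewrite (path_eltE k (Sub ((x : Q), walk (x - y) x) xw : qpath Q)) mcoeffUU mulr1.
Qed.

End NakayamaPaths.

(** * Modules generated by idempotents *)

Lemma kalg_scale0 (k : fieldType) (A : kalgType k) (M : lmodType A) (x : M) :
  kalg_map A 0 *: x = 0.
Proof. by rewrite rmorph0 scale0r. Qed.

Section Idempotent.
Variables (k : fieldType) (A : kalgType k) (e : A).
Hypothesis ee : e * e = e.

Lemma lideal_gen_idem : e *: lideal_gen e = lideal_gen e.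
Proof. exact: val_inj. Qed.

Lemma lideal_gen_span (p : lideal e) : p = (lideal_val p : A) *: lideal_gen e.
Proof.
apply: val_inj; have /lideal_predP [y Hy] := valP p.
by rewrite /= Hy; change (y * e = y * e * e); rewrite -mulrA ee.
Qed.

Section LidealMap.
Variables (M : lmodType A) (x : M).
Definition lideal_map_fun (p : lideal e) : M := (lideal_val p : A) *: x.
Lemma lideal_map_linear : linear lideal_map_fun.
Proof. by move=> a p q; rewrite /lideal_map_fun /= scalerDl scalerA. Qed.
HB.instance Definition _ := GRing.isLinear.Build A (lideal e) M *:%R
  lideal_map_fun lideal_map_linear.
(** The map sending the generator to x, when x = e x. *)
Definition lideal_map : {linear lideal e -> M} := lideal_map_fun.
End LidealMap.

Lemma liftable_lideal : liftable (lideal e).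
Proof.
move=> Z p i phi H; have [z Hz] := H (lideal_gen e).
have E : diff Z p i (e *: z) = phi (lideal_gen e).
  by rewrite -[in RHS]lideal_gen_idem !linearZ /= Hz.
exists (lideal_map (e *: z)) => q; rewrite {1}[q]lideal_gen_span.
by rewrite [LHS]linearZ [RHS]linearZ /= E.
Qed.

End Idempotent.
(** * Generation by the indecomposable projectives *)

Section Span.
Variables (k : fieldType) (A : kalgType k).

(** The k-span of a list, encoded without sums, so that induction on the list
    handles one coefficient at a time. *)
Fixpoint kspan (M : lmodType A) (l : seq M) (z : M) : Prop :=
  if l is x :: l' then exists c, kspan l' (z - kalg_map A c *: x) else z = 0.

Lemma kspanP (M : lmodType A) (l : seq M) z z' c :
  kspan l z -> kspan l z' -> kspan l (z + kalg_map A c *: z').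
Proof.
elim: l z z' => [|x l IH] z z' /=; first by move=> -> ->; rewrite scaler0 addr0.
move=> [d Hd] [d' Hd']; exists (d + c * d').
have := IH _ _ Hd Hd'; rewrite scalerBr addrACA -opprD scalerA -scalerDl.
by rewrite rmorphD rmorphM.
Qed.

Lemma kspan_sum (M : lmodType A) (J : Type) (r : seq J) (F : J -> M) (d : J -> k) :
  kspan (map F r) (\sum_(j <- r) kalg_map A (d j) *: F j).
Proof.
elim: r => [|j r IH] /=; first by rewrite big_nil.
by exists (d j); rewrite big_cons addrC addKr.
Qed.

(** A subspace W of a finite-dimensional space is finite-dimensional: if some
    element of W involves the first generator, it serves to remove that generator
    from all others. *)
Lemma kspan_subspace (M : lmodType A) (W : M -> Prop) (g : seq M) :
  (forall z z' c, W z -> W z' -> W (z + kalg_map A c *: z')) ->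
  exists2 l : seq M, List.Forall W l & forall z, W z -> kspan g z -> kspan l z.
Proof.
move=> HW; elim: g => [|x g [l Wl Hl]]; first by exists [::]; [constructor|].
have [[w [c [Ww c0 Hw]]]|no] := pselect (exists w c,
  [/\ W w, c != 0 & kspan g (w - kalg_map A c *: x)]).
  exists (w :: l); first by constructor.
  move=> z Wz [d Hd]; exists (d / c).
  rewrite -scaleNr -rmorphN; apply: Hl; first exact: HW.
  have := kspanP (- (d / c)) Hd Hw; rewrite scalerBr addrACA scalerA -rmorphM.
  by rewrite mulNr mulfVK // [in X in _ + (_ - X)]rmorphN scaleNr opprK addNr addr0.
exists l => // z Wz [d Hd]; apply: Hl => //; have [d0|d0] := eqVneq d 0.
  by move: Hd; rewrite d0 rmorph0 scale0r subr0.
by case: no; exists z, d.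
Qed.

(** The analogous notion for homogeneous elements of a complex, modulo
    coboundaries. *)
Definition hel (X : cplx A) := {j : int & X j}.
Definition to_hel (X : cplx A) j (x : X j) : hel X := existT _ j x.
Definition hel_map (X Y : cplx A) (f : cmap X Y) (s : hel X) : hel Y :=
  to_hel (f _ (projT2 s)).

Fixpoint hspan (X : cplx A) (l : seq (hel X)) i (z : X i) : Prop :=
  if l is s :: l' then
    exists c, hspan l' (z - kalg_map A c *: tr X (projT1 s) i (projT2 s))
  else exists y, z = diff X (i - 1) i y.

Lemma hspanP X (l : seq (hel X)) i (z z' : X i) c :
  hspan l z -> hspan l z' -> hspan l (z + kalg_map A c *: z').
Proof.
elim: l z z' => [|x l IH] z z' /=.
  by move=> [y ->] [y' ->]; exists (y + kalg_map A c *: y'); rewrite linearD linearZ.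
move=> [d Hd] [d' Hd']; exists (d + c * d').
have := IH _ _ Hd Hd'; rewrite scalerBr addrACA -opprD scalerA -scalerDl.
by rewrite rmorphD rmorphM.
Qed.

Lemma hspan_diff X (l : seq (hel X)) p i (z : X i) (y : X p) : i = p + 1 ->
  z = diff X p i y -> hspan l z.
Proof.
move=> ip zy; have pi : p = i - 1 by rewrite ip addrK.
elim: l => [|s l IH] /=; last by exists 0; rewrite rmorph0 scale0r subr0.
by move: y zy; rewrite pi => y ->; exists y.
Qed.

Lemma hspan0 X (l : seq (hel X)) i : hspan l (0 : X i).
Proof. by apply: (@hspan_diff _ _ (i - 1) _ _ 0); rewrite ?linear0 ?subrK. Qed.

Lemma hspan_tr X (l : seq (hel X)) i j (z : X i) : hspan l z -> hspan l (tr X i j z).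
Proof.
have [<-|ij] := eqVneq i j; first by rewrite tr_id.
by move=> _; rewrite tr_neq //; apply: hspan0.
Qed.

Lemma hspan_catl X (l l' : seq (hel X)) i (z : X i) : hspan l' z -> hspan (l ++ l') z.
Proof.
move=> H; elim: l => [|s l IH] //=.
by exists 0; rewrite rmorph0 scale0r subr0.
Qed.

Lemma hspan_catr X (l l' : seq (hel X)) i (z : X i) : hspan l z -> hspan (l ++ l') z.
Proof.
elim: l z => [|s l IH] z /=; last by move=> [c /IH H]; exists c.
by move=> [y ->]; exact: (hspan_diff _ (esym (subrK 1 i)) erefl).
Qed.

Lemma hspan_map X Y (f : cmap X Y) (l : seq (hel X)) i (z : X i) :
  hspan l z -> hspan [seq hel_map f s | s <- l] (f i z).
Proof.
elim: l z => [|s l IH] z /=.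
  by move=> [y ->]; exists (f _ y); rewrite cmapP.
move=> [c /IH H]; exists c.
by rewrite tr_cmap -linearZ -linearB.
Qed.

Lemma hspan_kspan (X : cplx A) i (l : seq (X i)) z : kspan l z ->
  hspan [seq to_hel x | x <- l] z.
Proof.
elim: l z => [|x l IH] z /=; first by move=> ->; exists 0; rewrite linear0.
by move=> [c /IH H]; exists c; rewrite tr_id.
Qed.

End Span.

(** Idempotents e_x with sum 1, such that e_y A e_x is spanned by one element,
    which is zero for x < y and e_x for x = y. Every module M is the sum of its
    subspaces e_x M. *)
Section Generation.
Variables (k : fieldType) (A : kalgType k) (n : nat).
Variables (e : 'I_n -> A) (w : 'I_n -> 'I_n -> A).
Hypothesis e_sum : \sum_x e x = 1.
Hypothesis e_idem : forall x, e x * e x = e x.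
Hypothesis e_sandwich : forall x y z, exists c, e y * z * e x = kalg_map A c * w x y.
Hypothesis w_id : forall x, w x x = e x.
Hypothesis w_up : forall x y : 'I_n, (x < y)%N -> w x y = 0.

Definition stalk (M : lmodType A) (fgM : fin_gen M) : cplx A :=
  cplx3 (f := lin_zero (zmod A) M) (g := lin_zero M (zmod A)) (fun=> erefl)
    (fin_gen_zmod A) fgM (fin_gen_zmod A).

Lemma stalk_diff M fgM i j (x : @stalk M fgM i) : diff (stalk fgM) i j x = 0.
Proof. by case: i x => [[|[|i]]|[|i]] x; case: j => [[|[|j]]|[|j]]. Qed.

Lemma stalk_0 M fgM i (x : @stalk M fgM i) : i != 0 -> x = 0.
Proof. by case: i x => [[|[|i]]|[|i]] // x _; apply: zmod_eq0. Qed.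

Section Kill.
Variables (X : cplx A) (j : int) (x : X j) (a : 'I_n).
Hypothesis dx : diff X j (j + 1) x = 0.
Hypothesis ex : e a *: x = x.
Hypothesis fgP : fin_gen (lideal (e a)).
Local Notation S := (shift (- j) (stalk fgP)).

(** The map from the projective A e_a, placed in degree j, which
    sends the generator to the cocycle x. *)
Program Definition kill_map : cmap S X :=
  @Cmap _ _ S X (fun i => lin_comp (tr X j i)
     (lin_comp (lideal_map (e a) x) (tr (stalk fgP) (i - j) 0))) _.
Next Obligation.
move=> i i' p; rewrite [diff S _ _ _]/= /lin_scale_fun stalk_diff scaler0 linear0.
rewrite /=; set y := lideal_map_fun _ _.
have dy l : diff X j l y = 0.
  have [->|jl] := eqVneq l (j + 1); last by rewrite diff_shape.
  by rewrite linearZ /= dx scaler0.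
have [<-|ji] := eqVneq j i; first by rewrite tr_id dy.
by rewrite tr_neq // linear0.
Qed.

Local Notation X' := (cone kill_map).

(** The first component of an element of the cone, moved to degree 0. *)
Definition proj_part i (p : S i) : lideal (e a) := tr (stalk fgP) (i - j) 0 p.

Lemma kill_map_boundary i l : hspan (X := X') l (cone_inr kill_map i (tr X j i x)).
Proof.
have [<-|ji] := eqVneq j i; last by rewrite tr_neq // linear0; apply: hspan0.
pose q : S (j - 1 + 1) := tr (stalk fgP) 0 (j - 1 + 1 - j) (lideal_gen (e a)).
apply: (@hspan_diff _ _ X' l (j - 1) j _ (q, 0)); first by rewrite subrK.
rewrite tr_id /= /lin_pair_fun /= /lin_scale_fun stalk_diff scaler0 oppr0 linear0 addr0.
congr pair; rewrite tr_cancel; last by rewrite subrK.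
have Eq : proj_part q = lideal_gen (e a) by rewrite /proj_part /q tr_cancel //; lia.
rewrite -[X in lideal_map_fun x X]/(proj_part q) Eq.
exact: esym ex.
Qed.

Lemma proj_part0 i (p : S i) : (i = j -> proj_part p = 0) -> p = 0.
Proof.
move=> H; have [ij|ij] := eqVneq (i - j) 0; last exact: stalk_0.
have E : i = j by move: ij => /eqP; rewrite subr_eq0 => /eqP.
have := congr1 (tr (stalk fgP) 0 (i - j)) (H E).
by rewrite /proj_part tr_cancel // linear0.
Qed.

Lemma cone_kill_cycle i (p : S (i + 1)) (z : X i) :
  diff X' i (i + 1) (p, z) = 0 ->
  tr X j (i + 1) (lideal_map (e a) x (proj_part p)) + diff X i (i + 1) z = 0.
Proof.
move=> H; have := congr1 snd H; rewrite /= /lin_pair_fun /= tr_id.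
exact.
Qed.

Lemma proj_part_fix b i (p : S i) : e b *: p = p ->
  exists c, lideal_val (proj_part p) = kalg_map A c * w a b :> A.
Proof.
move=> bp; have {}bp : e b *: proj_part p = proj_part p.
  by rewrite /proj_part -[LHS]linearZ /= bp.
have [c Hc] := e_sandwich a b (lideal_val (proj_part p)); exists c; rewrite -Hc.
rewrite -{1}bp; have /lideal_predP [y Hy] := valP (proj_part p).
by rewrite /= Hy; change (e b * (y * e a) = e b * (y * e a) * e a); rewrite -!mulrA e_idem.
Qed.

Lemma hspan_inr l i (z : X i) : hspan l z ->
  hspan (X := X') (map (hel_map (cone_inr kill_map)) l) ((0, z) : X' i).
Proof. by move=> /(hspan_map (cone_inr kill_map)). Qed.

(** As e_b A e_a = 0 for a < b, cohomology that vanishes at later vertices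
    still vanishes there after passing to the cone. *)
Lemma kill_acyclic (b : 'I_n) : (a < b)%N ->
  (forall i (z : X i), diff X i (i + 1) z = 0 -> e b *: z = z -> hspan [::] z) ->
  forall i (z : X' i), diff X' i (i + 1) z = 0 -> e b *: z = z -> hspan [::] z.
Proof.
move=> ab H i [p z] /cone_kill_cycle Hd E.
have bp : e b *: p = p := congr1 fst E; have bz : e b *: z = z := congr1 snd E.
have q0 : proj_part p = 0.
  have [c Hc] := proj_part_fix bp; apply: val_inj.
  by rewrite /= Hc w_up // mulr0.
have -> : p = 0 by apply: proj_part0.
apply: (@hspan_inr [::]); apply: H => //.
by move: Hd; rewrite q0 !linear0 add0r.
Qed.

(** As e_a A e_a = k e_a, a cocycle (p, z) of the cone fixed by e_a with p
    nonzero would make x a coboundary; so p = 0, and the class of x, which the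
    cone kills, is no longer needed among the generators. *)
Lemma kill_span l : ~ hspan l x ->
  (forall i (z : X i), diff X i (i + 1) z = 0 -> e a *: z = z ->
     hspan (to_hel x :: l) z) ->
  forall i (z : X' i), diff X' i (i + 1) z = 0 -> e a *: z = z ->
     hspan (map (hel_map (cone_inr kill_map)) l) z.
Proof.
move=> nx H i [p z] /cone_kill_cycle Hd E.
have ap : e a *: p = p := congr1 fst E; have az : e a *: z = z := congr1 snd E.
have p0 : p = 0.
  apply: proj_part0 => ij.
  have [c Hc] := proj_part_fix ap; rewrite w_id in Hc.
  have [c0|c0] := eqVneq c 0; first by apply: val_inj; rewrite /= Hc c0 rmorph0 mul0r.
  case: nx; apply: (@hspan_diff _ _ X l i j x (- (kalg_map A c^-1 *: z))) => //.
  move: Hd; rewrite /lideal_map /= /lideal_map_fun Hc.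
  rewrite -scalerA ex linearZ /= => Hd.
  have : tr X (i + 1) j (kalg_map A c *: tr X j (i + 1) x + diff X i (i + 1) z) = 0.
    by rewrite Hd linear0.
  rewrite linearD linearZ /= tr_cancel // (@tr_diff _ _ X _ _ i) // tr_id => /eqP.
  rewrite addr_eq0 => /eqP E2; rewrite linearN linearZ /= -scalerN -E2 scalerA -rmorphM.
  by rewrite mulVf // rmorph1 scale1r.
rewrite p0 in Hd *; have dz : diff X i (i + 1) z = 0.
  by move: Hd; rewrite /proj_part !linear0 add0r.
have [c Hc] := H i z dz az; rewrite /= in Hc.
have := hspanP c (hspan_inr Hc) (kill_map_boundary i _).
congr hspan; congr pair; rewrite /= ?addr0 ?scaler0 ?addr0 //.
by rewrite subrK.
Qed.

End Kill.
Lemma fin_gen_kspan (M : lmodType A) a : fin_gen M ->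
  exists g : seq M, forall z, e a *: z = z -> kspan g z.
Proof.
move=> [q [g Hg]].
pose F (p : 'I_q * 'I_n) := w p.2 a *: g p.1.
exists (map F (index_enum _)) => z az; have [c Hc] := Hg z.
have [d Hd] := choice (fun p : 'I_q * 'I_n => e_sandwich p.2 a (c p.1)).
rewrite (_ : z = \sum_p kalg_map A (d p) *: F p); first exact: kspan_sum.
transitivity (\sum_i \sum_b kalg_map A (d (i, b)) *: F (i, b)); last first.
  by rewrite pair_bigA; apply: eq_bigr => -[].
rewrite -az Hc scaler_sumr; apply: eq_bigr => i _.
rewrite scalerA -[e a * c i]mulr1 -e_sum mulr_sumr scaler_suml.
by apply: eq_bigr => b _; rewrite (Hd (i, b)) /F scalerA.
Qed.

Definition cocycle_at (X : cplx A) a (s : hel X) :=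
  diff X (projT1 s) (projT1 s + 1) (projT2 s) = 0 /\ e a *: projT2 s = projT2 s.

Definition spans_at (X : cplx A) a (l : seq (hel X)) :=
  forall i (z : X i), diff X i (i + 1) z = 0 -> e a *: z = z -> hspan l z.

Lemma spans_at_exists (X : cplx A) a :
  exists2 l, List.Forall (cocycle_at a) l & @spans_at X a l.
Proof.
suff H (s : seq int) : exists2 l : seq (hel X), List.Forall (cocycle_at a) l &
    forall i (z : X i), i \in s -> diff X i (i + 1) z = 0 -> e a *: z = z -> hspan l z.
  have [B HB] := obj_bounded X.
  have [l Hl Hs] := H [seq (t%:Z - B%:Z) | t <- iota 0 (B + B + 1)].
  exists l => // i z dz az.
  have [iB|iB] := ltnP B (absz i); first by rewrite (HB i iB z); apply: hspan0.
  apply: Hs => //; apply/mapP; exists (absz (i + B%:Z)); last by lia.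
  by rewrite mem_iota; lia.
elim: s => [|i s [l Hl Hs]]; first by exists [::].
have [g Hg] := fin_gen_kspan a (obj_fg X i).
have [|l' Wl' Hl'] := @kspan_subspace _ _ (X i)
  (fun z => diff X i (i + 1) z = 0 /\ e a *: z = z) g.
  move=> z z' c [dz az] [dz' az']; split.
    by rewrite linearD linearZ /= dz dz' scaler0 addr0.
  by rewrite scalerDr scalerA -kalg_mapC -scalerA az az'.
exists (map (@to_hel _ _ X i) l' ++ l).
  by apply/List.Forall_app; split=> //; elim: Wl' => //= *; constructor.
move=> j z; rewrite in_cons => /orP[/eqP ji|js] dz az; last first.
  by apply: hspan_catl; apply: Hs.
subst j; apply: hspan_catr; apply: hspan_kspan; apply: Hl'; [by split|exact: Hg].
Qed.

(** z is the sum of the e_a z, because 1 is the sum of the e_a. *)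
Lemma acyclic_spans (X : cplx A) : (forall a, @spans_at X a [::]) -> acyclic X.
Proof.
move=> H p i q z ip iq dz; subst i q.
have /choice [y Hy] : forall a, exists y, e a *: z = diff X (p + 1 - 1) (p + 1) y.
  move=> a; apply: (H a); first by rewrite linearZ /= dz scaler0.
  by rewrite scalerA e_idem.
move: y Hy; rewrite addrK => y Hy.
exists (\sum_a y a); rewrite linear_sum -[z]scale1r -e_sum scaler_suml.
exact: eq_bigr.
Qed.

(** Induction on the number m of vertices at which cohomology may remain. At the
    last of them, a, a finite list of cocycles generates the cohomology; each one
    is either redundant or removed by passing to a cone, which changes neither
    the vanishing at later vertices nor membership in C. *)
Lemma stalks_generate (C : cplx A -> Prop) : thick C -> (exists X, C X) ->
  (forall a (fgP : fin_gen (lideal (e a))), C (stalk fgP)) ->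
  forall X, C X.
Proof.
move=> thC [X0 CX0] CP.
suff H m X : (forall b : 'I_n, (m <= b)%N -> @spans_at X b [::]) -> C X.
  by move=> X; apply: (H n) => b; rewrite leqNgt ltn_ord.
elim: m X => [|m IH] X HX.
  by apply: (thick_acyclic thC (X := X0)) => //; apply: acyclic_spans => a; apply: HX.
have [mn|nm] := ltnP m n; last first.
  by apply: IH => b mb; have := ltn_ord b; lia.
pose a := Ordinal mn.
have [l] := spans_at_exists X a; move El : (size l) => q.
elim: q X l HX El => [|q IHq] X [|[j x] l] //= HX.
  move=> _ _ Hl; apply: IH => b; rewrite leq_eqVlt => /orP[/eqP mb|mb]; last exact: HX.
  by have -> : b = a by apply: val_inj.
move=> [El] /List.Forall_cons_iff [[/= dx ax] Hl] Hs.
have [xl|nxl] := pselect (hspan l x).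
  apply: (IHq X l) => // i z dz az; have [c /= Hc] := Hs i z dz az.
  by have := hspanP c Hc (hspan_tr i xl); rewrite subrK.
have fgP : fin_gen (lideal (e a)).
  exists 1%N, (fun _ => lideal_gen (e a)) => p.
  by exists (fun _ => lideal_val p); rewrite big_ord1 -lideal_gen_span.
apply: (thick_cone_target thC (f := kill_map dx fgP)).
  by apply: (thick_shift thC); apply: CP.
apply: (IHq _ (map (hel_map (cone_inr (kill_map dx fgP))) l)).
- by move=> b mb; apply: kill_acyclic => //; apply: HX.
- by rewrite size_map.
- elim: Hl {El Hs nxl} => //= -[i z] l' [/= dz az] _ IHl; constructor=> //; split.
    by rewrite -[LHS](cmapP (cone_inr (kill_map dx fgP)) (i + 1) z) dz linear0.
  by congr pair; rewrite /= ?scaler0.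
- exact: kill_span.
Qed.

End Generation.

(** * Recovering the terms of a three-term complex *)

Section Terms.
Variables (k : fieldType) (A : kalgType k) (C : cplx A -> Prop) (thC : thick C).

Program Definition dsum_swap (X Y : cplx A) : cmap (dsum2 X Y) (dsum2 Y X) :=
  @Cmap _ _ (dsum2 X Y) (dsum2 Y X) (fun i => lin_pair snd fst) _.
Next Obligation. by []. Qed.

Lemma thick_dsum (s : seq (cplx A)) X : C (dsum s) -> List.In X s -> C X.
Proof.
elim: s => [|Y s IH] //= CYs [<-|Xs]; first exact: (thick_summand thC CYs).
apply: IH => //; apply: (thick_summand thC (Y := Y)).
apply: (thick_qis thC (f := dsum_swap _ _)) CYs.
refine (@qis_bij _ _ _ _ (dsum_swap Y (dsum s)) (fun i p => (p.2, p.1)) _ _) => i; by case.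
Qed.

(* Complexes carry proofs of finite generation; the primed variables allow
   different proofs for the same module. *)
Variables (M N L : lmodType A) (f : {linear M -> N}) (g : {linear N -> L}).
Hypotheses (gf0 : forall x, g (f x) = 0) (g00 : forall x, g (lin_zero (zmod A) N x) = 0).
Hypotheses (fgM fgM' : fin_gen M) (fg0 : fin_gen (zmod A)) (fgN fgN' fgN'' : fin_gen N).
Hypotheses (fgL fgL' fgL'' : fin_gen L).
Local Notation X := (cplx3 gf0 fgM fgN fgL).
Local Notation X0 := (cplx3 g00 fg0 fgN' fgL').

(** X0 is N -> L; it maps onto the stalk of N, and the cone of this map is the
    stalk of L up to quasi-isomorphism. *)
Program Definition term_proj : cmap X0 (stalk fgN'') :=
  @Cmap _ _ X0 (stalk fgN'') (fun i => match i return {linear X0 i -> stalk fgN'' i} with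
    | Posz 0 => idfun | _ => lin_zero _ _ end) _.
Next Obligation.
by move=> i j x; rewrite stalk_diff; case: i x => [[|[|i]]|[|i]] x; case: j => [[|[|j]]|[|j]].
Qed.

Program Definition term_proj_cone : cmap (stalk fgL'') (cone term_proj) :=
  @Cmap _ _ (stalk fgL'') (cone term_proj)
   (fun i => match i return {linear stalk fgL'' i -> cone term_proj i} with
    | Posz 0 => lin_pair (idfun : {linear L -> X0 1}) (lin_zero L (stalk fgN'' 0))
    | _ => lin_zero _ _ end) _.
Next Obligation.
move=> i j x; rewrite stalk_diff linear0; have [i0|i0] := eqVneq i 0; last first.
  by rewrite (stalk_0 x i0) !linear0.
subst i; rewrite [LHS](_ : 0 = (0, 0)) //; congr pair; first by rewrite /= oppr0.
by rewrite /= linear0 add0r [RHS](linear0 (diff (stalk fgN'') 0 j)).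
Qed.

Lemma qis_term_proj_cone : qis term_proj_cone.
Proof.
move=> i; split.
  move=> x _; have [i0|i0] := eqVneq i 0; last first.
    by move=> _; exists 0; rewrite linear0; apply: stalk_0.
  subst i; move=> [[y1 y2] E]; exists 0; rewrite linear0.
  have := congr1 snd E; have := congr1 fst E; rewrite /= tr_id.
  by rewrite !addr0 => -> <-; rewrite linear0 oppr0.
have null (y : cone term_proj i) : y = 0 -> exists2 x : stalk fgL'' i,
    diff (stalk fgL'') i (i + 1) x = 0 &
    exists y', y - term_proj_cone i x = diff (cone term_proj) (i - 1) i y'.
  by move=> ->; exists 0; [rewrite linear0 | exists 0; rewrite !linear0 addr0].
case: i null => [[|[|i]]|[|[|i]]] null [l y] dly.
- exists (l + g y); first exact: stalk_diff.
  exists (y, 0); rewrite /= /lin_pair_fun /= tr_id !addr0.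
  by congr pair; rewrite /= ?subr0 // opprD addNKr.
- by apply: null; congr pair; apply: zmod_eq0.
- by apply: null; congr pair; apply: zmod_eq0.
- apply: null; have := congr1 snd dly; rewrite /= tr_id addr0 => l0.
  by congr pair; [exact: l0|exact: zmod_eq0].
- by apply: null; congr pair; apply: zmod_eq0.
- by apply: null; congr pair; apply: zmod_eq0.
Qed.

(** X0 is the subcomplex of X without M; the cone of the inclusion is M, in degree
    - 1, up to quasi-isomorphism. *)
Program Definition term_inj : cmap X0 X :=
  @Cmap _ _ X0 X (fun i => match i return {linear X0 i -> X i} with
    | Posz 0 => idfun | Posz 1 => idfun | _ => lin_zero _ _ end) _.
Next Obligation.
move=> [[|[|i]]|[|i]] [[|[|j]]|[|j]] x //=; rewrite ?(zmod_eq0 x) ?linear0 //.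
Qed.

Program Definition term_inj_cone : cmap (shift 1 (stalk fgM')) (cone term_inj) :=
  @Cmap _ _ (shift 1 (stalk fgM')) (cone term_inj)
   (fun i => match i return {linear shift 1 (stalk fgM') i -> cone term_inj i} with
    | Negz 0 => lin_pair (\- f : {linear M -> X0 0}) (idfun : {linear M -> X (-1)})
    | _ => lin_zero _ _ end) _.
Next Obligation.
move=> i j x; rewrite [diff _ i j x]/= /lin_scale_fun stalk_diff scaler0 linear0.
have [i0|i0] := eqVneq i (-1); last first.
  rewrite (_ : x = 0) ?linear0 //; apply: (@stalk_0 _ _ _ _ (i + 1)); lia.
subst i; rewrite [LHS](_ : 0 = (0, 0)) //; have [j0|j0] := eqVneq j 0.
  subst j; congr pair; rewrite /= ?tr_id; last by rewrite addNr.
  by rewrite linearN /= gf0 oppr0 oppr0.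
by rewrite diff_shape.
Qed.

Lemma qis_term_inj_cone : qis term_inj_cone.
Proof.
move=> i; split.
  move=> x _; have [i0|i0] := eqVneq i (-1); last first.
    by move=> _; exists 0; rewrite linear0; apply: (@stalk_0 _ _ _ _ (i + 1)); lia.
  subst i; move=> [[y1 y2] E]; exists 0; rewrite linear0.
  have := congr1 snd E; rewrite /= => ->.
  by rewrite addr0 linear0.
have null (y : cone term_inj i) z : y = diff (cone term_inj) (i - 1) i z ->
    exists2 x : shift 1 (stalk fgM') i, diff (shift 1 (stalk fgM')) i (i + 1) x = 0 &
    exists y', y - term_inj_cone i x = diff (cone term_inj) (i - 1) i y'.
  by move=> yz; exists 0; [rewrite linear0 | exists z; rewrite linear0 subr0].
case: i null => [[|[|i]]|[|[|i]]] null [y1 y2] dy.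
- apply: (null _ (y2, 0)).
  have := congr1 snd dy; rewrite /= /lin_pair_fun /= !tr_id.
  move=> /eqP; rewrite addr_eq0 => /eqP ->.
  by rewrite linear0 addr0.
- apply: (null _ (y2, 0)); rewrite /= /lin_pair_fun /= !tr_id oppr0 linear0 addr0.
  by congr pair; apply: zmod_eq0.
- by apply: (null _ 0); rewrite linear0; congr pair; apply: zmod_eq0.
- exists y2; first exact: scaler0.
  exists 0; rewrite linear0; have := congr1 snd dy; rewrite /= /lin_pair_fun /= !tr_id.
  move=> /eqP; rewrite addr_eq0 => /eqP ->.
  by congr pair; rewrite /= ?subrr // opprK addNr.
- by apply: (null _ 0); rewrite linear0; congr pair; apply: zmod_eq0.
- by apply: (null _ 0); rewrite linear0; congr pair; apply: zmod_eq0.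
Qed.

Lemma thick_term_right : C X0 -> C (stalk fgN'') -> C (stalk fgL'').
Proof.
move=> CX CN; have := thick_cone_map thC term_proj CX CN.
apply: (thick_iso thC); apply: diso_sym; exact: diso_qis qis_term_proj_cone.
Qed.

Lemma thick_term_left : C X0 -> C X -> C (stalk fgM').
Proof.
move=> CX0 CX; apply: (thick_unshift thC (n := 1)).
have := thick_cone_map thC term_inj CX0 CX.
apply: (thick_iso thC); apply: diso_sym; exact: diso_qis qis_term_inj_cone.
Qed.

End Terms.

(** * The branch extension algebra as an incidence algebra *)

Section LinearExtension.
Variables (k : fieldType) (Q : quiver) (chi : qpath Q -> k).
Local Notation PA := (pathAlg k Q).

(** The linear form on the path algebra with value [chi p] at each path p. *)
Definition lform (f : PA) : k := \sum_(p <- msupp f) mcoeff p f * chi p.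

Lemma lformEw (D : {fset qpath Q}) f : (msupp f `<=` D)%fset ->
  lform f = \sum_(p <- D) mcoeff p f * chi p.
Proof.
move=> sD; apply: big_fset_incl => // p _.
by rewrite -mcoeff_eq0 => /eqP ->; rewrite mul0r.
Qed.

Lemma lformD f g : lform (f + g) = lform f + lform g.
Proof.
pose D := (msupp f `|` msupp g)%fset.
rewrite (@lformEw D) ?msuppD_le // (@lformEw D f) ?fsubsetUl //.
rewrite (@lformEw D g) ?fsubsetUr // -big_split /=.
by apply: eq_bigr => p _; rewrite mcoeffD mulrDl.
Qed.

Lemma lformZ c f : lform (c *: f) = c * lform f.
Proof.
rewrite (@lformEw (msupp f)) ?msuppZ_le // mulr_sumr.
by apply: eq_bigr => p _; rewrite mcoeffZ mulrA.
Qed.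

Lemma lform0 : lform 0 = 0.
Proof. by rewrite -(scale0r 0) lformZ mul0r. Qed.

Lemma lformB f g : lform (f - g) = lform f - lform g.
Proof. by rewrite lformD -scaleN1r lformZ mulN1r. Qed.

Lemma lform_sum (I : finType) (F : I -> PA) : lform (\sum_i F i) = \sum_i lform (F i).
Proof. by apply: (big_morph lform lformD lform0). Qed.

Lemma lform_path p : lform (mkmalgU p 1) = chi p.
Proof. by rewrite (@lformEw [fset p]%fset) ?msuppU_le // big_seq_fset1 mcoeffUU mul1r. Qed.

End LinearExtension.

(** When the relations identify parallel paths, the entry of an element at
    (x, y), the sum of its coefficients at the paths from x to y, identifies the
    bound quiver algebra with the incidence algebra of reachability. *)
Section ParallelPaths.
Variables (k : fieldType) (Q : quiver) (R : pathAlg k Q -> Prop) (le : rel Q).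
Local Notation PA := (pathAlg k Q).
Local Notation pth := (path (@arrow Q)).

Hypothesis le_path : forall x s, pth x s -> le x (last x s).
Hypothesis path_le : forall x y, le x y -> exists2 s, pth x s & last x s = y.
Hypothesis parallel : forall x s s', pth x s -> pth x s' -> last x s = last x s' ->
  gen_ideal R (path_elt k x s - path_elt k x s').

Definition ends (x y : Q) (p : qpath Q) : k :=
  ((val p).1 == x)%:R * (last (val p).1 (val p).2 == y)%:R.

Definition entry (f : PA) (x y : Q) : k := lform (ends x y) f.

Hypothesis R_entry : forall f, R f -> forall x y, entry f x y = 0.

Lemma entry_path z s x y : pth z s ->
  entry (path_elt k z s) x y = (z == x)%:R * (last z s == y)%:R.
Proof.
move=> zs; rewrite (path_eltE k (Sub (z, s) zs : qpath Q)).
exact: lform_path.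
Qed.

Lemma entryD f g x y : entry (f + g) x y = entry f x y + entry g x y.
Proof. exact: lformD. Qed.
Lemma entryZ c f x y : entry (c *: f) x y = c * entry f x y.
Proof. exact: lformZ. Qed.
Lemma entry0 x y : entry 0 x y = 0.
Proof. exact: lform0. Qed.

Lemma entry_pathAlg_mul f g x y :
  entry (pathAlg_mul f g) x y = \sum_w entry g x w * entry f w y.
Proof.
elim/pathAlg_ind: f => [|f f' Ef Ef'|c f Ef|p].
- by rewrite pathAlg_mul0l entry0 big1 // => w _; rewrite entry0 mulr0.
- rewrite pathAlg_mulDl entryD (eq_bigr _ (fun w _ => congr1 _ (entryD f f' w y))).
  under [RHS]eq_bigr => w _ do rewrite mulrDr.
  by rewrite big_split; congr (_ + _).
- rewrite pathAlg_mulZl; transitivity (c * entry (pathAlg_mul f g) x y).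
    exact: entryZ.
  rewrite (eq_bigr _ (fun w _ => congr1 _ (entryZ c f w y))).
  under [RHS]eq_bigr => w _ do rewrite mulrCA.
  by rewrite -mulr_sumr; congr (_ * _).
elim/pathAlg_ind: g => [|f f' Ef Ef'|c f Ef|q].
- by rewrite pathAlg_mul0r entry0 big1 // => w _; rewrite entry0 mul0r.
- rewrite pathAlg_mulDr entryD (eq_bigr _ (fun w _ => congr1 ( *%R^~ _) (entryD f f' x w))).
  under [RHS]eq_bigr => w _ do rewrite mulrDl.
  by rewrite big_split; congr (_ + _).
- rewrite pathAlg_mulZr; transitivity (c * entry (pathAlg_mul (mkmalgU p 1) f) x y).
    exact: entryZ.
  rewrite (eq_bigr _ (fun w _ => congr1 ( *%R^~ _) (entryZ c f x w))).
  under [RHS]eq_bigr => w _ do rewrite -mulrA.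
  by rewrite -mulr_sumr; congr (_ * _).
case: p q => [[a s] sa] [[b t] tb]; rewrite -!path_eltE /=; rewrite /= in sa tb.
rewrite (path_elt_mul k sa tb).
under eq_bigr => w _ do rewrite !entry_path //.
rewrite (bigD1 (last b t)) //= eqxx mulr1 big1 ?addr0; last first.
  by move=> w; rewrite eq_sym => /negbTE ->; rewrite mulr0 mul0r.
case: eqP => [E|_]; last by rewrite entry0 mul0r mulr0.
by rewrite entry_path ?cat_path ?tb -?E // last_cat -E mul1r.
Qed.

Lemma entryM f g x y : entry (f * g) x y = \sum_w entry g x w * entry f w y.
Proof. exact: entry_pathAlg_mul. Qed.

Lemma gen_ideal_entry f : gen_ideal R f -> forall x y, entry f x y = 0.
Proof.
elim=> {f} [f /R_entry||f g _ Hf _ Hg|a f _ Hf|a f _ Hf] x y.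
- exact.
- exact: entry0.
- by rewrite entryD Hf Hg addr0.
- by rewrite entryM big1 // => w _; rewrite Hf mul0r.
- by rewrite entryM big1 // => w _; rewrite Hf mulr0.
Qed.

Lemma gen_ideal_scale c f : gen_ideal R f -> gen_ideal R (c *: f).
Proof. by move=> If; rewrite -pathAlg_scaleE; apply: gen_idealMl. Qed.

Lemma entry_nle f x y : ~~ le x y -> entry f x y = 0.
Proof.
move=> xy; elim/pathAlg_ind: f => [|f f' Ef Ef'|c f Ef|[[z s] zs]].
- exact: entry0.
- by rewrite entryD Ef Ef' addr0.
- by rewrite entryZ Ef mulr0.
rewrite -path_eltE /= entry_path //.
case: eqP => [E|_]; last by rewrite mul0r.
case: eqP => [E'|_]; last by rewrite mulr0.
by move: xy; rewrite -E -E' le_path.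
Qed.

Lemma path_choice : exists s : Q * Q -> seq Q, forall x y, le x y ->
  pth x (s (x, y)) /\ last x (s (x, y)) = y.
Proof.
have /choice [s Hs] : forall p : Q * Q, exists s, le p.1 p.2 ->
    pth p.1 s /\ last p.1 s = p.2.
  move=> [x y]; have [xy|xy] := boolP (le x y); last by exists [::] => /= H; case/negP: xy.
  by have [s s1 s2] := path_le xy; exists s.
by exists s => x y; apply: (Hs (x, y)).
Qed.

Definition of_matrix (s : Q * Q -> seq Q) (d : Q -> Q -> k) : PA :=
  \sum_(p : Q * Q) d p.1 p.2 *: path_elt k p.1 (s p).

Lemma of_matrixD s d d' : of_matrix s (fun x y => d x y + d' x y) =
  of_matrix s d + of_matrix s d'.
Proof. by rewrite -big_split; apply: eq_bigr => p _; rewrite scalerDl. Qed.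

Lemma of_matrixZ s c d : of_matrix s (fun x y => c * d x y) = c *: of_matrix s d.
Proof. by rewrite scaler_sumr; apply: eq_bigr => p _; rewrite scalerA. Qed.

Lemma eq_of_matrix s d d' : d =2 d' -> of_matrix s d = of_matrix s d'.
Proof. by move=> E; apply: eq_bigr => p _; rewrite E. Qed.

Section Choice.
Variable s : Q * Q -> seq Q.
Hypothesis Hs : forall x y, le x y -> pth x (s (x, y)) /\ last x (s (x, y)) = y.

Lemma entry_of_matrix (d : Q -> Q -> k) : (forall x y, ~~ le x y -> d x y = 0) ->
  forall x y, entry (of_matrix s d) x y = d x y.
Proof.
move=> d0 x y; rewrite /entry lform_sum (bigD1 (x, y)) //= big1 ?addr0.
  rewrite [LHS]entryZ; have [xy|xy] := boolP (le x y); last by rewrite d0 ?mul0r.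
  by have [s1 s2] := Hs xy; rewrite entry_path // s2 !eqxx !mulr1.
move=> [a b] ab; rewrite [LHS]entryZ /=.
have [le_ab|le_ab] := boolP (le a b); last by rewrite d0 ?mul0r.
have [s1 s2] := Hs le_ab; rewrite entry_path // s2 -natrM mulnb.
by rewrite -[(a == x) && _]/((a, b) == (x, y)) (negbTE ab) mulr0.
Qed.

(** By linearity it is enough to consider a path; its only nonzero entry is 1, at
    its end points, and it is parallel to the path chosen there. *)
Lemma gen_ideal_of_matrix f : gen_ideal R (f - of_matrix s (entry f)).
Proof.
elim/pathAlg_ind: f => [|f f' If If'|c f If|[[z t] zt]].
- rewrite (_ : _ - _ = 0); first exact: gen_ideal0.
  rewrite sub0r (_ : of_matrix s _ = 0) ?oppr0 // /of_matrix big1 // => p _.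
  by rewrite entry0 scale0r.
- rewrite (eq_of_matrix _ (entryD f f')) of_matrixD opprD addrACA.
  exact: (gen_idealD If If').
- rewrite (eq_of_matrix _ (entryZ c f)) of_matrixZ -scalerBr.
  exact: (gen_ideal_scale c If).
rewrite -path_eltE /=; rewrite /= in zt.
have le_z := le_path zt; have [s1 s2] := Hs le_z.
rewrite (_ : of_matrix s _ = path_elt k z (s (z, last z t))).
  by apply: parallel; rewrite // s2.
rewrite /of_matrix (bigD1 (z, last z t)) //= big1 ?addr0.
  by rewrite entry_path // !eqxx mulr1 scale1r.
move=> [a b] ab; rewrite entry_path //= -natrM mulnb.
have /negbTE -> : ~~ ((z == a) && (last z t == b)); last by rewrite scale0r.
by apply: contra ab => /andP[/eqP -> /eqP ->].
Qed.

Lemma entry_inj f : (forall x y, entry f x y = 0) -> gen_ideal R f.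
Proof.
move=> f0; have := gen_ideal_of_matrix f.
rewrite (_ : of_matrix s _ = 0) ?subr0 // /of_matrix big1 // => p _.
by rewrite f0 scale0r.
Qed.

End Choice.

Local Notation B := (bound_quiver_alg R).
Definition bq_entry (b : B) x y : k := entry (repr (b : bqAlg R)) x y.

Lemma bq_entry_mk f x y : bq_entry (bqAlg_mk R f) x y = entry f x y.
Proof.
have /bqAlg_mkP H : bqAlg_mk R (repr (bqAlg_mk R f)) = bqAlg_mk R f by rewrite bqAlg_mkK.
apply/eqP; rewrite -subr_eq0; apply/eqP.
rewrite -[RHS](gen_ideal_entry H x y); exact: esym (lformB _ _ _).
Qed.

Lemma bq_entry1 x y : bq_entry 1 x y = (x == y)%:R.
Proof.
rewrite [LHS]bq_entry_mk /entry [X in lform _ X](_ : _ = \sum_(z : Q) path_elt k z [::]) //.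
rewrite lform_sum (bigD1 x) //= big1 ?addr0; last first.
  by move=> z zx; rewrite [LHS]entry_path // (negbTE zx) mul0r.
by rewrite [LHS]entry_path // eqxx mul1r.
Qed.

Lemma bq_entryD a b x y : bq_entry (a + b) x y = bq_entry a x y + bq_entry b x y.
Proof.
rewrite -[a](bqAlg_mkK (R := R)) -[b](bqAlg_mkK (R := R)).
by rewrite -[X in bq_entry X](bqAlg_mkD) !bq_entry_mk entryD.
Qed.

Lemma bq_entryM a b x y : bq_entry (a * b) x y = \sum_w bq_entry b x w * bq_entry a w y.
Proof.
rewrite -[a](bqAlg_mkK (R := R)) -[b](bqAlg_mkK (R := R)).
by rewrite [X in bq_entry X](bqAlg_mkM) bq_entry_mk entryM;
  apply: eq_bigr => w _; rewrite !bq_entry_mk.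
Qed.

Lemma bq_entryZ c b x y : bq_entry (kalg_map B c * b) x y = c * bq_entry b x y.
Proof.
rewrite -[b](bqAlg_mkK (R := R)) [X in bq_entry X](bqAlg_mkM) !bq_entry_mk.
by rewrite pathAlg_scaleE; apply: entryZ.
Qed.

Lemma bq_entry_nle b x y : ~~ le x y -> bq_entry b x y = 0.
Proof. exact: entry_nle. Qed.

Lemma bq_entry_inj a b : (forall x y, bq_entry a x y = bq_entry b x y) -> a = b.
Proof.
move=> H; rewrite -[a](bqAlg_mkK (R := R)) -[b](bqAlg_mkK (R := R)); apply/bqAlg_mkP.
have [s Hs] := path_choice; apply: (entry_inj Hs) => x y.
by apply: (etrans (lformB _ _ _)); apply/eqP; rewrite subr_eq0; apply/eqP; apply: H.
Qed.

Lemma bq_entry_surj (d : Q -> Q -> k) : (forall x y, ~~ le x y -> d x y = 0) ->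
  exists b, forall x y, bq_entry b x y = d x y.
Proof.
move=> d0; have [s Hs] := path_choice; exists (bqAlg_mk R (of_matrix s d)) => x y.
by rewrite bq_entry_mk entry_of_matrix.
Qed.

End ParallelPaths.

Section Branch.
Variables (k : fieldType) (u v : nat).
Local Notation Q := (br_quiver u v).
Local Notation pth := (path (@arrow Q)).
Local Notation R := (@br_rel k u v).

(** Reachability: t_i and b_i lie in the column i, columns do not decrease along
    arrows, t_i leads to b_i but not back, and every c follows all t and b. *)
Definition br_le (x y : Q) : bool :=
  match x, y with
  | inl (inl i), inl (inl j) => i <= j
  | inl (inl i), inl (inr j) => i <= j
  | inl (inr i), inl (inr j) => i <= j
  | inl _, inr _ => true
  | inr i, inr j => i <= j
  | _, _ => false
  end%N.

Definition br_rank (x : Q) : nat :=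
  match x with inl (inl i) => i | inl (inr i) => u + i | inr i => u + u + i end.

Lemma br_le_refl x : br_le x x.
Proof. by case: x => [[i|i]|i] /=. Qed.

Lemma br_le_trans y x z : br_le x y -> br_le y z -> br_le x z.
Proof.
by case: x => [[i|i]|i]; case: y => [[j|j]|j]; case: z => [[l|l]|l] //=; apply: leq_trans.
Qed.

Lemma br_arrow_le x y : arrow x y -> br_le x y /\ (br_rank x < br_rank y)%N.
Proof.
case: x => [[i|i]|i]; case: y => [[j|j]|j] //=;
  have := ltn_ord i; have := ltn_ord j; try (by move=> _ _ /eqP ->; split; lia).
- by move=> ? ? /eqP ->; split; lia.
- by move=> ? ? _; split; lia.
Qed.

Lemma br_le_rank x y : br_le x y -> (br_rank x <= br_rank y)%N.
Proof.
case: x => [[i|i]|i]; case: y => [[j|j]|j] //=;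
  have := ltn_ord i; have := ltn_ord j; lia.
Qed.

Lemma br_path_le x s : pth x s -> br_le x (last x s).
Proof.
elim: s x => [|y s IH] x /=; first by rewrite br_le_refl.
by move=> /andP[/br_arrow_le [xy _] /IH]; apply: br_le_trans.
Qed.

Lemma br_le_step x y : br_le x y -> x != y -> exists2 x1, arrow x x1 & br_le x1 y.
Proof.
have next (a : nat) (i j : 'I_a) : (i <= j)%N -> i != j ->
    exists2 l : 'I_a, l == i.+1 :> nat & (l <= j)%N.
  move=> ij nij; have lt_ij : (i < j)%N by rewrite ltn_neqAle ij andbT.
  by exists (Ordinal (leq_ltn_trans lt_ij (ltn_ord j))); rewrite /=.
case: x => [[i|i]|i]; case: y => [[j|j]|j] //= ij nij.
- have [l l1 l2] := next _ i j ij nij; by exists (inl (inl l)).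
- by exists (inl (inr i)) => //=.
- by exists (inl (inr i)) => //=.
- have [l l1 l2] := next _ i j ij nij; by exists (inl (inr l)).
- have [iu|iu] := eqVneq i.+1 u.
    by exists (inr (Ordinal (leq_ltn_trans (leq0n j) (ltn_ord j)))).
  have iu' : (i.+1 < u)%N by have := ltn_ord i; lia.
  by exists (inl (inr (Ordinal iu'))) => //=.
- have [l l1 l2] := next _ i j ij nij; by exists (inr l).
Qed.

Lemma br_le_path x y : br_le x y -> exists2 s, pth x s & last x s = y.
Proof.
move: {2}(br_rank y - br_rank x)%N (leqnn (br_rank y - br_rank x)) => d.
elim: d x => [|d IH] x rd xy; have [->|nxy] := eqVneq x y; try by exists [::].
  have [x1 /br_arrow_le [_ xx1] x1y] := br_le_step xy nxy.
  by have := br_le_rank x1y; lia.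
have [x1 a x1y] := br_le_step xy nxy.
have [|s s1 s2] := IH x1 _ x1y; last by exists (x1 :: s) => //; apply/andP.
by have [_ ?] := br_arrow_le a; have := br_le_rank x1y; lia.
Qed.

Lemma br_path_loop x s : pth x s -> last x s = x -> s = [::].
Proof.
case: s => [|y s] //= /andP[/br_arrow_le [_ xy] /br_path_le /br_le_rank ys] E.
by move: ys; rewrite E leqNgt xy.
Qed.

(** Induction on the length. Paths with the same first arrow are compared by
    their tails. Otherwise one leaves t_i through t_(i+1) and the other through
    b_i, and then through b_(i+1); by induction the tail of the first may be
    replaced by one through b_(i+1), and the relation of the square applies. *)
Lemma br_parallel x s s' : pth x s -> pth x s' -> last x s = last x s' ->
  gen_ideal R (path_elt k x s - path_elt k x s').
Proof.
have pI (f : pathAlg k Q) : f = 0 -> gen_ideal R f by move=> ->; apply: gen_ideal0.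
have consE y z t : arrow y z -> pth z t ->
    path_elt k y (z :: t) = path_elt k z t * path_elt k y [:: z] :> pathAlg k Q.
  move=> yz zt; have yz' : pth y [:: z] by rewrite /= andbT.
  by rewrite [RHS](path_elt_mul k zt yz') /= eqxx.
have trans (f g h : pathAlg k Q) :
    gen_ideal R (f - g) -> gen_ideal R (g - h) -> gen_ideal R (f - h).
  by move=> Ifg Igh; rewrite -(subrKA g); apply: (gen_idealD Ifg Igh).
have sym (f g : pathAlg k Q) : gen_ideal R (f - g) -> gen_ideal R (g - f).
  by move=> Ifg; rewrite -opprB -scaleN1r; apply: (gen_ideal_scale _ Ifg).
have consI y z t t' : arrow y z -> pth z t -> pth z t' ->
    gen_ideal R (path_elt k z t - path_elt k z t') ->
    gen_ideal R (path_elt k y (z :: t) - path_elt k y (z :: t')).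
  move=> yz zt zt' H; rewrite consE // (consE y z t') //.
  by rewrite -(mulrBl (path_elt k y [:: z])); apply: (gen_idealMr _ H).
move: {2}(size s) (leqnn (size s)) => d; elim: d x s s' => [|d IH] x s s'.
  case: s => // _ _ xs' /esym /(br_path_loop xs') ->; apply: pI; exact: subrr.
case: s => [|y s]; first by move=> _ _ xs' /esym /(br_path_loop xs') ->; apply: pI; exact: subrr.
case: s' => [|y' s']; first by move=> _ xs _ /(br_path_loop xs).
rewrite /= ltnS => sd /andP[xy ys] /andP[xy' ys'] E.
have [yy'|nyy'] := eqVneq y y'.
  by subst y'; apply: consI => //; apply: IH.
have square (i j : 'I_u) t t' : j = i.+1 :> nat ->
    pth (inl (inl j) : Q) t -> pth (inl (inr i) : Q) t' ->
    (size t <= d)%N || (size t' <= d)%N -> last (inl (inl j) : Q) t = last (inl (inr i) : Q) t' ->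
    gen_ideal R (path_elt k (inl (inl i) : Q) (inl (inl j) :: t) -
                 path_elt k (inl (inl i) : Q) (inl (inr i) :: t')).
  move=> ji jt it' td Et.
  case: t' it' Et td => [|y1 t'] /=.
    by move=> _ El _; have := br_path_le jt; rewrite El /= ji ltnn.
  move=> /andP[iy1 yt'] Et td.
  have Ey1 : y1 = inl (inr j).
    case: y1 iy1 {yt' Et td} => [[l|l]|l] //=.
      by move=> /eqP li; congr (inl (inr _)); apply: val_inj; rewrite /= li ji.
    by move=> /andP[/eqP iu _]; have := ltn_ord j; rewrite ji iu ltnn.
  subst y1; apply: (trans _ (path_elt k (inl (inl i) : Q) [:: inl (inl j), inl (inr j) & t'])).
    have jj : pth (inl (inl j) : Q) (inl (inr j) :: t') by rewrite /= eqxx.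
    have aij : @arrow Q (inl (inl i)) (inl (inl j)) by apply/eqP.
    apply: consI => //; case/orP: td => td; first exact: IH.
    by apply: sym; apply: IH.
  have p1 : pth (inl (inl i) : Q) [:: inl (inl j); inl (inr j)] by rewrite /= ji !eqxx.
  have p2 : pth (inl (inl i) : Q) [:: inl (inr i); inl (inr j)] by rewrite /= ji !eqxx.
  have q : pth (inl (inr j) : Q) t' := yt'.
  have m1 := path_elt_mul k q p1; have m2 := path_elt_mul k q p2.
  rewrite /= eqxx in m1; rewrite /= eqxx in m2.
  rewrite -[X in X - _]m1 -[X in _ - X]m2 -(mulrBr (path_elt k _ t')).
  by apply: gen_idealMl; apply: gen_ideal_gen; exists i, j.
case: x y y' xy xy' {IH} nyy' ys ys' E => [[i|i]|i] [[j|j]|j] [[j'|j']|j'] //=.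
- by move=> /eqP ij /eqP ij' /eqP[]; do 2!congr inl; apply: val_inj; rewrite /= ij ij'.
- move=> /eqP ij /eqP ij' _ ys ys' E; subst j'; by apply: square => //; rewrite sd.
- move=> /eqP ij /eqP ij' _ ys ys' E; subst j; apply: sym; by apply: square => //; rewrite sd orbT.
- by move=> /eqP ij /eqP ij' /eqP[]; subst j j'.
- by move=> /eqP ij /eqP ij' /eqP[]; congr (inl (inr _)); apply: val_inj; rewrite /= ij ij'.
- by move=> /eqP ij /andP[/eqP iu _]; have := ltn_ord j; rewrite ij iu ltnn.
- by move=> /andP[/eqP iu _] /eqP ij'; have := ltn_ord j'; rewrite ij' iu ltnn.
- move=> /andP[_ /eqP j0] /andP[_ /eqP j0'] /eqP[]; congr inr; apply: val_inj; by rewrite /= j0 j0'.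
- by move=> /eqP ij /eqP ij' /eqP[]; congr inr; apply: val_inj; rewrite /= ij ij'.
Qed.

Lemma br_rel_entry f : R f -> forall x y, entry f x y = 0.
Proof.
move=> [i [j [ji ->]]] x y; rewrite [LHS]lformB.
rewrite [X in X - _]entry_path /= ?ji ?eqxx // [X in _ - X]entry_path /= ?ji ?eqxx //.
exact: subrr.
Qed.

End Branch.

(** * Maps between the projectives of the Nakayama algebra *)

(** A map of left modules from A e to A e' is right multiplication by an element
    of e A e', here a multiple of the path W b a from b to a. *)
Section RightMultiplication.
Variables (k : fieldType) (A : kalgType k) (n r : nat).
Variables (E : nat -> A) (W : nat -> nat -> A).
Local Notation P a := (lideal (E a)).
Local Notation vertex a := (0 < a <= n)%N.
Hypothesis E_idem : forall a, E a * E a = E a.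
Hypothesis E_sandwich : forall a b z, vertex a -> vertex b ->
  exists c, E a * z * E b = kalg_map A c * W b a.
Hypothesis W_id : forall a, vertex a -> W a a = E a.
Hypothesis W_up : forall a b, (b < a)%N -> W b a = 0.
Hypothesis W_mul : forall a b c, vertex a -> vertex c -> (a <= b <= c)%N ->
  W b a * W c b = W c a.
Hypothesis W_free : forall a b c, vertex a -> vertex b -> (a <= b < a + r)%N ->
  kalg_map A c * W b a = 0 -> c = 0.

Definition is_mult a b (c : k) (f : {linear P a -> P b}) :=
  forall p, lideal_val (f p) = kalg_map A c * ((lideal_val p : A) * W b a) :> A.

Lemma E_W a b : vertex a -> vertex b -> E a * W b a = W b a.
Proof.
move=> va vb; have [ab|ba] := leqP a b; last by rewrite W_up // mulr0.
by rewrite -W_id // W_mul // leqnn.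
Qed.

Lemma is_mult_exists a b (f : {linear P a -> P b}) : vertex a -> vertex b ->
  exists c, is_mult c f.
Proof.
move=> va vb; have [c Hc] := E_sandwich (lideal_val (f (lideal_gen (E a)))) va vb.
exists c => p; rewrite {1}(lideal_gen_span (E_idem a) p) linearZ.
have E1 : lideal_val (f (lideal_gen (E a))) = kalg_map A c * W b a :> A.
  rewrite -Hc -{1}(lideal_gen_idem (E_idem a)) linearZ.
  have /lideal_predP [y Hy] := valP (f (lideal_gen (E a))).
  by rewrite /= Hy; change (E a * (y * E b) = E a * (y * E b) * E b); rewrite -!mulrA E_idem.
by rewrite [LHS]/= E1; change ((lideal_val p : A) * (kalg_map A c * W b a) =
  kalg_map A c * ((lideal_val p : A) * W b a)); rewrite mulrA -kalg_mapC mulrA.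
Qed.

Lemma is_mult_up a b (f : {linear P a -> P b}) : vertex a -> vertex b -> (b < a)%N ->
  forall p, f p = 0.
Proof.
move=> va vb ba p; have [c Hc] := is_mult_exists f va vb; apply: val_inj.
by rewrite /= Hc W_up // !mulr0.
Qed.

Lemma is_mult_comp a b b' c c' (f : {linear P a -> P b}) (f' : {linear P b -> P b'})
    (g : {linear P a -> P b'}) :
  vertex a -> vertex b' -> (a <= b <= b')%N -> is_mult c f -> is_mult c' f' ->
  (forall p, g p = f' (f p)) -> is_mult (c' * c) g.
Proof.
move=> va vb' abb Hf Hf' Hg p.
by rewrite Hg Hf' Hf rmorphM -!mulrA W_mul.
Qed.

Lemma is_mult_id a (f : {linear P a -> P a}) : vertex a -> (forall p, f p = p) ->
  is_mult 1 f.
Proof.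
move=> va Hf p; rewrite Hf rmorph1 mul1r W_id //.
by have /lideal_predP [y ->] := valP p; change (y * E a = y * E a * E a); rewrite -mulrA E_idem.
Qed.

Lemma is_mult_span a b c (f g : {linear P a -> P b}) : vertex a -> vertex b ->
  c != 0 -> is_mult c g -> exists d, forall p, f p = kalg_map A d *: g p.
Proof.
move=> va vb c0 Hg; have [d Hd] := is_mult_exists f va vb.
exists (d / c) => p; apply: val_inj; rewrite /= Hd.
change (kalg_map A d * ((lideal_val p : A) * W b a) =
  kalg_map A (d / c) * (lideal_val (g p) : A)).
by rewrite Hg [RHS]mulrA -rmorphM mulfVK.
Qed.

Lemma is_mult_free a b c d (g : {linear P a -> P b}) : vertex a -> vertex b ->
  (a <= b < a + r)%N -> c != 0 -> is_mult c g ->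
  (forall p, kalg_map A d *: g p = 0) -> d = 0.
Proof.
move=> va vb ab c0 Hg H; have := congr1 (@lideal_val _ _) (H (lideal_gen (E a))).
rewrite /= => H1; have {}H1 : kalg_map A d * (lideal_val (g (lideal_gen (E a))) : A) = 0 := H1.
move: H1; rewrite Hg /= mulrA -rmorphM E_W // => /(W_free va vb ab) /eqP.
by rewrite mulf_eq0 (negbTE c0) orbF => /eqP.
Qed.

Lemma is_mult_nonzero a b c (f : {linear P a -> P b}) x : is_mult c f -> f x <> 0 -> c != 0.
Proof.
move=> Hf fx; apply/eqP => c0; apply: fx; apply: val_inj.
by rewrite /= Hf c0 rmorph0 mul0r.
Qed.

End RightMultiplication.

Section NakayamaElements.
Variables (k : fieldType) (n r : nat).
Local Notation N := (nakayama k n r).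
Local Notation Q := (nak_quiver n).
Local Notation E := (@nak_idem k n r).

Lemma nak_idem_ord (x : 'I_n) : E x.+1 = bqAlg_mk (@nak_rel k n r) (path_elt k (x : Q) [::]).
Proof.
by rewrite /nak_idem (big_pred1 x).
Qed.

(** The class of the path from b to a, and 0 if there is none, for vertices
    numbered from 1; the sum has at most one term. *)
Definition nakW (b a : nat) : N :=
  \sum_(p : 'I_n * 'I_n | [&& p.1.+1 == b, p.2.+1 == a & (p.2 <= p.1)%N])
    bqAlg_mk (@nak_rel k n r) (wpath k p.1 p.2).

Lemma nakW_ord (x y : 'I_n) : (y <= x)%N ->
  nakW x.+1 y.+1 = bqAlg_mk (@nak_rel k n r) (wpath k x y).
Proof.
move=> yx; rewrite /nakW (big_pred1 (x, y)) // => -[x' y'] /=.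
rewrite !eqSS -[RHS]/((x' == x) && (y' == y)).
apply/idP/idP => [/and3P[/eqP/val_inj -> /eqP/val_inj -> _]|/andP[/eqP -> /eqP ->]].
  by rewrite !eqxx.
by rewrite !eqxx.
Qed.

Lemma nakW_up a b : (b < a)%N -> nakW b a = 0.
Proof.
move=> ba; rewrite /nakW big_pred0 // => -[x y] /=.
by apply/negbTE; apply/negP => /and3P[/eqP xb /eqP ya yx]; lia.
Qed.

Lemma vertex_ord a : (0 < a <= n)%N -> exists x : 'I_n, a = x.+1.
Proof. by case: a => // a /= an; exists (Ordinal an). Qed.

Lemma nakW_id a : (0 < a <= n)%N -> nakW a a = E a.
Proof.
move=> /vertex_ord [x ->]; rewrite nakW_ord // nak_idem_ord /wpath.
by rewrite subnn.
Qed.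

Lemma nakW_mul a b c : (0 < a <= n)%N -> (0 < c <= n)%N -> (a <= b <= c)%N ->
  nakW b a * nakW c b = nakW c a.
Proof.
move=> va vc /andP[ab bc]; have vb : (0 < b <= n)%N by lia.
move: va vb vc ab bc => /vertex_ord [z ->] /vertex_ord [y ->] /vertex_ord [x ->].
rewrite !ltnS => zy yx; rewrite !nakW_ord //; last exact: leq_trans zy yx.
by rewrite [LHS]bqAlg_mkM; congr bqAlg_mk; apply: wpath_mul; rewrite zy.
Qed.

Lemma bqAlg_mk0 : bqAlg_mk (@nak_rel k n r) 0 = 0.
Proof. by rewrite /bqAlg_mk !piE. Qed.

Lemma bqAlg_mkZ c (f : pathAlg k Q) :
  bqAlg_mk (@nak_rel k n r) (c *: f) = kalg_map N c * bqAlg_mk (@nak_rel k n r) f.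
Proof. by rewrite [RHS]bqAlg_mkM pathAlg_scaleE. Qed.

Lemma nak_sandwich a b z : (0 < a <= n)%N -> (0 < b <= n)%N ->
  exists c, E a * z * E b = kalg_map N c * nakW b a.
Proof.
move=> /vertex_ord [y ->] /vertex_ord [x ->]; rewrite !nak_idem_ord.
have [c Hc] := idem_mul_idem x y (repr (z : bqAlg (@nak_rel k n r))).
exists c; rewrite -[z](bqAlg_mkK (R := @nak_rel k n r)).
rewrite [X in X * _]bqAlg_mkM [LHS]bqAlg_mkM.
have -> : bqAlg_mk (@nak_rel k n r) (path_elt k (y : Q) [::] * repr (z : bqAlg (@nak_rel k n r)) *
    path_elt k (x : Q) [::]) = bqAlg_mk (@nak_rel k n r)
       (c *: (if (y <= x)%N then wpath k x y else 0)) by congr bqAlg_mk.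
rewrite bqAlg_mkZ; case: leqP => [yx|xy]; first by rewrite nakW_ord.
have -> : nakW x.+1 y.+1 = 0 by apply: nakW_up.
exact: (congr1 (fun w => kalg_map N c * w) bqAlg_mk0).
Qed.

Lemma nakW_free a b c : (0 < a <= n)%N -> (0 < b <= n)%N -> (a <= b < a + r)%N ->
  kalg_map N c * nakW b a = 0 -> c = 0.
Proof.
move=> /vertex_ord [y ->] /vertex_ord [x ->] /andP[]; rewrite ltnS => yx xr.
rewrite nakW_ord // -bqAlg_mkZ -bqAlg_mk0.
move=> /bqAlg_mkP; rewrite subr0; apply: wpath_free; lia.
Qed.

Lemma nak_idem_sum : \sum_(x < n) E x.+1 = 1.
Proof.
rewrite (eq_bigr _ (fun x _ => nak_idem_ord x)).
have mk1 : bqAlg_mk (@nak_rel k n r) (\sum_(x : Q) path_elt k x [::]) = 1 by [].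
rewrite -[RHS]mk1; exact: (esym (@big_morph _ _ (bqAlg_mk (@nak_rel k n r)) 0 +%R 0 +%R
  (@bqAlg_mkD _ _ _) bqAlg_mk0 Q _ xpredT (fun x : Q => path_elt k x [::]))).
Qed.

End NakayamaElements.

(** * The complexes of the tilting object *)

Section Tilting.
Variables (k : fieldType) (u v : nat).
Local Notation m := (u + v + 1)%N.
Local Notation n := (2 * u + v)%N.
Local Notation N := (nakayama k n m).
Local Notation P := (nakP k n m).
Local Notation E := (@nak_idem k n m).
Local Notation W := (@nakW k n m).
Local Notation vertex a := (0 < a <= n)%N.
Variable xi : forall a : nat, {linear P a -> P a.+1}.
Hypotheses (u_ge1 : (1 <= u)%N) (v_ge1 : (1 <= v)%N).
Hypothesis xi_neq0 : forall a, (1 <= a <= n - 1)%N -> exists x, xi a x <> 0.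

Lemma xi_comp_id a p : xi_comp xi a a p = p.
Proof. by case: a p => [|a] p; rewrite /= ?ltnn tr_id. Qed.

Lemma xi_compS a b : (a <= b)%N -> xi_comp xi a b.+1 = lin_comp (xi b) (xi_comp xi a b).
Proof. by move=> /= ->. Qed.

Lemma xi_comp_comp a b c p : (a <= b <= c)%N ->
  xi_comp xi b c (xi_comp xi a b p) = xi_comp xi a c p.
Proof.
move=> /andP[ab]; elim: c => [|c IH].
  rewrite leqn0 => /eqP b0; subst b; move: ab.
  by rewrite leqn0 => /eqP a0; subst a; rewrite !xi_comp_id.
rewrite leq_eqVlt => /orP[/eqP bc|bc]; first by subst b; rewrite xi_comp_id.
rewrite ltnS in bc; have ac : (a <= c)%N by apply: leq_trans ab bc.
by rewrite (xi_compS bc) (xi_compS ac) /= IH.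
Qed.

Lemma xi_comp_mult a b : vertex a -> vertex b -> (a <= b)%N ->
  exists2 c, c != 0 & is_mult W c (xi_comp xi a b).
Proof.
move=> va; elim: b => [|b IH] vb; first by lia.
rewrite leq_eqVlt => /orP[/eqP ab|ab].
  subst a; exists 1; first exact: oner_neq0.
  exact: (is_mult_id (f := xi_comp xi b.+1 b.+1) (@nak_idemM k n m) (@nakW_id k n m)
    va (@xi_comp_id b.+1)).
rewrite ltnS in ab; have vb' : vertex b by lia.
have [c c0 Hc] := IH vb' ab.
have [x Hx] : exists x, xi b x <> 0 by apply: xi_neq0; lia.
have [d Hd] := is_mult_exists (@nak_idemM k n m) (@nak_sandwich k n m) (xi b) vb' vb.
have d0 := is_mult_nonzero Hd Hx.
exists (d * c); first by rewrite mulf_neq0.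
apply: (is_mult_comp (@nakW_mul k n m) va vb (b := b)) Hc Hd _; first by lia.
by move=> p; rewrite (xi_compS ab).
Qed.

Lemma hom_span a b (f : {linear P a -> P b}) : vertex a -> vertex b -> (a <= b)%N ->
  exists c, forall p, f p = kalg_map N c *: xi_comp xi a b p.
Proof.
move=> va vb ab; have [c c0 Hc] := xi_comp_mult va vb ab.
exact: (is_mult_span (@nak_idemM k n m) (@nak_sandwich k n m) f va vb c0 Hc).
Qed.

Lemma hom_up a b (f : {linear P a -> P b}) : vertex a -> vertex b -> (b < a)%N ->
  forall p, f p = 0.
Proof.
exact: (is_mult_up (@nak_idemM k n m) (@nak_sandwich k n m) (@nakW_up k n m)).
Qed.

Lemma hom_free a b d : vertex a -> vertex b -> (a <= b < a + m)%N ->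
  (forall p, kalg_map N d *: xi_comp xi a b p = 0) -> d = 0.
Proof.
move=> va vb ab; have [c c0 Hc] := xi_comp_mult va vb (proj1 (andP ab)).
exact: (is_mult_free (@nakW_id k n m) (@nakW_up k n m) (@nakW_mul k n m)
  (@nakW_free k n m) va vb ab c0 Hc).
Qed.

(** Uniform notation for the four kinds of summands. The outer terms: [None] is
    the zero term, [Some j] on the left is P_j and [Some i] on the right is
    P_(m + i). *)
Definition lterm (l : option nat) : lmodType N := if l is Some j then P j else zmod N.
Definition rterm (r : option nat) : lmodType N := if r is Some i then P (m + i) else zmod N.

Definition lmor l : {linear lterm l -> P m} :=
  match l with Some j => xi_comp xi j m | None => lin_zero (zmod N) (P m) end.
Definition rmor r : {linear P m -> rterm r} :=
  match r with Some i => xi_comp xi m (m + i) | None => lin_zero (P m) (zmod N) end.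

Definition lok (l : option nat) := if l is Some j then (0 < j < m)%N else true.
Definition rok (r : option nat) := if r is Some i then (0 < i < u)%N else true.

(** The orders for which lmor and rmor factor: the zero term is the least on the
    left and the greatest on the right. *)
Definition lle (l l' : option nat) :=
  match l, l' with None, _ => true | Some j, Some j' => (j <= j')%N | _, _ => false end.
Definition rle (r r' : option nat) :=
  match r, r' with _, None => true | Some i, Some i' => (i <= i')%N | _, _ => false end.

Lemma vm : vertex m. Proof. lia. Qed.
Lemma vl j : (0 < j < m)%N -> vertex j. Proof. lia. Qed.
Lemma vr i : (0 < i < u)%N -> vertex (m + i). Proof. lia. Qed.

Lemma hom_m_l l (phi : {linear P m -> lterm l}) x : lok l -> phi x = 0.
Proof.
case: l phi => [j|] phi /= ok; last exact: (@zmod_eq0 k N (phi x)).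
by apply: hom_up; [exact: vm|exact: vl|lia].
Qed.

Lemma hom_r_m r (phi : {linear rterm r -> P m}) x : rok r -> phi x = 0.
Proof.
case: r phi x => [i|] phi x /= ok; last by rewrite (@zmod_eq0 k N x) linear0.
by apply: hom_up; [exact: vr|exact: vm|lia].
Qed.

Lemma hom_r_l r l (phi : {linear rterm r -> lterm l}) x : rok r -> lok l -> phi x = 0.
Proof.
case: r phi x => [i|] phi x /= okr; last by rewrite (@zmod_eq0 k N x) linear0.
case: l phi => [j|] phi /= okl; last exact: (@zmod_eq0 k N (phi x)).
by apply: hom_up; [exact: vr|exact: vl|lia].
Qed.

Lemma hom_l_m l (phi : {linear lterm l -> P m}) : lok l ->
  exists c, forall x, phi x = kalg_map N c *: lmor l x.
Proof.
case: l phi => [j|] phi /= ok; last first.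
  by exists 0 => x; rewrite (@zmod_eq0 k N x) !linear0 scaler0.
by apply: hom_span; [exact: vl|exact: vm|lia].
Qed.

Lemma hom_m_r r (phi : {linear P m -> rterm r}) : rok r ->
  exists c, forall x, phi x = kalg_map N c *: rmor r x.
Proof.
case: r phi => [i|] phi /= ok; last first.
  by exists 0 => x; rewrite scaler0; apply: (@zmod_eq0 k N (phi x)).
by apply: hom_span; [exact: vm|exact: vr|lia].
Qed.

Lemma hom_l_r l r (phi : {linear lterm l -> rterm r}) : lok l -> rok r ->
  exists c, forall x, phi x = kalg_map N c *: rmor r (lmor l x).
Proof.
case: l phi => [j|] phi okl; last first.
  by exists 0 => x; rewrite (@zmod_eq0 k N x) !linear0 scaler0.
case: r phi => [i|] phi okr; last first.
  by exists 0 => x; rewrite scaler0; apply: (@zmod_eq0 k N (phi x)).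
have [|||c Hc] := hom_span phi; [exact: vl|exact: vr|by move: okl => /=; lia|].
exists c => x; rewrite Hc /= xi_comp_comp //; move: okl => /=; lia.
Qed.

Lemma lmor_inj l l' (a : {linear lterm l -> lterm l'}) : lok l -> lok l' ->
  (forall x, lmor l' (a x) = 0) -> forall x, a x = 0.
Proof.
case: l a => [j|] a okl; last by move=> _ _ x; rewrite (@zmod_eq0 k N x) linear0.
case: l' a => [j'|] a okl' H x; last exact: (@zmod_eq0 k N (a x)).
have [jj|jj] := leqP j j'; last by apply: hom_up; [exact: vl|exact: vl|].
have [c Hc] := hom_span a (vl okl) (vl okl') jj.
suff c0 : c = 0 by rewrite Hc c0; apply: kalg_scale0.
apply: (hom_free (vl okl) vm); first by move: okl => /=; lia.
move=> p; have := H p; rewrite /= Hc linearZ /= xi_comp_comp //.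
by rewrite jj /=; move: okl' => /=; lia.
Qed.

Lemma rmor_epi r r' (b : {linear rterm r -> rterm r'}) : rok r -> rok r' ->
  (forall x, b (rmor r x) = 0) -> forall x, b x = 0.
Proof.
case: r b => [i|] b okr; last by move=> _ _ x; rewrite (@zmod_eq0 k N x) linear0.
case: r' b => [i'|] b okr' H x; last exact: (@zmod_eq0 k N (b x)).
have [ii|ii] := leqP i i'; last by apply: hom_up; [exact: vr|exact: vr|lia].
have [|c Hc] := hom_span b (vr okr) (vr okr'); first lia.
suff c0 : c = 0 by rewrite Hc c0; apply: kalg_scale0.
apply: (hom_free vm (vr okr')); first by move: okr' => /=; lia.
move=> p; have := H p; rewrite /= Hc xi_comp_comp //; lia.
Qed.

Lemma lmor_factor l l' : lok l' -> lle l l' ->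
  exists a : {linear lterm l -> lterm l'}, forall x, lmor l' (a x) = lmor l x.
Proof.
case: l => [j|]; last first.
  by move=> _ _; exists (lin_zero (zmod N) (lterm l')) => x; rewrite linear0.
case: l' => [j'|] //= => /= ok jj; exists (xi_comp xi j j') => x.
by apply: xi_comp_comp; lia.
Qed.

Lemma rmor_factor r r' : rle r r' ->
  exists b : {linear rterm r -> rterm r'}, forall x, b (rmor r x) = rmor r' x.
Proof.
case: r' => [i'|]; last by exists (lin_zero (rterm r) (zmod N)).
case: r => [i|] //= ii; exists (xi_comp xi (m + i) (m + i')) => x.
by apply: xi_comp_comp; lia.
Qed.

Lemma lmor_nfactor l l' : lok l -> lok l' -> ~~ lle l l' ->
  forall c (a : {linear lterm l -> lterm l'}),
    (forall x, lmor l' (a x) = kalg_map N c *: lmor l x) -> c = 0.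
Proof.
case: l => [j|] //= okl; case: l' => [j'|] /= okl' jj c a H;
  apply: (hom_free (vl okl) vm (d := c)); try lia; move=> p; rewrite -H //.
by rewrite (hom_up a (vl okl) (vl okl')) ?linear0 // ltnNge.
Qed.

Lemma rmor_nfactor r r' : rok r -> rok r' -> ~~ rle r r' ->
  forall c (b : {linear rterm r -> rterm r'}),
    (forall x, b (rmor r x) = kalg_map N c *: rmor r' x) -> c = 0.
Proof.
case: r' => [i'|]; last by case: r.
case: r => [i|] /= okr okr' ii c b H;
  apply: (hom_free vm (vr okr') (d := c)); try lia; move=> p; rewrite -H.
  by rewrite (hom_up b) //; [exact: vr|exact: vr|lia].
exact: linear0.
Qed.

Lemma hom_m_m (phi : {linear P m -> P m}) : exists c, forall x, phi x = kalg_map N c *: x.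
Proof.
have [c Hc] := hom_span phi vm vm (leqnn _); exists c => x.
by rewrite Hc xi_comp_id.
Qed.

Lemma scale_m_free c : (forall x : P m, kalg_map N c *: x = 0) -> c = 0.
Proof.
move=> H; apply: (hom_free vm vm); first lia.
by move=> p; rewrite xi_comp_id.
Qed.

(** * The summands of T and the vertices of the quiver *)

Local Notation Q := (br_quiver u v).

(** The labels of the summand at each vertex: t_1, ..., t_u are E_1, ...,
    E_(u-1), P_m, then b_1, ..., b_u are G_1, ..., G_(u-1), F_u, and
    c_1, ..., c_v are F_(u+1), ..., F_(u+v). *)
Definition lft (x : Q) : option nat :=
  match x with
  | inl (inl _) => None
  | inl (inr i) => Some i.+1
  | inr i => Some (u + i.+1)%N
  end.

Definition rgt (x : Q) : option nat :=
  match x with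
  | inl (inl i) => if i.+1 == u then None else Some i.+1
  | inl (inr i) => if i.+1 == u then None else Some i.+1
  | inr _ => None
  end.

Lemma lft_ok x : lok (lft x).
Proof.
case: x => [[i|i]|i] //; rewrite /lok [lft _]/=; have := ltn_ord i; lia.
Qed.

Lemma rgt_ok x : rok (rgt x).
Proof.
case: x => [[i|i]|i] //; rewrite /rok [rgt _]/=; case: eqP => //; have := ltn_ord i; lia.
Qed.

Lemma br_le_label x y : br_le x y = lle (lft x) (lft y) && rle (rgt x) (rgt y).
Proof.
case: x => [[i|i]|i]; case: y => [[j|j]|j]; rewrite /=;
  have := ltn_ord i; have := ltn_ord j; do ?[case: eqP => ?]; rewrite /=; lia.
Qed.

Lemma lterm_fg l : fin_gen (lterm l).
Proof. by case: l => [j|]; [exact: fin_gen_nakP|exact: fin_gen_zmod]. Qed.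

Lemma rterm_fg r : fin_gen (rterm r).
Proof. by case: r => [j|]; [exact: fin_gen_nakP|exact: fin_gen_zmod]. Qed.

Lemma label_comp0 x z : rmor (rgt x) (lmor (lft x) z) = 0.
Proof.
case: x z => [[i|i]|i] z //; first exact: linear0.
rewrite [rgt _]/=; case: eqP => // _; exact: (@xi_comp0 k u v xi i.+1 z).
Qed.

Definition label_cplx l r (H : forall z, rmor r (lmor l z) = 0) : cplx N :=
  cplx3 H (lterm_fg l) (fin_gen_nakP k n m m) (rterm_fg r).

Definition summand (x : Q) : cplx N := label_cplx (@label_comp0 x).

Lemma summand_eq x l r (H : forall z, rmor r (lmor l z) = 0) fgM fgP fgL :
  lft x = l -> rgt x = r -> summand x = cplx3 (f := lmor l) (g := rmor r) H fgM fgP fgL.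
Proof.
move=> el er; rewrite /summand; move: (@label_comp0 x); rewrite el er => H'.
by rewrite /label_cplx; congr cplx3; apply: Prop_irrelevance.
Qed.

(** The vertices in the order of the summands of T. The default values of
    [insubd] are not taken at the indices in use. *)
Definition vt (i : nat) : Q := inl (inl (insubd (Ordinal u_ge1) i)).
Definition vb (i : nat) : Q := inl (inr (insubd (Ordinal u_ge1) i)).
Definition vF (j : nat) : Q :=
  if j == u then vb u.-1 else inr (insubd (Ordinal v_ge1) (j - u).-1).

Definition vertices : seq Q :=
  vt u.-1 :: [seq vt i.-1 | i <- index_iota 1 u]
          ++ [seq vF j | j <- index_iota u (u + v).+1]
          ++ [seq vb l.-1 | l <- index_iota 1 u].

Lemma Tcplx_summands : Tcplx xi = dsum (map summand vertices).
Proof.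
have subE i : (i < u)%N -> insubd (Ordinal u_ge1) i = i :> nat.
  by move=> iu; rewrite val_insubd iu.
have subF i : (i < v)%N -> insubd (Ordinal v_ge1) i = i :> nat.
  by move=> iu; rewrite val_insubd iu.
have u1 : (u.-1 < u)%N by lia.
have u2 : u.-1.+1 = u by lia.
rewrite /Tcplx /vertices map_cons !map_cat -!map_comp; congr dsum; congr (_ :: _ ++ _ ++ _).
- apply: esym; apply: (@summand_eq (vt u.-1) None None) => //.
  by rewrite [rgt _]/= subE // u2 eqxx.
- apply/eq_in_map => i; rewrite mem_index_iota => /andP[i1 iu]; apply: esym.
  apply: (@summand_eq _ None (Some i)); rewrite // [rgt _]/= subE ?prednK //; last by lia.
  by rewrite ltn_eqF.
- apply/eq_in_map => j; rewrite mem_index_iota => /andP[uj juv]; apply: esym.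
  apply: (@summand_eq _ (Some j) None); rewrite /vF; case: eqP => ju.
  + by rewrite [lft _]/= subE // u2 ju.
  + by rewrite [lft _]/= subF; [congr Some|]; lia.
  + by rewrite [rgt _]/= subE // u2 eqxx.
  + by [].
- apply/eq_in_map => l; rewrite mem_index_iota => /andP[l1 lu]; apply: esym.
  have lu' : (l.-1 < u)%N by lia.
  apply: (@summand_eq _ (Some l) (Some l)); rewrite [LHS]/= subE // prednK // ltn_eqF //.
Qed.

Lemma mem_vertices x : x \in vertices.
Proof.
have vtE (i : 'I_u) : inl (inl i) = vt i by rewrite /vt valKd.
have vbE (i : 'I_u) : inl (inr i) = vb i by rewrite /vb valKd.
have vFE (i : 'I_v) : inr i = vF (u + i.+1).
  by rewrite /vF (_ : (u + i.+1 == u)%N = false) ?addKn ?valKd //; lia.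
rewrite /vertices in_cons !mem_cat; case: x => [[i|i]|i].
- rewrite vtE; have [iu|iu] := eqVneq i.+1 u; first by rewrite (_ : u.-1 = i) ?eqxx //; lia.
  rewrite (map_f (fun j => vt j.-1) (x := i.+1)) ?orbT // mem_index_iota.
  by have := ltn_ord i; lia.
- rewrite vbE; have [iu|iu] := eqVneq i.+1 u.
    have -> : vb i = vF u by rewrite /vF eqxx (_ : u.-1 = i) //; lia.
    by rewrite (map_f vF) ?orbT // mem_index_iota; lia.
  rewrite (map_f (fun j => vb j.-1) (x := i.+1)) ?orbT // mem_index_iota.
  by have := ltn_ord i; lia.
- rewrite vFE (map_f vF) ?orbT // mem_index_iota.
  by have := ltn_ord i; lia.
Qed.

Lemma uniq_vertices : uniq vertices.
Proof.
apply: (@leq_size_uniq _ (enum Q)); first exact: enum_uniq.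
  by move=> x _; apply: mem_vertices.
rewrite -cardE !card_sum !card_ord /= !size_cat !size_map !size_iota; lia.
Qed.

(** * Maps between the summands *)

Lemma liftable_nakP a : liftable (P a).
Proof. exact: (liftable_lideal (nak_idemM k n m a)). Qed.

Lemma kproj_summand x : kproj (summand x).
Proof.
apply: kproj_cplx3; last 1 first.
- by case: (rgt x) => [i|]; [exact: liftable_nakP|exact: liftable_zmod].
- by case: (lft x) => [i|]; [exact: liftable_nakP|exact: liftable_zmod].
- exact: liftable_nakP.
Qed.

Lemma In_map (I : eqType) (T : Type) (f : I -> T) (s : seq I) y :
  List.In y (map f s) <-> exists2 x, x \in s & y = f x.
Proof.
elim: s => [|x s IH] /=; first by split=> // -[].
split=> [[<-|/IH [z zs ->]]|[z]].
- by exists x; rewrite ?mem_head.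
- by exists z; rewrite // in_cons zs orbT.
by rewrite in_cons => /orP[/eqP -> ->|zs zE]; [left|right; apply/IH; exists z].
Qed.

Lemma kproj_T : kproj (Tcplx xi).
Proof.
rewrite Tcplx_summands; apply: kproj_dsum => X /In_map [x _ ->].
exact: kproj_summand.
Qed.

Lemma summand_shift_null x y d (s : cmap (summand x) (shift d (summand y))) :
  d != 0 -> homotopic s (cmap_zero _ _).
Proof.
have lx := lft_ok x; have ly := lft_ok y; have rx := rgt_ok x; have ry := rgt_ok y.
move=> d0; apply: cplx3_shift_null => //.
- by move=> phi z; apply: hom_m_l.
- by move=> phi z; apply: hom_r_m.
- by move=> phi z; apply: hom_r_l.
- by move=> phi; apply: hom_l_m.
- by move=> phi; apply: hom_m_r.
- by move=> phi; apply: hom_l_r.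
case El : (lft x) lx => [j|] lx; last by constructor 1 => z; apply: (@zmod_eq0 k N z).
case Er : (rgt y) ry => [i|] ry; last first.
  by constructor 3; apply: rmor_factor; case: (rgt x).
have [ij|ji] := ltnP i j.
  constructor 2 => c Hc; apply: (hom_free (vl lx) (vr ry)).
    by move: lx ry; rewrite /=; lia.
  move=> p; rewrite -[RHS](Hc p) /= xi_comp_comp //.
  by move: lx; rewrite /=; lia.
(* Here j <= i < u, so the source is G_j: its left and right labels agree. *)
constructor 3; apply: rmor_factor; rewrite [rok _]/= in ry.
case: x El {s lx rx} => [[a|a]|a] //= -[ja]; last by lia.
by case: eqP => au /=; lia.
Qed.

(** The identity of P_m extends to the outer terms when neither label
    decreases. *)
Lemma summand_map_exists x y : exists h : cmap (summand x) (summand y),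
  br_le x y -> forall z : P m, h 0 z = z.
Proof.
have [xy|xy] := boolP (br_le x y); last by exists (cmap_zero _ _).
move: xy; rewrite br_le_label => /andP[lxy rxy].
have [a Ha] := lmor_factor (lft_ok y) lxy; have [b Hb] := rmor_factor rxy.
by exists (cplx3_map (@label_comp0 x) (@label_comp0 y) (lterm_fg _) (lterm_fg _)
  (fin_gen_nakP k n m m) (fin_gen_nakP k n m m) (rterm_fg _) (rterm_fg _) Ha Hb).
Qed.

Definition summand_map x y : cmap (summand x) (summand y) :=
  sval (cid (summand_map_exists x y)).

Lemma summand_map0 x y z : br_le x y -> summand_map x y 0 z = z.
Proof. by move=> xy; apply: (svalP (cid (summand_map_exists x y)) xy z). Qed.

Lemma summand_map_uniq x y (s t : cmap (summand x) (summand y)) :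
  (forall z : P m, s 0 z = t 0 z) -> forall i z, s i z = t i z.
Proof.
apply: cplx3_map_uniq.
- by move=> a; apply: lmor_inj; apply: lft_ok.
- by move=> b; apply: rmor_epi; apply: rgt_ok.
Qed.

Lemma dEnd_T : dEnd_isom (Tcplx xi) (branch_alg k u v).
Proof.
have kT := kproj_T; rewrite Tcplx_summands in kT *.
refine (@dEnd_incidence k N Q summand (@br_le u v) summand_map _ _ _ _ _ (branch_alg k u v)
  (@bq_entry k Q (@br_rel k u v)) _ _ _ _ _ _ _ vertices _ _ _) => //.
- move=> x i z; apply: (@summand_map_uniq x x (summand_map x x) (cmap_id _)) => p.
  by rewrite summand_map0 ?br_le_refl.
- move=> x y w i z xy yw.
  apply: (@summand_map_uniq x w (cmap_comp (summand_map y w) (summand_map x y))) => p.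
  rewrite /= [summand_map x y 0 p]summand_map0 // summand_map0 // summand_map0 //.
  exact: br_le_trans xy yw.
- move=> x y f xy; apply: cplx3_map_span.
  + by move=> a; apply: lmor_inj; apply: lft_ok.
  + by move=> b; apply: rmor_epi; apply: rgt_ok.
  + exact: hom_m_m.
  + by move=> z; apply: summand_map0.
- move=> x y f xy; apply: cplx3_map_null.
  + by move=> a; apply: lmor_inj; apply: lft_ok.
  + by move=> b; apply: rmor_epi; apply: rgt_ok.
  + exact: hom_m_m.
  move: xy; rewrite br_le_label negb_and => /orP[lxy|rxy]; [left|right].
    by apply: lmor_nfactor => //; apply: lft_ok.
  by apply: rmor_nfactor => //; apply: rgt_ok.
- move=> x y c xy; apply: cplx3_map_free.
  + by move=> phi z; apply: hom_m_l; apply: lft_ok.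
  + by move=> phi z; apply: hom_r_m; apply: rgt_ok.
  + exact: scale_m_free.
  + by move=> z; apply: summand_map0.
- by move=> x y; apply: bq_entry1; exact: br_rel_entry.
- by move=> a b x y; apply: bq_entryD; exact: br_rel_entry.
- by move=> a b x y; apply: bq_entryM; exact: br_rel_entry.
- by move=> s b x y; apply: bq_entryZ; exact: br_rel_entry.
- by move=> b x y; apply: bq_entry_nle; exact: br_path_le.
- move=> a b; apply: bq_entry_inj; [exact: br_path_le|exact: br_le_path|exact: br_parallel].
- move=> d; apply: bq_entry_surj; [exact: br_le_path|exact: br_rel_entry].
- exact: uniq_vertices.
- exact: mem_vertices.
Qed.

(** * Generation from the summands *)

(** P_a with a < m comes from G_a or F_a, and P_a with a > m from E_(a-m). *)
Lemma thick_stalk (C : cplx N -> Prop) : thick C -> C (Tcplx xi) ->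
  forall a (fgP : fin_gen (P a)), vertex a -> C (stalk fgP).
Proof.
move=> thC CT a fgP va.
have CX X : List.In X (Pcplx k u v :: [seq Ecplx xi i | i <- index_iota 1 u]
     ++ [seq Fcplx xi j | j <- index_iota u (u + v).+1]
     ++ [seq Gcplx xi l | l <- index_iota 1 u]) -> C X.
  exact: (thick_dsum thC CT).
have CP : C (Pcplx k u v) by apply: CX; left.
have CE i : (1 <= i < u)%N -> C (Ecplx xi i).
  move=> iu; apply: CX; right; apply/List.in_or_app; left; apply/In_map.
  by exists i; rewrite // mem_index_iota.
have CF j : (u <= j < (u + v).+1)%N -> C (Fcplx xi j).
  move=> ju; apply: CX; right; apply/List.in_or_app; right; apply/List.in_or_app; left.
  by apply/In_map; exists j; rewrite // mem_index_iota.
have CG l : (1 <= l < u)%N -> C (Gcplx xi l).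
  move=> lu; apply: CX; right; apply/List.in_or_app; right; apply/List.in_or_app; right.
  by apply/In_map; exists l; rewrite // mem_index_iota.
have [am|ma] := ltnP a m.
  have [au|ua] := ltnP a u.
    by refine (thick_term_left (f := xi_comp xi a m) (g := xi_comp xi m (m + a)) thC
      fgP (CE a _) (CG a _)); lia.
  by refine (thick_term_left (f := xi_comp xi a m) (g := lin_zero (P m) (zmod N)) thC
    fgP CP (CF a _)); lia.
move: ma; rewrite leq_eqVlt => /orP[/eqP ma|ma].
  subst a; have -> : fgP = fin_gen_nakP k n m m by apply: Prop_irrelevance.
  exact: CP.
have Ea : a = (m + (a - m))%N by lia.
move: fgP; rewrite Ea => fgP.
refine (thick_term_right (g := xi_comp xi m (m + (a - m))) thC fgP (CE (a - m)%N _) CP); lia.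
Qed.

Lemma tilting_T : tilting (Tcplx xi).
Proof.
split.
  move=> d r d0; apply: droof_null; first exact: kproj_T.
  move: r => _; rewrite Tcplx_summands.
  apply: null_dsum_shift => X Y /In_map [x _ ->] /In_map [y _ ->] s.
  exact: summand_shift_null.
move=> C thC CT.
apply: (@stalks_generate k N n (fun x => E x.+1) (fun x y => W x.+1 y.+1) _ _ _ _ _ C) => //.
- exact: nak_idem_sum.
- by move=> x; apply: nak_idemM.
- by move=> x y z; apply: nak_sandwich; rewrite /= ltn_ord.
- by move=> x; apply: nakW_id; rewrite /= ltn_ord.
- by move=> x y xy; apply: nakW_up.
- by exists (Tcplx xi).
- by move=> x fgP; apply: (thick_stalk thC CT); rewrite /= ltn_ord.
Qed.

End Tilting.

Theorem proposition5p6 (k : closedFieldType) (u v : nat)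
    (xi : forall a : nat, {linear nakP k (2 * u + v) (u + v + 1) a ->
                                  nakP k (2 * u + v) (u + v + 1) a.+1})
    (u_ge1 : (1 <= u)%N) (v_ge1 : (1 <= v)%N)
    (xi_neq0 : forall a : nat, (1 <= a <= 2 * u + v - 1)%N ->
                 exists x, xi a x <> 0) :
  tilting (Tcplx xi) /\ dEnd_isom (Tcplx xi) (branch_alg k u v).
Proof. by split; [exact: tilting_T | exact: dEnd_T]. Qed.
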